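(* Let $q=e^{2\pi i z}$, $\eta(z)=q^{1/24}\prod_{n\ge1}(1-q^n)$, and define \[ g_2(z)=\eta^6(4z),\qquad L_2(z)=\frac{\eta^6(8z)}{\eta^2(4z)\eta^4(16z)},\qquad H(z)=g_2(z)L_2^2(z)=\sum_{n\ge -1}C(n)q^n . \] For every prime $p\equiv 3\pmod 4$ and every integer $m\ge 0$, \[ v_p\big(C(p^{2m+1})\big)=2m,\qquad v_p\!\left(\frac{H\,|\,U(p^{2m+1})}{C(p^{2m+1})}-g_2\right)\ge 2m+2 . \]
   Context: $\sum a(n)q^n\,|\,U(m)=\sum a(mn)q^n$. For a formal Laurent series in $q$ with rational coefficients, $v_p$ is the minimum of the $p$-adic valuations of its coefficients ($v_p(0)=\infty$); for a rational number it is the usual $p$-adic valuation. $H$ has integer coefficients, $H=q^{-1}-2q^3-13q^7+\cdots$. *)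

(* Defs.v *)
From mathcomp Require Import all_boot all_order all_algebra.
Set Implicit Arguments. Unset Strict Implicit. Unset Printing Implicit Defensive.
Import Order.TTheory GRing.Theory Num.Theory.
Local Open Scope ring_scope.

Definition ps := nat -> int.

Definition psmul (f g : ps) : ps := fun n => \sum_(i < n.+1) f i * g (n - i)%N.
Definition ps1 : ps := fun n => if n == 0%N then 1 else 0.
Definition pspow (f : ps) (k : nat) : ps := iter k (psmul f) ps1.
Definition psdil (d : nat) (f : ps) : ps :=
  fun n => if (d %| n)%N then f (n %/ d)%N else 0.

(* Multiplicative inverse of a power series with constant term 1:
   b_0 = 1, b_n = - sum_{k=1}^n a_k b_{n-k}. *)
Fixpoint psinv_aux (f : ps) (n : nat) : seq int :=
  match n with
  | 0 => [:: 1]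
  | n'.+1 => let s := psinv_aux f n' in
             rcons s (- \sum_(i < n'.+1) f i.+1 * nth 0 s (n' - i)%N)
  end.
Definition psinv (f : ps) : ps := fun n => nth 0 (psinv_aux f n) n.

(* The product prod_{k>=1} (1 - q^k): its n-th coefficient is that of the
   finite product prod_{k=1}^{n} (1 - X^k). *)
Definition euler_ps : ps :=
  fun n => (\prod_(1 <= k < n.+1) (1 - 'X^k) : {poly int})`_n.

(* eta(d z) = q^{d/24} * euler_ps(q^d).  The q^{1/24}-powers are collected:
   g2 = eta^6(4z)                      = q^{24/24}  * G(q),
   L2 = eta^6(8z)/(eta^2(4z) eta^4(16z)) = q^{(48-8-64)/24} * L(q) = q^{-1} * L(q). *)
Definition g2_ps : ps := pspow (psdil 4 euler_ps) 6.
Definition L2_ps : ps :=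
  psmul (pspow (psdil 8 euler_ps) 6)
        (psinv (psmul (pspow (psdil 4 euler_ps) 2) (pspow (psdil 16 euler_ps) 4))).
(* H = g2 * L2^2 = q^{1-2} * (G * L^2) *)
Definition H_ps : ps := psmul g2_ps (pspow L2_ps 2).

(* Coefficient at q^n (n : int) of the Laurent series q^s * f(q). *)
Definition lcoef (s : int) (f : ps) (n : int) : int :=
  match n - s with Posz k => f k | Negz _ => 0 end.

Definition C (n : int) : int := lcoef (-1) H_ps n.
Definition g2coef (n : int) : int := lcoef 1 g2_ps n.

Definition vp (p : nat) (x : rat) : int :=
  (logn p `|numq x|%N)%:Z - (logn p `|denq x|%N)%:Z.
(* v_p(x) >= k, with the convention v_p(0) = +oo. *)
Definition vp_ge (p : nat) (x : rat) (k : int) : Prop := x = 0 \/ k <= vp p x.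

(* Main.v *)
From HB Require Import structures.
Require Import Defs.
From mathcomp Require Import all_boot all_order all_algebra.
From mathcomp Require Import boolp.
From mathcomp Require Import ring lra zify.
Import Order.TTheory GRing.Theory Num.Theory.
Set Implicit Arguments. Unset Strict Implicit. Unset Printing Implicit Defensive.
Local Open Scope ring_scope.

(** Put [t = 1/L2] and [f = (sum_n q^(4 n^2))^2].  Jacobi's relations make [f], as a
    series in [t], the solution [w] of Legendre's equation, so that
    [g2 = f (q dt/dq)] and [H = g3 + (q d/dq)^2 (1/(t f))] with [g3 = 16 g2 t^2];
    hence [C(N)] and the coefficient of [g3] agree modulo [N^2].  Integrated once,
    [g2] and [g3] become the explicit series [w] and [16 t^2 w] in [t], whose
    coefficients are squares of central binomial coefficients, and the quotient
    of the coefficient of [16 t^2 w] at [p y] by that of [w] at [y] is a constant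
    [gam] times [1 + O(p y)], by the [p]-adic behaviour of factorials.  The second
    solution [w log t + nu] of Legendre's equation gives [log q], and controls the
    Frobenius defect [log (s(t)^p / s(t^p))] of the series [q = s(t)].  Together
    these show that [g3 = gam g2(q^p)] up to coefficients at [q^N] divisible by
    [N^2].  Finally [g2] has complex multiplication by [Q(i)], so that
    [g2(p^2 n) = p^2 g2(n)] for [p = 3 mod 4]. *)

(** * Formal power series over the rationals *)

(** Two obstacles shape the argument. The congruence must hold modulo the square of the index, and
    dividing by that square is what integrating twice in log q does; so the aim becomes the
    p-integrality of the double integral of g3 minus gam / p^2 times that of g2 at q^p. In the
    variable t the first integrals have explicit coefficients, but the second integration is against
    d log q = dt/t + d(nu / w), and nu / w is not p-integral: its coefficient at p j is the one at j
    divided by p, up to integral terms. The loss is repaired by a Lipschitz estimate for (ratio /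
    gam - 1) / (p y) as a function of the index y. The natural value of gam is a p-adic number built
    from p-adic Gamma values, the square of a function of n at n = -3/4; it is replaced by the
    rational value at an n for which 4 n + 3 is a high odd power of p, the precision being chosen
    from the largest index considered. The residue of p modulo 4 enters twice: multiplication by p
    exchanges the classes 1 and 3 modulo 4 that carry the exponents of g2 and g3, and -1 is not a
    square modulo p. *)

Record fps := Fps { cf :> nat -> rat }.

Lemma fpsP (x y : fps) : (forall n, x n = y n) -> x = y.
Proof. by case: x y => [x] [y] /= /funext ->. Qed.

HB.instance Definition _ := gen_eqMixin fps.
HB.instance Definition _ := gen_choiceMixin fps.

Definition fps_add (x y : fps) := Fps (fun n => x n + y n).
Definition fps_opp (x : fps) := Fps (fun n => - x n).
Definition fps_zero := Fps (fun=> 0).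
Definition fps_mul (x y : fps) := Fps (fun n => \sum_(i < n.+1) x i * y (n - i)%N).
Definition fps_one := Fps (fun n => (n == 0%N)%:R).

Fact fps_addA : associative fps_add.
Proof. by move=> x y z; apply: fpsP => n; exact: addrA. Qed.
Fact fps_addC : commutative fps_add.
Proof. by move=> x y; apply: fpsP => n; exact: addrC. Qed.
Fact fps_add0 : left_id fps_zero fps_add.
Proof. by move=> x; apply: fpsP => n; exact: add0r. Qed.
Fact fps_addN : left_inverse fps_zero fps_opp fps_add.
Proof. by move=> x; apply: fpsP => n; exact: addNr. Qed.

HB.instance Definition _ :=
  GRing.isZmodule.Build fps fps_addA fps_addC fps_add0 fps_addN.

(** Truncations transport ring laws from polynomials: a coefficient of a product depends only on
    coefficients of no larger index. *)
Definition trunc (N : nat) (x : fps) : {poly rat} := \poly_(i < N) x i.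

Lemma coef_trunc N (x : fps) n : (n < N)%N -> (trunc N x)`_n = x n.
Proof. by move=> lt_nN; rewrite coef_poly lt_nN. Qed.

Lemma coef_truncM N (x y : fps) n :
  (n < N)%N -> (trunc N x * trunc N y)`_n = fps_mul x y n.
Proof.
move=> lt_nN; rewrite coefM; apply: eq_bigr => i _.
by rewrite !coef_trunc // ?(leq_ltn_trans _ lt_nN) ?leq_subr // -ltnS.
Qed.

Fact fps_mulC : commutative fps_mul.
Proof.
by move=> x y; apply: fpsP => n; rewrite -!(@coef_truncM n.+1) // mulrC.
Qed.
Fact fps_mulA : associative fps_mul.
Proof.
move=> x y z; apply: fpsP => n.
have lN i : (n - i < n.+1)%N by rewrite ltnS leq_subr.
have lt_i (i : 'I_n.+1) : (i < n.+1)%N by [].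
transitivity ((trunc n.+1 x * (trunc n.+1 y * trunc n.+1 z))`_n).
  rewrite coefM; apply: eq_bigr => i _.
  by rewrite coef_truncM ?coef_trunc.
rewrite mulrA coefM; apply: eq_bigr => i _.
by rewrite coef_truncM ?coef_trunc.
Qed.
Fact fps_mul1 : left_id fps_one fps_mul.
Proof.
move=> x; apply: fpsP => n; rewrite /= big_ord_recl subn0 mul1r big1 ?addr0 //.
by move=> i _; rewrite mul0r.
Qed.
Fact fps_mulDl : left_distributive fps_mul fps_add.
Proof.
move=> x y z; apply: fpsP => n /=; rewrite -big_split.
by apply: eq_bigr => i _; rewrite mulrDl.
Qed.
Fact fps_one_neq0 : fps_one != 0 :> fps.
Proof. by apply/eqP => /(congr1 (fun x : fps => x 0%N)) /eqP; rewrite oner_eq0. Qed.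

HB.instance Definition _ :=
  GRing.Zmodule_isComNzRing.Build fps fps_mulA fps_mulC fps_mul1 fps_mulDl fps_one_neq0.

Lemma cfD (x y : fps) n : (x + y) n = x n + y n. Proof. by []. Qed.
Lemma cfN (x : fps) n : (- x) n = - x n. Proof. by []. Qed.
Lemma cfB (x y : fps) n : (x - y) n = x n - y n. Proof. by []. Qed.
Lemma cf0 n : (0 : fps) n = 0. Proof. by []. Qed.
Lemma cf1 n : (1 : fps) n = (n == 0%N)%:R. Proof. by []. Qed.
Lemma cfM (x y : fps) n : (x * y) n = \sum_(i < n.+1) x i * y (n - i)%N.
Proof. by []. Qed.
Lemma cfMn (x : fps) k n : (x *+ k) n = x n *+ k.
Proof. by elim: k => // k IH; rewrite !mulrS cfD IH. Qed.
Lemma cf_sum I (r : seq I) (P : pred I) (F : I -> fps) n :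
  (\sum_(i <- r | P i) F i) n = \sum_(i <- r | P i) F i n.
Proof. by elim/big_rec2: _ => // i a b _ <-. Qed.
Lemma cf0M (x y : fps) : (x * y) 0%N = x 0%N * y 0%N.
Proof. by rewrite cfM big_ord1. Qed.
Lemma cf0X (x : fps) k : (x ^+ k) 0%N = x 0%N ^+ k.
Proof. by elim: k => // k IH; rewrite !exprS cf0M IH. Qed.

Definition fpsC (c : rat) := Fps (fun n => if n == 0%N then c else 0).

Lemma cfCM c (x : fps) n : (fpsC c * x) n = c * x n.
Proof.
by rewrite cfM big_ord_recl subn0 big1 ?addr0 // => i _; rewrite mul0r.
Qed.
Lemma fpsCD a b : fpsC (a + b) = fpsC a + fpsC b.
Proof. by apply: fpsP => -[|n]; rewrite cfD /= ?addr0. Qed.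
Lemma fpsCN a : fpsC (- a) = - fpsC a.
Proof. by apply: fpsP => -[|n]; rewrite cfN /= ?oppr0. Qed.
Lemma fpsC1 : fpsC 1 = 1. Proof. by apply: fpsP => -[|n]. Qed.
Lemma fpsCM a b : fpsC (a * b) = fpsC a * fpsC b.
Proof. by apply: fpsP => n; rewrite cfCM /=; case: n => [|n]; rewrite ?mulr0. Qed.
Lemma fpsC_nat k : fpsC k%:R = k%:R.
Proof.
elim: k => [|k IH]; first by apply: fpsP => -[|n].
by rewrite -addn1 !natrD fpsCD IH fpsC1.
Qed.

Definition qX := Fps (fun n => (n == 1%N)%:R).

Lemma cf_qXM (x : fps) n : (qX * x) n = if n is k.+1 then x k else 0.
Proof.
case: n => [|n]; first by rewrite cf0M mul0r.
rewrite cfM !big_ord_recl mul0r add0r mul1r subSS subn0 big1 ?addr0 // => i _.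
by rewrite mul0r.
Qed.

Lemma cf_qXn k n : (qX ^+ k) n = (n == k)%:R.
Proof. by elim: k n => [|k IH] [|n] //; rewrite exprS cf_qXM ?IH. Qed.

Lemma cf_qXnM k (x : fps) n :
  (qX ^+ k * x) n = if (k <= n)%N then x (n - k)%N else 0.
Proof.
elim: k n => [|k IH] n; first by rewrite mul1r subn0.
by rewrite exprS -mulrA cf_qXM; case: n => // n; rewrite IH.
Qed.

(** * Congruence modulo a power of the variable *)

Definition eqm N (x y : fps) := forall n, (n < N)%N -> x n = y n.

Lemma eqm_refl N x : eqm N x x. Proof. by []. Qed.
Lemma eqm_sym N x y : eqm N x y -> eqm N y x.
Proof. by move=> H n lt; rewrite H. Qed.
Lemma eqm_trans N y x z : eqm N x y -> eqm N y z -> eqm N x z.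
Proof. by move=> H K n lt; rewrite H ?K. Qed.
Lemma eqm_le M N x y : (M <= N)%N -> eqm N x y -> eqm M x y.
Proof. by move=> le H n lt; apply: H; apply: leq_trans lt le. Qed.
Lemma eqmP x y : (forall N, eqm N x y) -> x = y.
Proof. by move=> H; apply: fpsP => n; apply: (H n.+1). Qed.
Lemma eqmD N x y x' y' : eqm N x x' -> eqm N y y' -> eqm N (x + y) (x' + y').
Proof. by move=> H K n lt; rewrite !cfD H ?K. Qed.
Lemma eqmM N x y x' y' : eqm N x x' -> eqm N y y' -> eqm N (x * y) (x' * y').
Proof.
move=> H K n lt; rewrite !cfM; apply: eq_bigr => i _.
by rewrite H ?K // (leq_ltn_trans _ lt) ?leq_subr // -ltnS.
Qed.
Lemma eqmX N x x' k : eqm N x x' -> eqm N (x ^+ k) (x' ^+ k).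
Proof. by move=> H; elim: k => // k IH; rewrite !exprS; apply: eqmM. Qed.
Lemma eqm_qXn N k (x : fps) : (N <= k)%N -> eqm N (qX ^+ k * x) 0.
Proof. by move=> le n lt; rewrite cf_qXnM leqNgt (leq_trans lt le). Qed.

(** * Composition *)

(** The sum stops at [k = n], which gives the true composite only when [t] has no constant term;
    hence that hypothesis in the multiplicative laws. *)
Definition scomp (x t : fps) := Fps (fun n => \sum_(k < n.+1) x k * (t ^+ k) n).

Lemma cfX0 (t : fps) k n : t 0%N = 0 -> (n < k)%N -> (t ^+ k) n = 0.
Proof.
move=> t0; elim: k n => // k IH n lt; rewrite exprS cfM big_ord_recl t0 mul0r add0r.
by rewrite big1 // => i _; rewrite IH ?mulr0 //= /bump leq0n; have := ltn_ord i; lia.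
Qed.

Lemma comp_le (x t : fps) n N : t 0%N = 0 -> (n < N)%N ->
  scomp x t n = \sum_(k < N) x k * (t ^+ k) n.
Proof.
move=> t0 lt; rewrite /= (big_ord_widen N (fun k => x k * (t ^+ k) n)) //.
rewrite [RHS](bigID (fun k : 'I_N => (k < n.+1)%N)) /= [X in _ + X]big1 ?addr0 //.
by move=> i; rewrite -leqNgt => le; rewrite cfX0 ?mulr0.
Qed.

Lemma compD x y t : scomp (x + y) t = scomp x t + scomp y t.
Proof.
apply: fpsP => n; rewrite cfD /= -big_split.
by apply: eq_bigr => i _; rewrite mulrDl.
Qed.
Lemma compN x t : scomp (- x) t = - scomp x t.
Proof.
apply: fpsP => n; rewrite cfN /= -sumrN.
by apply: eq_bigr => i _; rewrite mulNr.
Qed.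
Lemma compB x y t : scomp (x - y) t = scomp x t - scomp y t.
Proof. by rewrite compD compN. Qed.
Lemma compC c t : scomp (fpsC c) t = fpsC c.
Proof.
apply: fpsP => n; rewrite /= big_ord_recl big1 => [|i _]; last by rewrite mul0r.
by rewrite addr0 [X in _ * X]cf1; case: n => [|n]; rewrite /= ?mulr1 ?mulr0.
Qed.
Lemma comp1 t : scomp 1 t = 1. Proof. by rewrite -fpsC1 compC. Qed.
Lemma comp_nat k (t : fps) : scomp k%:R t = k%:R. Proof. by rewrite -fpsC_nat compC. Qed.

Lemma comp_qXn k (t : fps) : t 0%N = 0 -> scomp (qX ^+ k) t = t ^+ k.
Proof.
move=> t0; apply: fpsP => n; rewrite (@comp_le _ _ _ (maxn n k).+1) //; last by lia.
have lt : (k < (maxn n k).+1)%N by lia.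
rewrite (bigD1 (Ordinal lt)) //= cf_qXn eqxx mul1r big1 ?addr0 // => i ne.
rewrite cf_qXn; case: eqP => [e|_]; last by rewrite mul0r.
by case/eqP: ne; apply: val_inj.
Qed.
Lemma comp_qX (t : fps) : t 0%N = 0 -> scomp qX t = t.
Proof. by move=> t0; have := comp_qXn 1 t0. Qed.

Lemma compM (x : fps) (y : fps) (t : fps) : t 0%N = 0 -> scomp (x * y) t = scomp x t * scomp y t.
Proof.
move=> t0; apply: fpsP => n.
have -> : (scomp x t * scomp y t) n =
    \sum_(i < n.+1) \sum_(j < n.+1) x i * y j * (t ^+ (i + j)) n.
  rewrite cfM.
  transitivity (\sum_(a < n.+1) \sum_(i < n.+1) \sum_(j < n.+1)
     (x i * y j) * ((t ^+ i) a * (t ^+ j) (n - a)%N)).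
    apply: eq_bigr => a _.
    rewrite !(@comp_le _ _ _ n.+1) //; last by rewrite ltnS leq_subr.
    rewrite mulr_suml; apply: eq_bigr => i _; rewrite mulr_sumr.
    by apply: eq_bigr => j _; rewrite mulrACA.
  rewrite exchange_big; apply: eq_bigr => i _ /=.
  rewrite exchange_big; apply: eq_bigr => j _ /=.
  by rewrite -mulr_sumr -cfM exprD.
transitivity (\sum_(k < n.+1) \sum_(i < k.+1) x i * y (k - i)%N * (t ^+ k) n).
  by apply: eq_bigr => k _; rewrite cfM mulr_suml.
transitivity (\sum_(k < n.+1) \sum_(i < n.+1 | (i <= k)%N)
   x i * y (k - i)%N * (t ^+ k) n).
  apply: eq_bigr => k _.
  by rewrite (big_ord_widen n.+1 (fun i => x i * y (k - i)%N * (t ^+ k) n)).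
rewrite (exchange_big_dep xpredT) //=; apply: eq_bigr => i _.
have le_in : (i <= n)%N by rewrite -ltnS.
transitivity (\sum_(j < (n - i).+1) x i * y j * (t ^+ (i + j)) n).
  rewrite -(big_mkord (fun k => (i <= k)%N)
    (fun k => x i * y (k - i)%N * (t ^+ k) n)).
  rewrite (@big_cat_nat _ _ _ i) //=; last by rewrite ltnW // ltnS.
  rewrite big_nat_cond big1 => [|k]; last by case/andP=> /andP[_ lt] le; lia.
  rewrite add0r -{1}(add0n i) big_addn big_nat_cond.
  rewrite -(big_mkord xpredT (fun j => x i * y j * (t ^+ (i + j)) n)).
  rewrite [in RHS]big_nat_cond subSn //.
  apply: eq_big => [k|k _]; first by rewrite leq_addl andbT.
  by rewrite addnK addnC.
rewrite (big_ord_widen n.+1 (fun j => x i * y j * (t ^+ (i + j)) n)) ?ltnS ?leq_subr //.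
rewrite [RHS](bigID (fun j : 'I_n.+1 => (j < (n - i).+1)%N)) /=.
rewrite [X in _ + X]big1 ?addr0 // => j lt.
by rewrite cfX0 ?mulr0 //; lia.
Qed.

Lemma compX (x : fps) (t : fps) k : t 0%N = 0 -> scomp (x ^+ k) t = scomp x t ^+ k.
Proof.
move=> t0; elim: k => [|k IH]; first exact: comp1.
by rewrite !exprS compM ?IH.
Qed.

Lemma comp_sum I (r : seq I) (P : pred I) (F : I -> fps) t :
  scomp (\sum_(i <- r | P i) F i) t = \sum_(i <- r | P i) scomp (F i) t.
Proof.
elim/big_rec2: _ => [|i a b _ <-]; last by rewrite compD.
exact: (comp_nat 0).
Qed.

Lemma eqm_comp N x x' (t t' : fps) : t 0%N = 0 -> eqm N x x' -> eqm N t t' ->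
  eqm N (scomp x t) (scomp x' t').
Proof.
move=> t0 H K n lt /=; apply: eq_bigr => k _.
rewrite H; last by apply: leq_ltn_trans lt; rewrite -ltnS.
by rewrite (eqmX k K).
Qed.

Lemma cf0_comp (x : fps) (t : fps) : scomp x t 0%N = x 0%N.
Proof. by rewrite /= big_ord1 mulr1. Qed.

Lemma eqm_sum_qXn N (x : fps) : eqm N x (\sum_(k < N) fpsC (x k) * qX ^+ k).
Proof.
move=> i lt; rewrite cf_sum (bigD1 (Ordinal lt)) // cfCM cf_qXn eqxx mulr1.
rewrite big1 => [|j ne]; [by rewrite /= addr0 | rewrite cfCM cf_qXn].
case: eqP => [e|_]; last by rewrite mulr0.
by case/eqP: ne; apply: val_inj.
Qed.

Lemma compA x (t u : fps) : t 0%N = 0 -> u 0%N = 0 ->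
  scomp (scomp x t) u = scomp x (scomp t u).
Proof.
move=> t0 u0; apply: fpsP => n.
have tu0 : scomp t u 0%N = 0 by rewrite cf0_comp.
pose X := \sum_(k < n.+1) fpsC (x k) * qX ^+ k.
have XE : eqm n.+1 x X := @eqm_sum_qXn _ x.
have lt : (n < n.+1)%N by [].
have r1 : scomp x (scomp t u) n = scomp X (scomp t u) n.
  by apply: (eqm_comp tu0 XE (@eqm_refl _ _)).
have r2 : scomp (scomp x t) u n = scomp (scomp X t) u n.
  by apply: (eqm_comp u0 (eqm_comp t0 XE (@eqm_refl _ _)) (@eqm_refl _ _)).
rewrite r1 r2 !comp_sum !cf_sum; apply: eq_bigr => k _.
by rewrite !compM ?compC ?comp_qXn ?compX //.
Qed.

Lemma comp_id x : scomp x qX = x.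
Proof.
apply: fpsP => n; rewrite /= big_ord_recr /= cf_qXn eqxx mulr1 big1 ?add0r //.
by move=> i _; rewrite cf_qXn gtn_eqF ?mulr0.
Qed.

(** * The derivation [q d/dq] *)

Definition D (x : fps) := Fps (fun n => n%:R * x n).
(** At index 0 the convention 1/0 = 0 makes the constant term vanish. *)
Definition integ (x : fps) := Fps (fun n => x n / n%:R).
Definition der (x : fps) := Fps (fun n => n.+1%:R * x n.+1).

Lemma cf_D x n : D x n = n%:R * x n. Proof. by []. Qed.
Lemma DD x y : D (x + y) = D x + D y.
Proof. by apply: fpsP => n; rewrite /= mulrDr. Qed.
Lemma DN x : D (- x) = - D x.
Proof. by apply: fpsP => n; rewrite /= mulrN. Qed.
Lemma DB x y : D (x - y) = D x - D y. Proof. by rewrite DD DN. Qed.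
Lemma DC c : D (fpsC c) = 0.
Proof. by apply: fpsP => -[|n]; rewrite /= ?mul0r ?mulr0. Qed.
Lemma D_nat k : D k%:R = 0. Proof. by rewrite -fpsC_nat DC. Qed.
Lemma D1 : D 1 = 0. Proof. exact: (D_nat 1). Qed.
Lemma DM x y : D (x * y) = D x * y + x * D y.
Proof.
apply: fpsP => n; rewrite cfD !cfM cf_D cfM mulr_sumr -big_split.
apply: eq_bigr => i _ /=.
have -> : n%:R = i%:R + (n - i)%:R :> rat by rewrite -natrD subnKC // -ltnS.
by ring.
Qed.
Lemma DCM c x : D (fpsC c * x) = fpsC c * D x.
Proof. by rewrite DM DC mul0r add0r. Qed.
Lemma DX x k : D (x ^+ k) = k%:R * x ^+ k.-1 * D x.
Proof.
elim: k => [|k IH]; first by rewrite D1 !mul0r.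
rewrite exprS DM IH; case: k {IH} => [|k]; first by rewrite /= !expr0 !mul0r mulr0; ring.
by rewrite exprS /= [k.+2%:R]mulrSr; ring.
Qed.
Lemma D_qX : D qX = qX.
Proof. by apply: fpsP => -[|[|n]]; rewrite /= ?mulr0 ?mulr1 ?mul0r. Qed.
Lemma D_sum I (r : seq I) (P : pred I) (F : I -> fps) :
  D (\sum_(i <- r | P i) F i) = \sum_(i <- r | P i) D (F i).
Proof.
elim/big_rec2: _ => [|i a b _ <-]; last by rewrite DD.
exact: (D_nat 0).
Qed.
Lemma eqm_D N x y : eqm N x y -> eqm N (D x) (D y).
Proof. by move=> H n lt; rewrite /= H. Qed.

Lemma D_integ (x : fps) : x 0%N = 0 -> D (integ x) = x.
Proof.
move=> x0; apply: fpsP => -[|n]; rewrite /= ?x0 ?mul0r //.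
by rewrite mulrCA divff ?mulr1 // pnatr_eq0.
Qed.
Lemma integ0 (x : fps) : integ x 0%N = 0. Proof. by rewrite /= invr0 mulr0. Qed.

Lemma D_eq (x : fps) (y : fps) : D x = D y -> x 0%N = y 0%N -> x = y.
Proof.
move=> H H0; apply: fpsP => -[//|n].
have /= := congr1 (fun z : fps => z n.+1) H.
by move/mulfI; apply; rewrite pnatr_eq0.
Qed.

Lemma D0_eq1 (x : fps) : D x = 0 -> x 0%N = 1 -> x = 1.
Proof. by move=> H H0; apply: D_eq; rewrite ?D1 // H0. Qed.

Lemma qX_der x : qX * der x = D x.
Proof. by apply: fpsP => n; rewrite cf_qXM; case: n => [|n] //=; rewrite mul0r. Qed.

Lemma der_qXn k : der (qX ^+ k) = k%:R * qX ^+ k.-1.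
Proof.
apply: fpsP => n; rewrite -fpsC_nat cfCM [LHS]/= !cf_qXn.
case: k => [|k] /=; first by rewrite mulr0 mul0r.
by rewrite eqSS; case: eqP => [->|]; rewrite ?mulr0.
Qed.

Lemma der_CM c x : der (fpsC c * x) = fpsC c * der x.
Proof. apply: fpsP => n; rewrite cfCM.
by rewrite -[LHS]/(n.+1%:R * (fpsC c * x) n.+1) cfCM mulrCA. Qed.

Lemma der_sum I (r : seq I) (P : pred I) (F : I -> fps) :
  der (\sum_(i <- r | P i) F i) = \sum_(i <- r | P i) der (F i).
Proof.
elim/big_rec2: _ => [|i a b _ <-]; apply: fpsP => n /=; first by rewrite mulr0.
by rewrite mulrDr.
Qed.

Lemma D_comp (x : fps) (t : fps) : t 0%N = 0 -> D (scomp x t) = scomp (der x) t * D t.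
Proof.
move=> t0; apply: fpsP => n; have lt : (n < n.+1)%N by [].
(* One coefficient more than the target precision, since [der] shifts the index by one. *)
pose X := \sum_(k < n.+2) fpsC (x k) * qX ^+ k.
have XE : eqm n.+2 x X := @eqm_sum_qXn _ x.
have dE : eqm n.+1 (der x) (der X) by move=> i li /=; rewrite XE.
have r1 : eqm n.+1 (scomp (der x) t * D t) (scomp (der X) t * D t).
  by apply: eqmM => //; apply: eqm_comp.
have r2 : eqm n.+1 (D (scomp x t)) (D (scomp X t)).
  by apply: eqm_D; apply: eqm_comp => //; apply: eqm_le XE.
rewrite r1 // r2 // comp_sum D_sum der_sum comp_sum mulr_suml.
congr (cf _ n); apply: eq_bigr => k _.
rewrite der_CM !compM // !compC DCM !comp_qXn // der_qXn compM // comp_nat.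
by rewrite comp_qXn // DX; ring.
Qed.

(** Chain rule q d/dq = Y (t d/dt): it lets the same operator [D] act on series in [t]. *)
Lemma D_comp_log (x : fps) (t : fps) Y : t 0%N = 0 -> D t = t * Y -> D (scomp x t) = scomp (D x) t * Y.
Proof.
move=> t0 Dt; rewrite D_comp // Dt -qX_der compM // comp_qX //.
by rewrite mulrCA mulrA.
Qed.

(** * Inverses *)

Definition geom := Fps (fun=> 1).

Lemma geomE : geom * (1 - qX) = 1.
Proof.
apply: fpsP => n; rewrite mulrBr mulr1 cfB mulrC cf_qXM.
by case: n => [|n]; rewrite /= ?subr0 ?subrr.
Qed.

(** After division by its constant term, [x] is 1 minus a series that can be substituted in the
    geometric series. Non-units are their own inverse, as the ring structure requires. *)
Definition fps_inv (x : fps) : fps :=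
  if x 0%N == 0 then x
  else fpsC (x 0%N)^-1 * scomp geom (1 - fpsC (x 0%N)^-1 * x).

Fact fps_mulVx : {in [pred x : fps | x 0%N != 0], left_inverse 1 fps_inv *%R}.
Proof.
move=> x /= nz; rewrite /fps_inv (negbTE nz).
set y := fpsC _ * x.
have y0 : (1 - y) 0%N = 0 by rewrite cfB cf1 cfCM mulVf ?subrr.
have := congr1 (scomp^~ (1 - y)) geomE.
rewrite compM // compB comp1 comp_qX // => H.
rewrite mulrAC mulrC -/y; apply: etrans H; ring.
Qed.

Fact fps_unitP x y : y * x = 1 -> [pred x : fps | x 0%N != 0] x.
Proof.
move=> /(congr1 (fun z : fps => z 0%N)); rewrite cf0M cf1 eqxx /= => H.
by apply/eqP => x0; move: H => /eqP; rewrite x0 mulr0 eq_sym oner_eq0.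
Qed.

Fact fps_inv0 : {in [predC [pred x : fps | x 0%N != 0]], fps_inv =1 id}.
Proof. by move=> x; rewrite inE /= negbK /fps_inv => ->. Qed.

HB.instance Definition _ :=
  GRing.ComNzRing_hasMulInverse.Build fps fps_mulVx fps_unitP fps_inv0.

Lemma unit_fps (x : fps) : (x \is a GRing.unit) = (x 0%N != 0). Proof. by []. Qed.
Lemma unit_fps1 (x : fps) : x 0%N = 1 -> x \is a GRing.unit.
Proof. by move=> e; rewrite unit_fps e oner_eq0. Qed.
Lemma cf0V (x : fps) : x \is a GRing.unit -> x^-1 0%N = (x 0%N)^-1.
Proof.
move=> u; have := congr1 (fun z : fps => z 0%N) (mulVr u).
rewrite cf0M cf1 eqxx => /= H; apply: (mulIf u).
by rewrite H mulVf.
Qed.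
Lemma DV x : x \is a GRing.unit -> D x^-1 = - (D x * x^-1 ^+ 2).
Proof.
move=> u; apply: (mulrI u); have := congr1 D (mulrV u).
rewrite DM D1 => /eqP; rewrite addrC addr_eq0 => /eqP ->.
have -> : x * - (D x * x^-1 ^+ 2) = - (D x * x^-1 * (x * x^-1)) by ring.
by rewrite mulrV // mulr1.
Qed.
Lemma comp_unit x t : (scomp x t \is a GRing.unit) = (x \is a GRing.unit).
Proof. by rewrite !unit_fps cf0_comp. Qed.
Lemma compV (x : fps) (t : fps) : t 0%N = 0 -> x \is a GRing.unit -> scomp x^-1 t = (scomp x t)^-1.
Proof.
move=> t0 u; have ut : scomp x t \is a GRing.unit by rewrite comp_unit.
by apply: (mulrI ut); rewrite -compM // !mulrV // comp1.
Qed.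

(** * Dilation and sign change *)

HB.lock Definition dil (d : nat) (x : fps) : fps := scomp x (qX ^+ d).

Definition sgn x := scomp x (- qX).

Lemma qXn0 d : (0 < d)%N -> (qX ^+ d : fps) 0%N = 0.
Proof. by case: d => // d _; rewrite cf_qXn. Qed.
Lemma NqX0 : (- qX) 0%N = 0. Proof. by rewrite cfN oppr0. Qed.

Lemma cf_dil d x n : (0 < d)%N ->
  dil d x n = if (d %| n)%N then x (n %/ d)%N else 0.
Proof.
move=> d0; rewrite dil.unlock /=; case: ifPn => [/dvdnP[k ->]|nd].
  rewrite mulnK //; have lt : (k < (k * d).+1)%N by rewrite ltnS leq_pmulr.
  rewrite (bigD1 (Ordinal lt)) //= -exprM cf_qXn (mulnC d k) eqxx mulr1 big1 ?addr0 //.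
  move=> i ne; rewrite -exprM cf_qXn; case: eqP => [/eqP|]; last by rewrite mulr0.
  rewrite [(d * i)%N]mulnC eqn_pmul2r // => /eqP e.
  by case/eqP: ne; apply: val_inj.
rewrite big1 // => i _; rewrite -exprM cf_qXn; case: eqP => [e|]; last by rewrite mulr0.
by case/negP: nd; rewrite e dvdn_mulr.
Qed.

Lemma cf_NqXn k n : ((- qX) ^+ k) n = (-1) ^+ k * (n == k)%:R.
Proof.
elim: k n => [|k IH] n; first by rewrite mul1r.
rewrite exprS mulNr cfN cf_qXM; case: n => [|n]; first by rewrite oppr0 mulr0.
by rewrite IH exprS eqSS mulN1r mulNr.
Qed.

Lemma cf_sgn x n : sgn x n = (-1) ^+ n * x n.
Proof.
rewrite /sgn /= big_ord_recr big1 => [|i _]; last first.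
  by rewrite cf_NqXn gtn_eqF /= ?mulr0.
by rewrite /= cf_NqXn eqxx mulr1 add0r mulrC.
Qed.

Section Dilation.
Variable (d : nat).
Hypothesis d0 : (0 < d)%N.
Let t0 := qXn0 d0.
Lemma dilD x y : dil d (x + y) = dil d x + dil d y. Proof. by rewrite !dil.unlock compD. Qed.
Lemma dilN x : dil d (- x) = - dil d x. Proof. by rewrite !dil.unlock compN. Qed.
Lemma dilB x y : dil d (x - y) = dil d x - dil d y. Proof. by rewrite !dil.unlock compB. Qed.
Lemma dilM x y : dil d (x * y) = dil d x * dil d y. Proof. by rewrite !dil.unlock compM. Qed.
Lemma dilX x k : dil d (x ^+ k) = dil d x ^+ k. Proof. by rewrite !dil.unlock compX. Qed.
Lemma dil_nat k : dil d k%:R = k%:R. Proof. by rewrite !dil.unlock comp_nat. Qed.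
Lemma dil1 : dil d 1 = 1. Proof. by rewrite !dil.unlock comp1. Qed.
Lemma dil_qX : dil d qX = qX ^+ d. Proof. by rewrite !dil.unlock comp_qX. Qed.
Lemma dilV x : x \is a GRing.unit -> dil d x^-1 = (dil d x)^-1.
Proof. by move=> ?; rewrite !dil.unlock compV. Qed.
Lemma cf0_dil x : dil d x 0%N = x 0%N. Proof. by rewrite !dil.unlock cf0_comp. Qed.
Lemma dil_mul x n : dil d x (d * n)%N = x n.
Proof. by rewrite cf_dil // dvdn_mulr // mulKn. Qed.
Lemma dil_inj : injective (dil d).
Proof.
move=> x y H; apply: fpsP => n.
by rewrite -(dil_mul x n) H dil_mul.
Qed.
Lemma D_dil x : D (dil d x) = d%:R * dil d (D x).
Proof.
apply: fpsP => n; rewrite cf_D -fpsC_nat cfCM !cf_dil //.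
case: ifPn => [/dvdnP[k ->]|_]; last by rewrite !mulr0.
by rewrite mulnK // cf_D natrM; ring.
Qed.
Lemma eqm_dil N M x y : (M <= d * N)%N -> eqm N x y -> eqm M (dil d x) (dil d y).
Proof.
move=> le H n lt; rewrite !cf_dil //; case: ifPn => // /dvdnP[k e].
by rewrite e mulnK //; apply: H; move: lt; rewrite e; nia.
Qed.
End Dilation.

Lemma dil_dil d e x : (0 < d)%N -> (0 < e)%N -> dil d (dil e x) = dil (d * e) x.
Proof.
move=> d0 e0; rewrite dil.unlock compA ?qXn0 //.
by rewrite comp_qXn ?qXn0 // exprM.
Qed.

Lemma sgn_dil d x : ~~ odd d -> (0 < d)%N -> sgn (dil d x) = dil d x.
Proof.
move=> ev d0; rewrite /sgn dil.unlock compA ?qXn0 ?NqX0 // comp_qXn ?NqX0 //.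
by rewrite exprNn -signr_odd (negbTE ev) mul1r.
Qed.

Lemma sgnM x y : sgn (x * y) = sgn x * sgn y. Proof. exact: compM NqX0. Qed.
Lemma sgnB x y : sgn (x - y) = sgn x - sgn y. Proof. exact: compB. Qed.
Lemma sgnX x k : sgn (x ^+ k) = sgn x ^+ k. Proof. exact: compX NqX0. Qed.
Lemma sgn_nat k : sgn k%:R = k%:R. Proof. exact: comp_nat. Qed.
Lemma sgn_qX : sgn qX = - qX. Proof. exact: comp_qX NqX0. Qed.
Lemma sgnV x : x \is a GRing.unit -> sgn x^-1 = (sgn x)^-1.
Proof. exact: compV NqX0. Qed.
Lemma sgnK x : sgn (sgn x) = x.
Proof. by apply: fpsP => n; rewrite !cf_sgn mulrA -expr2 sqrr_sign mul1r. Qed.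
Lemma cf0_sgn x : sgn x 0%N = x 0%N. Proof. exact: cf0_comp. Qed.

(** * The eta products as rational power series *)

Definition fps_of (f : ps) := Fps (fun n => (f n)%:~R).

Lemma fps_of_mul f g : fps_of (psmul f g) = fps_of f * fps_of g.
Proof.
apply: fpsP => n; rewrite /= /psmul raddf_sum.
by apply: eq_bigr => i _ /=; rewrite intrM.
Qed.
Lemma fps_of_pow f k : fps_of (pspow f k) = fps_of f ^+ k.
Proof.
elim: k => [|k IH]; last by rewrite exprS -IH -fps_of_mul.
by apply: fpsP => n; rewrite /= /pspow /= /ps1; case: eqP.
Qed.
Lemma fps_of_dil d f : (0 < d)%N -> fps_of (psdil d f) = dil d (fps_of f).
Proof. by move=> d0; apply: fpsP => n; rewrite cf_dil // /= /psdil; case: ifP. Qed.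

Lemma size_psinv_aux f n : size (psinv_aux f n) = n.+1.
Proof. by elim: n => //= n IH; rewrite size_rcons IH. Qed.

Lemma nth_psinv_aux f n k : (k <= n)%N -> nth 0 (psinv_aux f n) k = psinv f k.
Proof.
elim: n => [|n IH]; first by rewrite leqn0 => /eqP ->.
rewrite leq_eqVlt => /orP[/eqP -> //|lt].
by rewrite /= nth_rcons size_psinv_aux lt IH.
Qed.

Lemma psinvS f n :
  psinv f n.+1 = - \sum_(i < n.+1) f i.+1 * psinv f (n - i)%N.
Proof.
rewrite {1}/psinv /= nth_rcons size_psinv_aux ltnn eqxx; congr (- _).
by apply: eq_bigr => i _; rewrite nth_psinv_aux // leq_subr.
Qed.

Lemma fps_of_inv f : f 0%N = 1 -> fps_of (psinv f) = (fps_of f)^-1.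
Proof.
move=> f0; have u : fps_of f \is a GRing.unit by apply: unit_fps1; rewrite /= f0.
apply: (mulrI u); rewrite mulrV // -fps_of_mul; apply: fpsP => -[|n].
  by rewrite /= /psmul big_ord1 f0 mul1r.
rewrite /= /psmul big_ord_recl f0 mul1r subn0 psinvS.
rewrite (eq_bigr (fun i : 'I_n.+1 => f i.+1 * psinv f (n - i)%N)) ?addNr //.
Qed.

Definition of_poly (p : {poly int}) := Fps (fun n => (p`_n)%:~R).

Lemma of_polyM p r : of_poly (p * r) = of_poly p * of_poly r.
Proof.
apply: fpsP => n; rewrite /= coefM raddf_sum.
by apply: eq_bigr => i _ /=; rewrite intrM.
Qed.

Lemma of_poly_factor k : of_poly (1 - 'X^k) = 1 - qX ^+ k.
Proof.
apply: fpsP => n; rewrite cfB cf1 cf_qXn /= coefB coef1 coefXn rmorphB /=.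
by case: (n == 0%N); case: (n == k).
Qed.

Definition euler := fps_of euler_ps.

Lemma eqm_prod_ext N M M' (F : nat -> fps) : (M <= M')%N ->
  (forall k, (M <= k < M')%N -> eqm N (F k) 1) ->
  eqm N (\prod_(k < M') F k) (\prod_(k < M) F k).
Proof.
move=> le H; rewrite -!(big_mkord xpredT F) (@big_cat_nat _ _ _ M) //=.
rewrite -[X in eqm N _ X]mulr1; apply: eqmM => //.
rewrite big_nat; elim/big_rec: _ => // i x lt IH.
by rewrite -[X in eqm N _ X]mulr1; apply: eqmM => //; apply: H.
Qed.

Lemma eqm1_qXn (c : fps) N k : (N <= k)%N -> eqm N (1 + qX ^+ k * c) 1.
Proof.
move=> le; rewrite -[X in eqm _ _ X]addr0; apply: eqmD => //.
exact: eqm_qXn.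
Qed.

Lemma eulerE N M : (N <= M.+1)%N -> eqm N euler (\prod_(k < M) (1 - qX ^+ k.+1)).
Proof.
move=> le n lt.
have -> : euler n = (\prod_(k < n) (1 - qX ^+ k.+1) : fps) n.
  suff <- : of_poly (\prod_(1 <= k < n.+1) (1 - 'X^k)) = \prod_(k < n) (1 - qX ^+ k.+1) by [].
  rewrite big_add1 /= big_mkord; elim: (n) => [|m IH].
    by rewrite !big_ord0; apply: fpsP => i /=; rewrite coef1; case: eqP.
  by rewrite !big_ord_recr /= of_polyM IH of_poly_factor.
have [le'|lt'] := leqP n M.
  rewrite (@eqm_prod_ext n.+1 n M (fun k => 1 - qX ^+ k.+1)) // => k /andP[lk _].
  by rewrite -mulrN1; apply: eqm1_qXn.
have -> : n = M.+1 by lia.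
by lia.
Qed.

Lemma euler0 : euler 0%N = 1.
Proof. by rewrite (@eulerE 1 0) // big_ord0. Qed.

Lemma unit_eulerd d : (0 < d)%N -> dil d euler \is a GRing.unit.
Proof. by move=> d0; apply: unit_fps1; rewrite cf0_dil // euler0. Qed.

(** * Theta series *)

(** Jacobi's theta_3, the sum of q^(s^2) over all integers s. The range [s < i] is enough because
    [i = (s+1)^2] forces [s < i]. *)
Definition phi := Fps (fun i => (i == 0%N)%:R + 2 * \sum_(s < i) (i == (s.+1 ^ 2)%N)%:R).

Lemma sum_widen0 (F : nat -> rat) n i : (i <= n)%N ->
  (forall s, (i <= s)%N -> F s = 0) -> \sum_(s < n) F s = \sum_(s < i) F s.
Proof.
move=> le H; rewrite (big_ord_widen n F le).
rewrite [LHS](bigID (fun s : 'I_n => (s < i)%N)) /= [X in _ + X]big1 ?addr0 // => s.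
by rewrite -leqNgt => /H.
Qed.

Lemma phiE n : eqm n phi (1 + 2 * \sum_(s < n) qX ^+ (s.+1 ^ 2)).
Proof.
move=> i lt; rewrite cfD cf1 -fpsC_nat cfCM cf_sum.
transitivity ((i == 0%N)%:R + 2 * \sum_(s < i) (qX ^+ (s.+1 ^ 2) : fps) i : rat).
  rewrite [LHS]/cf; congr (_ + _ * _).
  by apply: eq_bigr => s _; rewrite cf_qXn.
congr (_ + _ * _).
apply: esym; apply: (sum_widen0 (F := fun s => (qX ^+ (s.+1 ^ 2) : fps) i)) => [|s le].
  exact: ltnW.
rewrite cf_qXn; case: eqP => // e; suff : (s < i)%N by rewrite ltnNge le.
by rewrite e expnS expn1 mulSn addSn ltnS leq_addr.
Qed.

Lemma telescope_sumr (V : zmodType) (F : nat -> V) n :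
  \sum_(s < n) (F s.+1 - F s) = F n - F 0%N.
Proof. by rewrite -(telescope_sumr F (leq0n n)) big_mkord. Qed.

(* Shanks' finite forms of Gauss's two theta identities: the difference in [n]
   of the right-hand sides telescopes in the summation index. *)
Section Shanks.

Let a k : fps := 1 - qX ^+ k.
Let b k : fps := 1 + qX ^+ k.
Let Y n := \prod_(k < n) (a k.+1 / b k.+1).
Let P n := \prod_(k < n) (a (2 * k.+1) / a (2 * k).+1).

Let unit_a k : a k.+1 \is a GRing.unit.
Proof. by apply: unit_fps1; rewrite cfB cf1 cf_qXn subr0. Qed.
Let unit_b k : b k.+1 \is a GRing.unit.
Proof. by apply: unit_fps1; rewrite cfD cf1 cf_qXn addr0. Qed.
Let unit_a2 k : a (2 * k.+1) \is a GRing.unit.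
Proof. by rewrite mulnS; apply: unit_a. Qed.
Let unit_Y n : Y n \is a GRing.unit.
Proof.
by apply: rpred_prod => k _; rewrite unitrM unitrV unit_a unit_b.
Qed.
Let unit_P n : P n \is a GRing.unit.
Proof.
by apply: rpred_prod => k _; rewrite unitrM unitrV unit_a2 unit_a.
Qed.
Let YS n : Y n.+1 * b n.+1 = Y n * a n.+1.
Proof. by rewrite /Y big_ord_recr /= -mulrA mulrVK. Qed.
Let PS n : P n.+1 * a (2 * n).+1 = P n * a (2 * n.+1).
Proof. by rewrite /P big_ord_recr /= -mulrA mulrVK. Qed.
Let YV n : (Y n.+1)^-1 * a n.+1 = (Y n)^-1 * b n.+1.
Proof.
apply: (mulrI (unit_Y n)); rewrite [RHS]mulVKr ?unit_Y //.
by rewrite mulrCA -YS mulKr ?unit_Y.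
Qed.
Let PV n : (P n.+1)^-1 * a (2 * n.+1) = (P n)^-1 * a (2 * n).+1.
Proof.
apply: (mulrI (unit_P n)); rewrite [RHS]mulVKr ?unit_P //.
by rewrite mulrCA -PS mulKr ?unit_P.
Qed.

(** The sum of (-1)^s q^(s^2) over |s| <= n with the two end terms counted by half. *)
Let B n := \sum_(s < n) ((-1) ^+ s * qX ^+ (s ^ 2) - (-1) ^+ s * qX ^+ (s.+1 ^ 2)) : fps.

Let shanks_phi n : B n = Y n * b n * \sum_(s < n) (-1) ^+ s * qX ^+ (s * n) * (Y s)^-1.
Proof.
elim: n => [|n IH]; first by rewrite /B !big_ord0 mulr0.
rewrite /B big_ord_recr /= -/(B n) IH YS big_ord_recr /=.
(* [V] is the telescoping certificate; [V 0] vanishes because [a 0 = 0]. *)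
pose V s := (-1) ^+ s * qX ^+ (s * n) * a s * (Y s)^-1 : fps.
have tele : a n.+1 * (\sum_(s < n) (-1) ^+ s * qX ^+ (s * n.+1) * (Y s)^-1) -
    b n * (\sum_(s < n) (-1) ^+ s * qX ^+ (s * n) * (Y s)^-1) = V n.
  have -> : V n = V n - V 0%N by rewrite /V /a expr0 subrr !(mulr0, mul0r) subr0.
  rewrite -telescope_sumr !mulr_sumr -sumrB; apply: eq_bigr => s _.
  have -> : V s.+1 = (-1) ^+ s.+1 * qX ^+ (s.+1 * n) * ((Y s)^-1 * b s.+1).
    by rewrite -YV /V; ring.
  by rewrite /V /a /b mulnS mulSn !exprD !exprS; ring.
set T' := \sum_(s < n) _ in tele *; set T := \sum_(s < n) _ in tele *.
have VY : Y n * V n = (-1) ^+ n * qX ^+ (n * n) * a n.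
  by rewrite /V; transitivity ((-1) ^+ n * qX ^+ (n * n) * a n * (Y n / Y n));
     [ring | rewrite mulrV ?mulr1].
have -> : Y n * a n.+1 * (T' + (-1) ^+ n * qX ^+ (n * n.+1) * (Y n)^-1) =
   Y n * b n * T + Y n * (a n.+1 * T' - b n * T) +
   a n.+1 * (-1) ^+ n * qX ^+ (n * n.+1) * (Y n / Y n) by ring.
rewrite tele VY mulrV // /a.
have -> : (n ^ 2 = n * n)%N by rewrite mulnn.
have -> : (n.+1 ^ 2 = n * n.+1 + n.+1)%N by rewrite -mulnn; lia.
by rewrite mulnS !exprD; ring.
Qed.

Let shanks_psi n : \sum_(s < 2 * n) qX ^+ 'C(s.+1, 2) =
  P n * \sum_(s < n) qX ^+ (s * (2 * n).+1) * (P s)^-1.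
Proof.
elim: n => [|n IH]; first by rewrite muln0 !big_ord0 mulr0.
apply: (mulIr (unit_a (2 * n))).
have -> : (2 * n.+1 = (2 * n).+2)%N by lia.
rewrite !big_ord_recr IH /= mulrAC.
have -> : P n.+1 * a (2 * n).+1 = P n * a (2 * n).+2 by rewrite PS mulnS.
pose V s := qX ^+ (s * (2 * n).+1) * a (2 * s) * (P s)^-1 : fps.
have tele : a (2 * n).+2 * (\sum_(s < n) qX ^+ (s * (2 * n).+3) * (P s)^-1) -
    a (2 * n).+1 * (\sum_(s < n) qX ^+ (s * (2 * n).+1) * (P s)^-1) = V n.
  have -> : V n = V n - V 0%N by rewrite /V /a expr0 subrr !(mulr0, mul0r) subr0.
  rewrite -telescope_sumr !mulr_sumr -sumrB; apply: eq_bigr => s _.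
  have -> : V s.+1 = qX ^+ (s.+1 * (2 * n).+1) * ((P s)^-1 * a (2 * s).+1).
    by rewrite -PV /V; ring.
  rewrite /V /a.
  have -> : (s * (2 * n).+3 = s * (2 * n).+1 + 2 * s)%N by lia.
  have -> : (s.+1 * (2 * n).+1 = s * (2 * n).+1 + (2 * n).+1)%N by lia.
  rewrite (exprD _ _ (2 * s)) (exprD _ _ (2 * n).+1) !(exprS _ (2 * n).+1) !(exprS _ (2 * n)) (exprS _ (2 * s)).
  by set u := qX ^+ (s * _); set v := qX ^+ (2 * n); set w := qX ^+ (2 * s); ring.
set T' := \sum_(s < n) _ in tele *; set T := \sum_(s < n) _ in tele *.
have VP : P n * V n = qX ^+ (n * (2 * n).+1) * a (2 * n).
  by rewrite /V; transitivity (qX ^+ (n * (2 * n).+1) * a (2 * n) * (P n / P n));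
     [ring | rewrite mulrV ?mulr1].
have -> : P n * a (2 * n).+2 * (T' + qX ^+ (n * (2 * n).+3) * (P n)^-1) =
   P n * T * a (2 * n).+1 + P n * (a (2 * n).+2 * T' - a (2 * n).+1 * T) +
   a (2 * n).+2 * qX ^+ (n * (2 * n).+3) * (P n / P n) by ring.
rewrite tele VP mulrV // /a.
have -> : 'C((2 * n).+1, 2) = (n * (2 * n).+1)%N by rewrite bin2 /=; lia.
have -> : 'C((2 * n).+2, 2) = (n * (2 * n).+1 + (2 * n).+1)%N by rewrite bin2 /=; nia.
have -> : (n * (2 * n).+3 = n * (2 * n).+1 + 2 * n)%N by lia.
rewrite (exprD _ _ (2 * n).+1) (exprD _ _ (2 * n)) !(exprS _ (2 * n).+1) !(exprS _ (2 * n)).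
by set u := qX ^+ (n * _); set v := qX ^+ (2 * n); ring.
Qed.

Let e1 := euler.
Let e2 := dil 2 euler.

Let unit_e1 : e1 \is a GRing.unit. Proof. exact: unit_fps1 euler0. Qed.
Let unit_e2 : e2 \is a GRing.unit. Proof. exact: unit_eulerd. Qed.

Let e1E n : eqm n e1 (\prod_(k < n) a k.+1). Proof. exact: eulerE. Qed.

Let e2E n : eqm n e2 (\prod_(k < n) a (2 * k.+1)).
Proof.
have -> : \prod_(k < n) a (2 * k.+1) = dil 2 (\prod_(k < n) a k.+1).
  elim: (n) => [|m IH]; first by rewrite !big_ord0 dil1.
  by rewrite !big_ord_recr /= dilM // IH dilB // dil1 dilX // dil_qX // -exprM.
by apply: (@eqm_dil 2 _ n) => //; lia.
Qed.

Let Y_lim n : eqm n (Y n) (e1 ^+ 2 / e2).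
Proof.
have -> : Y n = Y n * e2 / e2 by rewrite mulrK.
apply: eqmM => //.
refine (eqm_trans (eqmM (@eqm_refl n (Y n)) (@e2E n)) _).
have -> : Y n * \prod_(k < n) a (2 * k.+1) = (\prod_(k < n) a k.+1) ^+ 2.
  rewrite /Y -big_split -prodrXl /=; apply: eq_bigr => k _.
  have -> : a (2 * k.+1) = a k.+1 * b k.+1 by rewrite /a /b mul2n -addnn exprD; ring.
  by rewrite mulrCA mulrVK // expr2.
by apply: eqmX; apply: eqm_sym.
Qed.

Let P_lim n : eqm n (P n) (e2 ^+ 2 / e1).
Proof.
have -> : P n = P n * e1 / e1 by rewrite mulrK.
apply: eqmM => //.
have e1' : eqm n e1 (\prod_(k < 2 * n) a k.+1) by apply: eulerE; lia.
refine (eqm_trans (eqmM (@eqm_refl n (P n)) e1') _).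
have -> : P n * \prod_(k < 2 * n) a k.+1 = (\prod_(k < n) a (2 * k.+1)) ^+ 2.
  elim: (n) => [|m IH]; first by rewrite /P muln0 !big_ord0 mulr1 expr1n.
  have -> : (2 * m.+1 = (2 * m).+2)%N by lia.
  rewrite [in RHS]big_ord_recr [in RHS]exprMn -IH !big_ord_recr /=.
  have e : P m.+1 * a (2 * m).+1 = P m * a (2 * m).+2 by rewrite PS mulnS.
  set Q := \prod_(i < 2 * m) _.
  have -> : P m.+1 * (Q * a (2 * m).+1 * a (2 * m).+2) =
     P m.+1 * a (2 * m).+1 * (Q * a (2 * m).+2) by ring.
  by rewrite e mulnS; ring.
by apply: eqmX; apply: eqm_sym; apply: e2E.
Qed.

(** Every term with s > 0 carries the factor q^(s m) with s m >= n. *)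
Let sum_first n m (F : nat -> fps) : F 0%N = 1 -> (0 < n)%N -> (n <= m)%N ->
  eqm n (\sum_(s < n) (-1) ^+ s * qX ^+ (s * m) * F s) 1.
Proof.
move=> F0; case: n => // n _ le; rewrite big_ord_recl /= F0 !mulr1.
rewrite -[X in eqm _ _ X]addr0; apply: eqmD => //.
elim/big_rec: _ => // i x _ IH; rewrite -[X in eqm _ _ X]addr0; apply: eqmD => //.
rewrite -mulrA mulrCA; apply: eqm_qXn; rewrite /bump leq0n mulSn.
exact: leq_trans le (leq_addr _ _).
Qed.

Lemma sgn_phi : sgn phi = euler ^+ 2 / dil 2 euler.
Proof.
apply: eqmP => -[//|m]; set n := m.+1.
have H1 : eqm n (sgn phi) (B n + (-1) ^+ n * qX ^+ (n ^ 2)).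
  have -> : B n + (-1) ^+ n * qX ^+ (n ^ 2) =
      sgn (1 + 2 * \sum_(s < n) qX ^+ (s.+1 ^ 2)).
    rewrite /sgn compD compM ?NqX0 // comp1 comp_nat.
    elim: n => [|n IH]; first by rewrite /B !big_ord0 (comp_nat 0); ring.
    rewrite big_ord_recr /= compD mulrDr addrA -IH /B big_ord_recr /=.
    rewrite comp_qXn ?NqX0 // [(- qX) ^+ _]exprNn.
    have -> : (-1) ^+ (n.+1 ^ 2) = (-1) ^+ n.+1 :> fps.
      by rewrite -signr_odd oddX orFb signr_odd.
    by rewrite exprS; ring.
  by apply: eqm_comp => //; first [exact: NqX0 | exact: phiE].
refine (eqm_trans H1 _).
have H2 : eqm n ((-1) ^+ n * qX ^+ (n ^ 2)) 0.
  by rewrite mulrC; apply: eqm_qXn; rewrite -mulnn /n; nia.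
refine (eqm_trans (eqmD (@eqm_refl _ _) H2) _); rewrite addr0 shanks_phi.
rewrite -[X in eqm _ _ X]mulr1; apply: eqmM; last first.
  by apply: (sum_first (F := fun s => (Y s)^-1)) => //; rewrite /Y big_ord0 invr1.
rewrite -[X in eqm _ _ X]mulr1; apply: eqmM => //.
by rewrite /b -[qX ^+ n]mulr1; apply: eqm1_qXn.
Qed.

(** The product form of Gauss's series of triangular powers, the sum of q^(s (s+1) / 2) over s >=
    0. *)
Definition psi := dil 2 euler ^+ 2 / euler.

Lemma psiE n : eqm n psi (\sum_(s < 2 * n) qX ^+ 'C(s.+1, 2)).
Proof.
case: n => // m; set n := m.+1; apply: eqm_sym.
rewrite shanks_psi -[X in eqm _ _ X]mulr1; apply: eqmM => //.
rewrite (eq_bigr (fun s : 'I_n => (-1) ^+ s * qX ^+ (s * (2 * n).+1) * ((-1) ^+ s * (P s)^-1))).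
  apply: (sum_first (F := fun s => (-1) ^+ s * (P s)^-1)) => //; last by lia.
  by rewrite expr0 mul1r /P big_ord0 invr1.
move=> s _; rewrite mulrACA [X in _ = _ * X]mulrC.
transitivity ((-1) ^+ s ^+ 2 * (qX ^+ (s * (2 * n).+1) / P s)); last by ring.
by rewrite sqrr_sign mul1r.
Qed.

End Shanks.

(** * Euler's product at -q, and the splitting of theta_3 into even and odd squares *)

Lemma sgn_euler : sgn euler * euler * dil 4 euler = dil 2 euler ^+ 3.
Proof.
pose E n := \prod_(k < n) (1 - qX ^+ k.+1) : fps.
(* [O] collects the factors with odd exponent. The sign change fixes the other factors, and O(-q)
   O(q) = O(q^2). *)
pose O n := \prod_(k < n) (1 - qX ^+ (2 * k).+1) : fps.
have EO n : E (2 * n)%N = dil 2 (E n) * O n.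
  elim: n => [|n IH]; first by rewrite /E /O muln0 !big_ord0 dil1 mulr1.
  have -> : (2 * n.+1 = (2 * n).+2)%N by lia.
  rewrite /E !big_ord_recr /= -/(E _) IH /O big_ord_recr /= -/(O n) dilM // dilB //.
  by rewrite dil1 dilX // dil_qX // -exprM mulnS -/(E n); ring.
have OO n : sgn (O n) * O n = dil 2 (O n).
  elim: n => [|n IH]; first by rewrite /O !big_ord0 /sgn comp1 dil1 mulr1.
  rewrite /O big_ord_recr /= -/(O n) sgnM dilM // -IH.
  have -> : sgn (1 - qX ^+ (2 * n).+1) = 1 + qX ^+ (2 * n).+1.
    rewrite sgnB (sgn_nat 1) sgnX sgn_qX exprNn -signr_odd /= mul2n odd_double /=.
    by rewrite expr1 mulN1r opprK.
  rewrite dilB // dil1 // dilX // dil_qX // exprAC.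
  by set v := qX ^+ (2 * n).+1; ring.
apply: eqmP => n.
have EE N : (n <= N)%N -> eqm n euler (E N) by move=> le; apply: eulerE; lia.
have H2 N : (n <= N)%N -> eqm n (dil 2 euler) (dil 2 (E N)).
  by move=> le; apply: (@eqm_dil 2 _ n); [ | lia | apply: EE].
have l2 : (n <= 2 * n)%N by lia.
apply: eqm_trans (_ : eqm n (sgn (E (2 * n)%N) * E (2 * n)%N * dil 4 (E n)) _).
  apply: eqmM; first apply: eqmM; try exact: EE.
    by apply: eqm_comp; [exact: NqX0 | exact: EE | ].
  by apply: (@eqm_dil 4 _ n); [ | lia | apply: EE].
have -> : sgn (E (2 * n)%N) * E (2 * n)%N * dil 4 (E n) = dil 2 (E n) ^+ 2 * dil 2 (E (2 * n)%N).
  rewrite EO sgnM sgn_dil // dilM // dil_dil // -OO; ring.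
rewrite [dil 2 euler ^+ 3]exprSr; apply: eqmM; last exact: eqm_sym (H2 _ l2).
exact: eqmX (eqm_sym (H2 _ (leqnn n))).
Qed.

Lemma phi_eta : phi = dil 2 euler ^+ 5 / (euler ^+ 2 * dil 4 euler ^+ 2).
Proof.
have u1 : euler \is a GRing.unit by exact: unit_fps1 euler0.
have [u2 u4] : dil 2 euler \is a GRing.unit /\ dil 4 euler \is a GRing.unit.
  by split; apply: unit_eulerd.
have u : euler ^+ 2 * dil 4 euler ^+ 2 \is a GRing.unit.
  by rewrite unitrM !unitrX.
apply: (mulIr u); rewrite mulrVK //.
rewrite -[phi]sgnK sgn_phi sgnM sgnX sgnV // sgn_dil //.
apply: (mulIr u2).
transitivity ((sgn euler * euler * dil 4 euler) ^+ 2 * (dil 2 euler / dil 2 euler)).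
  by ring.
by rewrite sgn_euler mulrV //; ring.
Qed.

(** The even squares are 4 s^2, the odd ones are 8 times a triangular number plus 1. *)
Lemma phi_dissection : phi = dil 4 phi + 2 * (qX * dil 8 psi).
Proof.
apply: eqmP => n.
have H1 : eqm n phi (1 + 2 * \sum_(s < 4 * n) qX ^+ (s.+1 ^ 2)).
  by apply: eqm_le (@phiE _); lia.
refine (eqm_trans H1 _); apply: eqm_sym.
have H2 : eqm n (dil 4 phi) (dil 4 (1 + 2 * \sum_(s < 2 * n) qX ^+ (s.+1 ^ 2))).
  by apply: (@eqm_dil 4 _ (2 * n)); [ | lia | apply: phiE].
have H3 : eqm n (dil 8 psi) (dil 8 (\sum_(s < 2 * n) qX ^+ 'C(s.+1, 2))).
  by apply: (@eqm_dil 8 _ n); [ | lia | apply: psiE].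
refine (eqm_trans (eqmD H2 (eqmM (@eqm_refl _ 2) (eqmM (@eqm_refl _ qX) H3))) _).
rewrite dilD // dil1 // dilM // dil_nat // dil.unlock !comp_sum.
have -> : (4 * n = 2 * (2 * n))%N by lia.
elim: (2 * n)%N => [|m IH]; first by rewrite muln0 !big_ord0 !mulr0 !addr0.
have -> : (2 * m.+1 = (2 * m).+2)%N by lia.
rewrite !big_ord_recr /= !mulrDr.
rewrite !comp_qXn ?qXn0 // -!exprM -[qX * qX ^+ _]exprS.
have -> : (8 * 'C(m.+1, 2)).+1 = ((2 * m).+1 ^ 2)%N.
  by have := mul_bin_diag m.+1 1; rewrite /= bin1 -mulnn; nia.
have -> : (4 * m.+1 ^ 2 = (2 * m).+2 ^ 2)%N by nia.
set u := qX ^+ ((2 * m).+1 ^ 2); set v := qX ^+ ((2 * m).+2 ^ 2).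
set A := \sum_(i < m) _ in IH *; set A' := \sum_(i < m) _ in IH *.
set Q := \sum_(i < 2 * m) _ in IH *.
have IH' : eqm n (2 * u + 2 * v + (1 + 2 * A + 2 * (qX * A'))) (2 * u + 2 * v + (1 + 2 * Q)).
  exact: eqmD.
have -> : 1 + (2 * A + 2 * v) + (2 * (qX * A') + 2 * u) =
  2 * u + 2 * v + (1 + 2 * A + 2 * (qX * A')) by ring.
by refine (eqm_trans IH' _); have -> : 1 + (2 * Q + 2 * u + 2 * v) = 2 * u + 2 * v + (1 + 2 * Q) by ring.
Qed.

(** * Doubling relations *)

HB.lock Definition th3 : fps := phi.
HB.lock Definition th4 : fps := euler ^+ 2 / dil 2 euler.
(** Jacobi's theta_2 divided by 2 q^(1/4), so that it is a power series with constant term 1;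
    theta_2^4 is thus [16 * qX * th2 ^+ 4]. *)
HB.lock Definition th2 : fps := dil 2 psi.

Lemma unit_euler : euler \is a GRing.unit. Proof. exact: unit_fps1 euler0. Qed.
Lemma unit_dil d x : (0 < d)%N -> (dil d x \is a GRing.unit) = (x \is a GRing.unit).
Proof. by move=> d0; rewrite !unit_fps cf0_dil. Qed.

Lemma th2_eta : th2 = dil 4 euler ^+ 2 / dil 2 euler.
Proof. by rewrite th2.unlock /psi dilM // dilX // dilV ?unit_euler // dil_dil. Qed.
Lemma th3_eta : th3 = dil 2 euler ^+ 5 * ((euler ^-1) ^+ 2 * ((dil 4 euler)^-1) ^+ 2).
Proof.
rewrite th3.unlock phi_eta invrM ?unitrX ?unit_dil ?unit_euler // -!exprVn.
by congr (_ * _); rewrite mulrC.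
Qed.

Lemma unit_th2 : th2 \is a GRing.unit.
Proof. by rewrite th2_eta unitrM unitrV unitrX unit_dil ?unit_euler. Qed.
Lemma unit_th3 : th3 \is a GRing.unit.
Proof. by rewrite th3_eta !unitrM ?unitrX ?unitrV ?unit_dil ?unit_euler. Qed.
Lemma unit_th4 : th4 \is a GRing.unit.
Proof. by rewrite th4.unlock !unitrM ?unitrX ?unitrV ?unit_dil ?unit_euler. Qed.

Lemma th3_0 : th3 0%N = 1. Proof. by rewrite th3.unlock /= big_ord0 mulr0 addr0. Qed.
Lemma th4_0 : th4 0%N = 1.
Proof. by rewrite th4.unlock -sgn_phi cf0_sgn -th3.unlock th3_0. Qed.
Lemma th2_0 : th2 0%N = 1.
Proof.
by rewrite th2.unlock cf0_dil // /psi cf0M cf0V ?unit_euler // cf0X cf0_dil // euler0 invr1 expr1n mulr1.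
Qed.

Definition pos2 : (0 < 2)%N := isT.
Definition pos4 : (0 < 4)%N := isT.
Definition dil2E := (dilD 2, dilN 2, dilX pos2, dilM pos2, dil_nat 2).

Definition dil4E := (dilD 4, dilN 4, dilX pos4, dilM pos4, dil_nat 4, dil_qX pos4).

Lemma th2_sqr : th2 ^+ 2 = dil 2 th2 * dil 2 th3.
Proof.
have u4 := mulrV (unit_eulerd (isT : (0 < 4)%N)).
have u8 := mulrV (unit_eulerd (isT : (0 < 8)%N)).
have {u4 u8} := (unit_euler, u4, u8); rewrite th2_eta th3_eta.
move: euler => e [[ue u4] u8].
have E (x : fps) : x \is a GRing.unit -> dil 2 x^-1 = (dil 2 x)^-1 by exact: dilV.
rewrite !dil2E.
rewrite !E.
rewrite !(dil_dil _ pos2 pos2, dil_dil _ pos2 pos4).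
all: rewrite ?unit_dil //.
move: (dil 2 e)^-1 (dil 4 e)^-1 (dil 8 e)^-1 u4 u8.
move: (dil 2 e) (dil 4 e) (dil 8 e) => e2 e4 e8 i2 i4 i8 u4 u8.
transitivity (e4 ^+ 4 * i2 ^+ 2 * (e4 * i4) * (e8 * i8) ^+ 2); last by ring.
by rewrite u4 u8; ring.
Qed.

Lemma th3M4 : th3 * th4 = dil 2 th4 ^+ 2.
Proof.
have u1 := mulrV unit_euler.
have u2 := mulrV (unit_eulerd (isT : (0 < 2)%N)).
have {u1 u2} := (unit_euler, u1, u2); rewrite th3_eta th4.unlock.
move: euler => e [[ue u1] u2].
have E (x : fps) : x \is a GRing.unit -> dil 2 x^-1 = (dil 2 x)^-1 by exact: dilV.
rewrite !dil2E.
rewrite !E.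
rewrite !(dil_dil _ pos2 pos2, dil_dil _ pos2 pos4).
all: rewrite ?unit_dil //.
move: (dil 2 e)^-1 (dil 4 e)^-1 e^-1 u1 u2.
move: (dil 2 e) (dil 4 e) => e2 e4 i2 i4 i1 u1 u2.
transitivity (e2 ^+ 4 * i4 ^+ 2 * (e * i1) ^+ 2 * (e2 * i2)); first by ring.
by rewrite u1 u2; ring.
Qed.

(** At q^2 the left side is theta_3 theta_4, and the splitting into even and odd squares writes the
    two factors as a sum and a difference of the same two series. *)
Lemma th4_sqr : th4 ^+ 2 = dil 2 th3 ^+ 2 - 4 * qX * dil 2 th2 ^+ 2.
Proof.
apply: (dil_inj pos2); rewrite [LHS]dilX // -th3M4 !dil2E.
rewrite dil_qX // !(dil_dil _ pos2 pos2) {1}th3.unlock [in X in X * th4]phi_dissection th4.unlock -sgn_phi.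
rewrite [in X in _ * X]phi_dissection -th3.unlock.
have -> : sgn (dil 4 th3 + 2 * (qX * dil 8 psi)) = dil 4 th3 - 2 * (qX * dil 8 psi).
  rewrite /sgn compD -/(sgn _) -/(sgn (2 * _)) sgn_dil // !sgnM sgn_nat sgn_qX sgn_dil //.
  by ring.
by rewrite th2.unlock (dil_dil _ pos4 pos2); ring.
Qed.

Lemma th3_sqr : th3 ^+ 2 = dil 2 th3 ^+ 2 + 4 * qX * dil 2 th2 ^+ 2.
Proof.
have := congr1 sgn th4_sqr.
rewrite {1}th4.unlock -sgn_phi -sgnX sgnK sgnB !sgnM ?sgnX !sgn_dil // sgn_nat sgn_qX th3.unlock => ->.
by ring.
Qed.

Lemma th_quartic : th4 ^+ 4 = th3 ^+ 4 - 16 * qX * th2 ^+ 4.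
Proof.
rewrite (exprM th4 2 2) (exprM th3 2 2) (exprM th2 2 2) th4_sqr th3_sqr th2_sqr; ring.
Qed.

(** This descent and the next one stand in for the finite dimension of spaces of modular forms: a
    defect reproduced by q -> q^2 is determined by its constant term. *)
Lemma dil2_const x : x = dil 2 x -> x = fpsC (x 0%N).
Proof.
move=> H; suff K n : (0 < n)%N -> x n = 0 by apply: fpsP => -[//|n]; rewrite K.
elim/ltn_ind: n => n IH n0; rewrite H cf_dil //; case: ifPn => // /dvdnP[k e].
by rewrite e mulnK //; apply: IH; lia.
Qed.

Lemma dil2_eq0 x : x = 4 * dil 2 x -> x = 0.
Proof.
move=> H; apply: fpsP => n; elim/ltn_ind: n => n IH.
rewrite H -(fpsC_nat 4) cfCM cf_dil // cf0; case: ifPn => [/dvdnP[k e]|]; last by rewrite mulr0.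
case: n e IH => [|n] e IH; last by rewrite e mulnK // IH ?mulr0 //; lia.
have : x 0%N = (4 * dil 2 x) 0%N by rewrite -H.
by rewrite -(fpsC_nat 4) cfCM cf0_dil // div0n; lra.
Qed.

(** This is 4 (q d/dq) log(theta_2 / theta_3) = theta_4^4 without denominators; the term free of
    derivatives comes from q^(1/4). By the doubling relations the quotient [X] of the two sides is
    invariant under q -> q^2, hence constant. *)
Lemma th_wronskian :
  th3 * th2 + 4 * (th3 * D th2 - th2 * D th3) = th3 * th2 * th4 ^+ 4.
Proof.
set W := LHS; pose u := th3 * th2 * th4 ^+ 4.
have uu : u \is a GRing.unit.
  by rewrite !(unitrM, unitrX) ?unit_th2 ?unit_th3 ?unit_th4.
have dblW : th3 * th2 * W = th4 ^+ 2 * dil 2 W.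
  have -> : th3 * th2 * W = th3 ^+ 2 * th2 ^+ 2 +
     2 * (th3 ^+ 2 * D (th2 ^+ 2) - th2 ^+ 2 * D (th3 ^+ 2)).
    by rewrite /W !DX /=; ring.
  rewrite th3_sqr th2_sqr th4_sqr /W !(DD, DM, DX, D_nat, D_qX, D_dil pos2) /=.
  by rewrite !dil2E; ring.
have [X WE] : exists X, W = u * X by exists (W / u); rewrite mulrC mulrVK.
have XE : X = dil 2 X.
  have v : th3 ^+ 2 * th2 ^+ 2 * th4 ^+ 4 \is a GRing.unit.
    by rewrite !(unitrM, unitrX) ?unit_th2 ?unit_th3 ?unit_th4.
  apply: (mulrI v).
  transitivity (th3 * th2 * W); first by rewrite WE /u; ring.
  rewrite dblW WE /u !dil2E.
  transitivity (th4 ^+ 2 * (dil 2 th2 * dil 2 th3) * (dil 2 th4 ^+ 2) ^+ 2 * dil 2 X).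
    by ring.
  by rewrite -th2_sqr -th3M4; ring.
have X0 : X 0%N = 1.
  have := congr1 (fun z : fps => z 0%N) WE.
  rewrite /W /u cfD !cf0M cfB !cf0M !cf_D th3_0 th2_0 th4_0.
  by rewrite !(mul1r, mulr1, mul0r, mulr0, subr0, addr0) => <-.
by rewrite WE (dil2_const XE) X0 fpsC1 mulr1.
Qed.

HB.lock Definition G3 : fps := D (th3 ^+ 2) / th3 ^+ 2.

Lemma D_th3_sqr : D (th3 ^+ 2) = th3 ^+ 2 * G3.
Proof. by rewrite G3.unlock mulrC mulrVK // unitrX ?unit_th3. Qed.

(** Equivalently, D^2 (1 / theta_3^2) = - theta_2^4 theta_4^4 / (4 theta_3^2). The doubling
    relations give Om(q) = 4 Om(q^2) for the left side, which forces it to vanish. *)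
Lemma G3_riccati : G3 ^+ 2 - D G3 + 4 * qX * th2 ^+ 4 * th4 ^+ 4 = 0.
Proof.
set Om := LHS; apply: dil2_eq0.
pose A := dil 2 th3; pose B := dil 2 th2.
(* All quantities at q become polynomials in series at q^2: theta_3^2 = e + m and theta_4^2 = e -
   m. *)
pose e := A ^+ 2; pose m := 4 * qX * B ^+ 2; pose g := dil 2 G3; pose k := dil 2 (D G3).
pose y := dil 2 th4 ^+ 4; pose u := th3 ^+ 2.
have uE : u = e + m by exact: th3_sqr.
have cE : th4 ^+ 2 = e - m by exact: th4_sqr.
have yE : y = e ^+ 2 - m ^+ 2.
  rewrite /y (exprM _ 2 2) -th3M4 exprMn -/u uE cE; ring.
have Dg : D g = 2 * k by rewrite /g D_dil.
have De : D e = 2 * e * g.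
  by rewrite /e /A -(dilX pos2) (D_dil pos2) D_th3_sqr (dilM pos2) -/g; ring.
have uA : A \is a GRing.unit by rewrite unit_dil ?unit_th3.
have DA : D A = A * g.
  apply: (mulrI uA); have h2 : (2 : fps) \is a GRing.unit.
    by rewrite unit_fps -(fpsC_nat 2).
  apply: (mulrI h2); transitivity (D e); first by rewrite /e DX /=; ring.
  by rewrite De /e; ring.
have DBh : 2 * A * D B = A * B * (2 * g + y - 1).
  have := congr1 (dil 2) th_wronskian.
  rewrite !dil2E -/A -/B -/y => E.
  have EA : D A = 2 * dil 2 (D th3) by rewrite /A D_dil.
  have EB : D B = 2 * dil 2 (D th2) by rewrite /B D_dil.
  transitivity ((A * B + 4 * (A * dil 2 (D th2) - B * dil 2 (D th3))) - A * B + 2 * B * D A).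
    by rewrite EA EB; ring.
  by rewrite E DA; ring.
have Dm : D m = m * (2 * g + y).
  apply: (mulrI uA); rewrite /m !(DX, DM) D_nat D_qX /=.
  transitivity (4 * qX * B * (2 * A * D B) + 4 * qX * B ^+ 2 * A); first by ring.
  by rewrite DBh; ring.
have OmE : 4 * dil 2 Om = 4 * g ^+ 2 - 4 * k + m ^+ 2 * y.
  rewrite /Om !dil2E (dil_qX pos2) -/B -/y -/g -/k /m.
  by ring.
have em : 4 * qX * (B * A) ^+ 2 = e * m by rewrite /e /m; ring.
clearbody e m g k y.
have Dy : D y = 4 * e ^+ 2 * g - 2 * m ^+ 2 * (2 * g + y).
  by rewrite yE DB !DX De Dm -yE /=; ring.
have uu : u ^+ 2 \is a GRing.unit by rewrite /u !unitrX ?unit_th3.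
apply: (mulrI uu).
have Du : u * G3 = D u by rewrite D_th3_sqr.
have DDu : u * D G3 = D (D u) - D u * G3 by rewrite -[in D (D u)]Du DM; ring.
transitivity (2 * D u ^+ 2 - u * D (D u) + 4 * qX * (th2 ^+ 2) ^+ 2 * (th4 ^+ 2) ^+ 2 * u ^+ 2).
  transitivity ((u * G3) ^+ 2 - u * (u * D G3) + 4 * qX * (th2 ^+ 2) ^+ 2 * (th4 ^+ 2) ^+ 2 * u ^+ 2).
    by rewrite /Om; ring.
  rewrite DDu Du.
  transitivity (D u ^+ 2 + D u * (u * G3) - u * D (D u) +
     4 * qX * (th2 ^+ 2) ^+ 2 * (th4 ^+ 2) ^+ 2 * u ^+ 2); first by ring.
  by rewrite Du; ring.
rewrite OmE th2_sqr -/A -/B cE em.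
have Du' : D u = 2 * e * g + m * (2 * g + y) by rewrite uE DD De Dm.
rewrite Du' !(DD, DM, D_nat) De Dm Dg Dy uE yE; ring.
Qed.

(** * The function [t] and Legendre's equation *)

HB.lock Definition rq : fps := dil 4 (th2 / th3).
(** t = theta_2(q^4) / (2 theta_3(q^4)), so that 16 t^4 is the square of the elliptic modulus at
    q^4. [Yq] and [Fq] below are the logarithmic derivatives of [tq] and [fq]. *)
HB.lock Definition tq : fps := qX * rq.
HB.lock Definition fq : fps := dil 4 (th3 ^+ 2).
HB.lock Definition Yq : fps := dil 4 (th4 ^+ 4).
HB.lock Definition Fq : fps := 4 * dil 4 G3.

Lemma unit_rq : rq \is a GRing.unit.
Proof. by rewrite rq.unlock unit_dil // unitrM unitrV unit_th2 unit_th3. Qed.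
Lemma unit_fq : fq \is a GRing.unit.
Proof. by rewrite fq.unlock unit_dil // unitrX ?unit_th3. Qed.
Lemma tq0 : tq 0%N = 0. Proof. by rewrite tq.unlock cf_qXM. Qed.
Lemma rq0 : rq 0%N = 1.
Proof.
by rewrite rq.unlock cf0_dil // cf0M cf0V ?unit_th3 // th2_0 th3_0 invr1 mulr1.
Qed.
Lemma fq0 : fq 0%N = 1.
Proof. by rewrite fq.unlock cf0_dil // cf0X th3_0 expr1n. Qed.

Lemma rq_th : rq * dil 4 th3 = dil 4 th2.
Proof. by rewrite rq.unlock -(dilM pos4) mulrVK // unit_th3. Qed.

Lemma D_rq : rq + D rq = rq * Yq.
Proof.
have u3 : dil 4 th3 ^+ 2 \is a GRing.unit by rewrite unitrX // unit_dil ?unit_th3.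
apply: (mulIr u3).
have E := congr1 (dil 4) th_wronskian; move: E; rewrite !dil4E.
have -> : dil 4 th4 ^+ 4 = Yq by rewrite Yq.unlock (dilX pos4).
have D2 : D (dil 4 th2) = 4 * dil 4 (D th2) by rewrite D_dil.
have D3 : D (dil 4 th3) = 4 * dil 4 (D th3) by rewrite D_dil.
move=> E; have DR : D rq * dil 4 th3 = D (dil 4 th2) - rq * D (dil 4 th3).
  by rewrite -rq_th DM; ring.
transitivity (dil 4 th3 * dil 4 th2 + 4 * (dil 4 th3 * dil 4 (D th2) - dil 4 th2 * dil 4 (D th3))).
  transitivity (rq * dil 4 th3 * dil 4 th3 + D rq * dil 4 th3 * dil 4 th3); first by ring.
  rewrite DR rq_th D2 D3.
  transitivity (dil 4 th2 * dil 4 th3 + 4 * dil 4 (D th2) * dil 4 th3 - 4 * (rq * dil 4 th3) * dil 4 (D th3)).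
    by ring.
  by rewrite rq_th; ring.
by rewrite E -rq_th; ring.
Qed.

Lemma D_tq : D tq = tq * Yq.
Proof. by rewrite tq.unlock DM D_qX -mulrDr D_rq mulrA. Qed.

Lemma tq4_fq2 : tq ^+ 4 * fq ^+ 2 = qX ^+ 4 * dil 4 (th2 ^+ 4).
Proof. by rewrite tq.unlock fq.unlock !dil4E -rq_th; ring. Qed.

Lemma Yq_eq : Yq = fq ^+ 2 * (1 - 16 * tq ^+ 4).
Proof.
transitivity (fq ^+ 2 - 16 * (tq ^+ 4 * fq ^+ 2)); last by ring.
by rewrite tq4_fq2 Yq.unlock th_quartic fq.unlock !dil4E; ring.
Qed.

Lemma D_fq : D fq = fq * Fq.
Proof. by rewrite fq.unlock Fq.unlock (D_dil pos4) D_th3_sqr (dilM pos4); ring. Qed.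

Lemma Fq_riccati : Fq ^+ 2 - D Fq = - (64 * tq ^+ 4 * fq ^+ 2 * Yq).
Proof.
have -> : 64 * tq ^+ 4 * fq ^+ 2 * Yq = 64 * (tq ^+ 4 * fq ^+ 2) * Yq by ring.
rewrite tq4_fq2 Yq.unlock Fq.unlock DM D_nat (D_dil pos4).
have := congr1 (dil 4) G3_riccati; rewrite !dil4E.
have -> : dil 4 0 = 0 by exact: (dil_nat 4 0).
move=> E; apply/eqP; rewrite -subr_eq0; apply/eqP; move: E; set z := (X in X = 0) => E.
transitivity (16 * z); last by rewrite E mulr0.
by rewrite /z; ring.
Qed.

(** The hypergeometric series 2F1(1/2, 1/2; 1; 16 x), with x = t^4 in [wt]. *)
Definition w0 := Fps (fun m => ('C(2 * m, m) ^ 2)%:R).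
HB.lock Definition wt : fps := dil 4 w0.

Lemma binom_centralS m : (m.+1 * 'C(2 * m.+1, m.+1) = 2 * (2 * m).+1 * 'C(2 * m, m))%N.
Proof.
have e1 := mul_bin_diag (2 * m.+1) m.
have e2 := mul_bin_left (2 * m).+1 m.
have e3 := mul_bin_diag (2 * m).+1 m.
have s : ('C((2 * m).+1, m.+1) = 'C((2 * m).+1, m))%N.
  by rewrite -bin_sub; [congr 'C(_, _); lia | lia].
have p : (2 * m.+1).-1 = (2 * m).+1 by lia.
rewrite p in e1; rewrite /= in e3.
have e1' : (2 * 'C((2 * m).+1, m) = 'C(2 * m.+1, m.+1))%N by nia.
by nia.
Qed.

Lemma w0_ode : D (D w0) = 16 * (qX * D (D w0)) + 16 * (qX * D w0) + 4 * (qX * w0).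
Proof.
apply: fpsP => n; rewrite !cfD -(fpsC_nat 16) -(fpsC_nat 4) !cfCM !cf_qXM !cf_D.
case: n => [|n]; first by rewrite !mul0r !mulr0 !addr0.
have E : n.+1%:R * ('C(2 * n.+1, n.+1))%:R = 2 * (2 * n%:R + 1) * ('C(2 * n, n))%:R :> rat.
  transitivity ((n.+1 * 'C(2 * n.+1, n.+1))%:R : rat); first by rewrite natrM.
  by rewrite binom_centralS -(addn1 (2 * n)) !(natrM, natrD); ring.
transitivity ((n.+1%:R * ('C(2 * n.+1, n.+1))%:R) ^+ 2 : rat).
  by rewrite -[w0 _]/(('C(2 * n.+1, n.+1) ^ 2)%:R) natrX; ring.
rewrite E !cf_D -[w0 _]/(('C(2 * n, n) ^ 2)%:R) natrX. ring.
Qed.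

Lemma wt_ode : (1 - 16 * qX ^+ 4) * D (D wt) = 64 * qX ^+ 4 * (D wt + wt).
Proof.
have E : dil 4 (D (D w0)) = 16 * (qX ^+ 4 * dil 4 (D (D w0))) +
    16 * (qX ^+ 4 * dil 4 (D w0)) + 4 * (qX ^+ 4 * dil 4 w0).
  by rewrite [in LHS]w0_ode !dil4E.
rewrite wt.unlock !(D_dil pos4) DM D_nat !(D_dil pos4).
have -> : (1 - 16 * qX ^+ 4) * (0 * dil 4 (D w0) + 4 * (4 * dil 4 (D (D w0)))) =
   16 * dil 4 (D (D w0)) - 256 * (qX ^+ 4 * dil 4 (D (D w0))) by ring.
by rewrite [in X in X - _]E; ring.
Qed.

(** Legendre's equation for [W], and the Riccati equation read as a formula for D^2 (1/f), combine
    to D^2 (W/f) = 0; for a power series this forces W/f to be constant. *)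
Lemma wt_tq : scomp wt tq = fq.
Proof.
set W := LHS; pose W1 := scomp (D wt) tq; pose W2 := scomp (D (D wt)) tq.
have DW : D W = W1 * Yq by rewrite /W (D_comp_log _ tq0 D_tq).
have DW1 : D W1 = W2 * Yq by rewrite /W1 (D_comp_log _ tq0 D_tq).
have ode : (1 - 16 * tq ^+ 4) * W2 = 64 * tq ^+ 4 * (W1 + W).
  have c k : scomp (k%:R * qX ^+ 4) tq = k%:R * tq ^+ 4.
    by rewrite (compM k%:R (qX ^+ 4) tq0) comp_nat (comp_qXn 4 tq0).
  have c1 : scomp (1 - 16 * qX ^+ 4) tq = 1 - 16 * tq ^+ 4.
    by rewrite (compB 1) c comp1.
  transitivity (scomp ((1 - 16 * qX ^+ 4) * D (D wt)) tq).
    by rewrite (compM (1 - 16 * qX ^+ 4) (D (D wt)) tq0) c1.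
  by rewrite wt_ode (compM (64 * qX ^+ 4) (D wt + wt) tq0) c compD.
have W0 : W 0%N = 1.
  by rewrite /W cf0_comp wt.unlock cf0_dil //= muln0 bin0.
have uf := unit_fq; clearbody W W1 W2.
have -> : W = W / fq * fq by rewrite mulrVK.
suff -> : W / fq = 1 by rewrite mul1r.
have Di : D fq^-1 = - (fq^-1 * Fq).
  rewrite DV // D_fq -[in RHS](mulKr uf fq^-1); ring.
have DDi : D (D fq^-1) = - (64 * tq ^+ 4 * fq * Yq).
  rewrite Di DN DM Di.
  transitivity (fq^-1 * (Fq ^+ 2 - D Fq)); first by ring.
  rewrite Fq_riccati.
  transitivity (- (64 * tq ^+ 4 * (fq^-1 * fq) * fq * Yq)); first by ring.
  by rewrite mulVr // mulr1.
have DY : D Yq = 2 * fq ^+ 2 * Fq * (1 - 16 * tq ^+ 4) - 64 * fq ^+ 2 * tq ^+ 4 * Yq.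
  rewrite [in LHS]Yq_eq DM DB (D_nat 1) DM D_nat !DX D_fq D_tq /=; ring.
have DX2 : D (D (W / fq)) = 0.
  rewrite !(DM, DD) DDi DW !DM DW1 Di DY.
  have -> : W2 * Yq * Yq = 64 * tq ^+ 4 * (W1 + W) * fq ^+ 2 * Yq.
    by rewrite {1}Yq_eq -ode; ring.
  have -> : W1 * Yq = W1 * fq ^+ 2 * (1 - 16 * tq ^+ 4) by rewrite Yq_eq; ring.
  set i := fq^-1; set k := 1 - 16 * tq ^+ 4.
  have e : i * fq = 1 by rewrite mulVr.
  transitivity (64 * tq ^+ 4 * Yq * fq * (i * fq - 1) * W); last by rewrite e subrr mulr0 mul0r.
  by rewrite /k; ring.
apply: D0_eq1; last by rewrite cf0M cf0V // W0 fq0 invr1 mulr1.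
apply: D_eq; first by rewrite DX2 (D_nat 0).
by rewrite cf_D mul0r.
Qed.

(** * The forms [g2] and [H] *)

HB.lock Definition g2q : fps := qX * dil 4 (euler ^+ 6).
HB.lock Definition g3q : fps := 16 * g2q * tq ^+ 2.
HB.lock Definition Kq : fps := (fq * rq)^-1.

Lemma euler6 : euler ^+ 6 * th3 = th3 ^+ 2 * th2 * th4 ^+ 4.
Proof.
have u1 := mulrV unit_euler.
have u2 := mulrV (unit_eulerd (isT : (0 < 2)%N)).
have u4 := mulrV (unit_eulerd (isT : (0 < 4)%N)).
rewrite th2_eta th4.unlock th3_eta.
move: (dil 2 euler)^-1 (dil 4 euler)^-1 euler^-1 u1 u2 u4.
move: (dil 2 euler) (dil 4 euler) => e2 e4; move: euler => e1 i2 i4 i1 u1 u2 u4.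
transitivity (e1 ^+ 6 * e2 ^+ 5 * i1 ^+ 2 * i4 ^+ 2); first by ring.
transitivity (e1 ^+ 6 * e2 ^+ 5 * i1 ^+ 2 * i4 ^+ 2 * (e1 * i1) ^+ 2 * (e2 * i2) ^+ 5 * (e4 * i4) ^+ 2).
  by rewrite u1 u2 u4; ring.
by ring.
Qed.

Lemma th2_th3_eta : th2 * dil 2 euler ^+ 6 = th3 * (euler ^+ 2 * dil 4 euler ^+ 4).
Proof.
have u1 := mulrV unit_euler.
have u2 := mulrV (unit_eulerd (isT : (0 < 2)%N)).
have u4 := mulrV (unit_eulerd (isT : (0 < 4)%N)).
rewrite th2_eta th3_eta.
move: (dil 2 euler)^-1 (dil 4 euler)^-1 euler^-1 u1 u2 u4.
move: (dil 2 euler) (dil 4 euler) => e2 e4; move: euler => e1 i2 i4 i1 u1 u2 u4.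
transitivity (e4 ^+ 2 * e2 ^+ 5 * (e2 * i2)); first by ring.
transitivity (e4 ^+ 2 * e2 ^+ 5 * (e1 * i1) ^+ 2 * (e4 * i4) ^+ 2); last by ring.
by rewrite u1 u2 u4; ring.
Qed.

Lemma dil4_euler6 : dil 4 (euler ^+ 6) = fq * rq * Yq.
Proof.
have u3 : dil 4 th3 \is a GRing.unit by rewrite unit_dil ?unit_th3.
apply: (mulIr u3); rewrite -(dilM pos4) euler6 fq.unlock Yq.unlock !(dilM pos4) -rq_th; ring.
Qed.

Lemma g2qE : g2q = fq * D tq.
Proof. by rewrite g2q.unlock dil4_euler6 D_tq tq.unlock; ring. Qed.

Lemma fps_of_g2 : fps_of g2_ps = dil 4 (euler ^+ 6).
Proof. by rewrite fps_of_pow fps_of_dil // -(dilX pos4). Qed.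

Lemma fps_of_L2 : fps_of L2_ps = rq^-1.
Proof.
have n1 (f : ps) : f 0%N = 1 -> forall d k, (0 < d)%N -> pspow (psdil d f) k 0%N = 1.
  move=> f0 d k d0; elim: k => [|k IH] //.
  by rewrite /pspow /= /psmul big_ord1 -/(pspow _ _) IH /psdil dvdn0 div0n f0.
have E0 : euler_ps 0%N = 1 by rewrite /euler_ps big_geq // coef1.
rewrite /L2_ps fps_of_mul fps_of_inv; last by rewrite /psmul big_ord1 !n1.
rewrite fps_of_mul !fps_of_pow !fps_of_dil // -/euler.
have uA : dil 4 euler ^+ 2 * dil 16 euler ^+ 4 \is a GRing.unit.
  by rewrite !(unitrM, unitrX) ?unit_dil ?unit_euler.
have H : rq * dil 8 euler ^+ 6 = dil 4 euler ^+ 2 * dil 16 euler ^+ 4.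
  have u3 : dil 4 th3 \is a GRing.unit by rewrite unit_dil ?unit_th3.
  apply: (mulIr u3); rewrite mulrAC rq_th.
  have := congr1 (dil 4) th2_th3_eta; rewrite !(dilX pos4, dilM pos4).
  rewrite (dil_dil euler pos4 (isT : (0 < 2)%N)) (dil_dil euler pos4 pos4) => ->.
  by rewrite mulrC.
have u8 : dil 8 euler ^+ 6 \is a GRing.unit by rewrite unitrX ?unit_dil ?unit_euler.
rewrite -H (invrM unit_rq u8) mulVKr //.
Qed.

Definition Hq := fps_of H_ps.

(* In terms of [K = q / (t f)] the right-hand side is [q D^2 (1 / (t f))]. *)
Lemma Hq_g3q : Hq - qX * g3q = D (D Kq - Kq) - (D Kq - Kq).
Proof.
have uK : fq * rq \is a GRing.unit by rewrite unitrM unit_fq unit_rq.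
have KE : Kq * (fq * rq) = 1 by rewrite Kq.unlock mulVr.
have DK : D Kq - Kq = - (Kq * (Yq + Fq)).
  have := congr1 D KE; rewrite D1 !DM D_fq => E.
  apply: (mulIr uK); apply/eqP; rewrite -subr_eq0; apply/eqP; rewrite -[RHS]E.
  transitivity (D Kq * (fq * rq) - Kq * fq * (rq - rq * Yq) + Kq * fq * rq * Fq); first by ring.
  by rewrite -D_rq; ring.
have HE : Hq = fq * Yq / rq.
  rewrite /Hq /H_ps fps_of_mul fps_of_pow fps_of_L2 fps_of_g2 dil4_euler6.
  by rewrite expr2 mulrA [fq * rq * Yq]mulrAC mulrK ?unit_rq // mulrAC.
rewrite DK DN DM !DD.
have -> : D Kq = Kq - Kq * (Yq + Fq) by rewrite -DK addrC subrK.
have DY : D Yq = 2 * Fq * Yq - 64 * tq ^+ 4 * fq ^+ 2 * Yq.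
  rewrite [in LHS]Yq_eq DM DB (D_nat 1) DM D_nat !DX D_fq D_tq /=.
  transitivity (2 * Fq * (fq ^+ 2 * (1 - 16 * tq ^+ 4)) - 64 * tq ^+ 4 * fq ^+ 2 * Yq); first by ring.
  by rewrite -Yq_eq.
transitivity (Kq * (Yq ^+ 2 + 2 * Yq * Fq + (Fq ^+ 2 - D Fq) - D Yq)); last by ring.
rewrite DY Fq_riccati.
transitivity (Kq * Yq ^+ 2); last by ring.
apply: (mulIr uK); apply: (mulIr (unit_rq)).
transitivity (Kq * (fq * rq) * (Yq ^+ 2 * rq)); last by ring.
rewrite KE mul1r HE g3q.unlock g2q.unlock dil4_euler6.
transitivity (fq ^+ 2 * Yq * rq * (rq / rq) - 16 * fq ^+ 2 * rq ^+ 3 * Yq * (qX * tq) ^+ 2); first by ring.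
rewrite mulrV ?unit_rq // mulr1 expr2.
transitivity (fq ^+ 2 * (1 - 16 * tq ^+ 4) * Yq * rq); last by rewrite -Yq_eq; ring.
by rewrite tq.unlock; ring.
Qed.

(** * The complex multiplication property of [g2] *)

(** As (p - 1)/2 = 2 c + 1 is odd, raising x^2 = - y^2 to this power and using Fermat's theorem
    gives x y = - x y in the prime field. *)
Lemma sum_sqr_dvd p c a b : prime p -> p = (4 * c + 3)%N ->
  (p %| a ^ 2 + b ^ 2)%N -> (p %| a)%N /\ (p %| b)%N.
Proof.
move=> pp pE dv.
have dvE n : (p %| n)%N = (n%:R == 0 :> 'F_p) by rewrite (dvdn_pcharf (pchar_Fp pp)).
have fer n : (n%:R : 'F_p) ^+ p = n%:R.
  by rewrite -natrX -(Fp_nat_mod pp) fermat_little // Fp_nat_mod.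
have sqd n : (p %| n ^ 2)%N = (p %| n)%N by rewrite Euclid_dvdX // andbT.
suff: (p %| a)%N || (p %| b)%N.
  case/orP=> d; split=> //; move: dv; first by rewrite dvdn_addr sqd.
  by rewrite dvdn_addl sqd.
move: dv; rewrite !dvE natrD !natrX; set x := a%:R; set y := b%:R => /eqP/eqP.
rewrite addr_eq0 => /eqP sq.
have fx : x ^+ p = x by exact: fer.
have fy : y ^+ p = y by exact: fer.
have odd_pow (z : 'F_p) : z ^+ p = z * (z ^+ 2) ^+ (2 * c).+1.
  by rewrite -exprM -exprS; congr (_ ^+ _); lia.
have e : x * y = - (x * y).
  rewrite -{1}fx odd_pow sq exprNn -signr_odd /= mul2n odd_double /= -mul2n expr1.
  rewrite mulN1r mulrN mulNr -mulrA; congr (- (x * _)).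
  by rewrite mulrC -[RHS]fy [RHS]odd_pow.
have two : (2 : 'F_p) != 0 by rewrite -dvE; apply/negP => /dvdn_leq; lia.
move/eqP: e; rewrite -addr_eq0 -mulr2n -mulr_natr mulf_eq0 (negbTE two) orbF mulf_eq0.
by [].
Qed.

Definition Th3 := dil 4 th3.
Definition Th2 := 2 * (qX * dil 4 th2).

Lemma phi_split : phi = Th3 + Th2.
Proof.
rewrite {1}phi_dissection /Th3 /Th2 th3.unlock th2.unlock.
by rewrite (dil_dil _ (isT : (0 < 4)%N) (isT : (0 < 2)%N)).
Qed.

Lemma cf_Th3 n : Th3 n = if odd n then 0 else phi n.
Proof.
case: ifPn => od.
  rewrite /Th3 cf_dil //; case: ifPn => // /dvdnP[k e]; move: od; rewrite e; lia.
rewrite phi_split cfD /Th2 -(fpsC_nat 2) cfCM cf_qXM.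
case: n od => [|n] od; first by rewrite mulr0 addr0.
rewrite cf_dil //; case: ifPn => [/dvdnP[k e]|_]; last by rewrite mulr0 addr0.
by move: od; rewrite e; lia.
Qed.

Lemma cf_Th2 n : Th2 n = if odd n then phi n else 0.
Proof.
have : phi n = (Th3 + Th2) n by rewrite {1}phi_split.
by rewrite cfD cf_Th3; move: (phi n) (Th2 n) => a b; case: ifP => _ H; lra.
Qed.

(** This writes 2 g2 as the theta series over a^2 + b^2, a even and b odd, with weight b^2 - a^2,
    that is, with a Hecke character of Q(i). It follows from g2 = f D t with t = theta_2 / (2
    theta_3). *)
Lemma g2q_wronskian : 2 * g2q = Th3 * D Th2 - Th2 * D Th3.
Proof.
have E : Th2 = 2 * tq * Th3.
  by rewrite /Th2 /Th3 -rq_th tq.unlock; ring.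
rewrite E !DM D_nat g2qE fq.unlock (dilX (isT : (0 < 4)%N)) -/Th3; ring.
Qed.

Lemma phi_support n : phi n != 0 -> exists s, n = (s ^ 2)%N.
Proof.
case: n => [|n] nz; first by exists 0%N.
apply: contrapT => H; move/eqP: nz; apply; rewrite /= add0r big1 ?mulr0 // => i _.
by case: eqP => // e; case: H; exists i.+1.
Qed.

Lemma phi_sqr s : (0 < s)%N -> phi (s ^ 2)%N = 2.
Proof.
case: s => // s _; rewrite -[phi _]/(_ + _).
have lt : (s < s.+1 ^ 2)%N by rewrite -mulnn mulSn addSn ltnS leq_addr.
rewrite (bigD1 (Ordinal lt)) //= eqxx big1 => [|i ne].
  by rewrite addr0 mulr1 ?expn_eq0 add0r.
rewrite eqn_exp2r // eqSS; case: eqP => // e.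
by case/eqP: ne; apply: val_inj.
Qed.

Lemma phi_scale p n : prime p -> phi (p ^ 2 * n)%N = phi n.
Proof.
move=> pp; have p0 := prime_gt0 pp.
have [/phi_support[s ->]|/negPn/eqP H] := boolP (phi n != 0).
  case: s => [|s]; first by rewrite exp0n // muln0.
  by rewrite -expnMn !phi_sqr // muln_gt0 p0.
rewrite H; apply/eqP/negPn/negP => /phi_support[m e].
have : (p %| m)%N.
  have : (p %| m ^ 2)%N by rewrite -e -mulnn -mulnA dvdn_mulr.
  by rewrite Euclid_dvdX // andbT.
case/dvdnP=> s mE; move: e; rewrite mE expnMn mulnC => /eqP.
rewrite eqn_pmul2r ?expn_gt0 ?p0 // => /eqP e; move: H; rewrite e.
case: s {mE e} => [|s]; last by rewrite phi_sqr.
by rewrite exp0n //= big_ord0 mulr0 addr0.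
Qed.

(** Representations of p^2 n as a sum of two squares are those of n scaled by p, and the weight is
    quadratic. So only the terms of the convolution with index divisible by p^2 survive. *)
Lemma g2q_scale p c n : prime p -> p = (4 * c + 3)%N ->
  g2q (p ^ 2 * n)%N = p%:R ^+ 2 * g2q n.
Proof.
move=> pp pE; have p0 : (0 < p ^ 2)%N by rewrite expn_gt0 prime_gt0.
have op : odd (p ^ 2) by rewrite oddX /= pE; lia.
pose good (x : fps) := (forall i, x i != 0 -> exists s, i = (s ^ 2)%N) /\
  forall i, x (p ^ 2 * i)%N = x i.
have g3 : good Th3.
  split=> i; first by rewrite cf_Th3; case: ifP; rewrite ?eqxx // => _ /phi_support.
  by rewrite !cf_Th3 oddM op phi_scale.
have g2 : good Th2.
  split=> i; first by rewrite cf_Th2; case: ifP; rewrite ?eqxx // => _ /phi_support.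
  by rewrite !cf_Th2 oddM op phi_scale.
have key (x y : fps) : good x -> good y ->
    (x * D y) (p ^ 2 * n)%N = p%:R ^+ 2 * (x * D y) n.
  move=> [xs xp] [ys yp].
  transitivity ((dil (p ^ 2) x * D (dil (p ^ 2) y)) (p ^ 2 * n)%N).
    rewrite !cfM; apply: eq_bigr => i _; rewrite !cf_D !cf_dil //.
    have [d|nd] := boolP (p ^ 2 %| i)%N.
      have le : (i <= p ^ 2 * n)%N by rewrite -ltnS.
      have dd : (p ^ 2 %| p ^ 2 * n - i)%N by rewrite dvdn_sub // dvdn_mulr.
      rewrite dd.
      have [[k e] [l e']] := (dvdnP d, dvdnP dd).
      by rewrite e' e !mulnK // [(k * _)%N]mulnC [(l * _)%N]mulnC xp yp.
    rewrite mul0r; have [-> |xi] := eqVneq (x i) 0; first by rewrite mul0r.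
    have [-> |yi] := eqVneq (y (p ^ 2 * n - i)%N) 0; first by rewrite !mulr0.
    have [[a ea] [b eb]] := (xs _ xi, ys _ yi).
    have : (p %| a ^ 2 + b ^ 2)%N.
      rewrite -ea -eb subnKC; last by rewrite -ltnS.
      by rewrite -mulnn -mulnA dvdn_mulr.
    case/(sum_sqr_dvd pp pE) => pa _; case/negP: nd; rewrite ea.
    exact: dvdn_exp2r.
  rewrite (D_dil p0) mulrCA -dilM // -fpsC_nat cfCM dil_mul //.
  by rewrite natrX.
have h2 : (2 * g2q) (p ^ 2 * n)%N = p%:R ^+ 2 * (2 * g2q) n.
  by rewrite g2q_wronskian !cfB !key //; ring.
move: h2; rewrite -(fpsC_nat 2) !cfCM; lra.
Qed.

(** * The second solution of Legendre's equation and the inverse series of [t] *)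

Definition harm n : rat := \sum_(i < n) i.+1%:R^-1.
Definition psih m := harm (2 * m) - harm m.

Lemma harmS n : harm n.+1 = harm n + n.+1%:R^-1.
Proof. by rewrite /harm big_ord_recr. Qed.

Lemma psihS m : psih m.+1 = psih m + (2 * m%:R + 1)^-1 - (2 * m.+1%:R)^-1.
Proof.
rewrite /psih; have -> : (2 * m.+1 = (2 * m).+2)%N by lia.
rewrite !harmS.
have -> : (2 * m).+1%:R = 2 * m%:R + 1 :> rat by rewrite -addn1 natrD natrM.
have -> : (2 * m).+2%:R = 2 * m.+1%:R :> rat by rewrite -natrM; congr _%:R; lia.
have x0 : m.+1%:R != 0 :> rat by rewrite pnatr_eq0.
move: x0 (2 * m%:R + 1)^-1; move: (m.+1%:R : rat) (harm (2 * m)) => x h x0 y.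
by field.
Qed.

(** Frobenius's method: one quarter of the formal derivative of ['C(2 * m, m) ^ 2] in [m], the
    quarter matching log t = (1/4) log(t^4). *)
Definition nu0 := Fps (fun m => ('C(2 * m, m) ^ 2)%:R * psih m).
HB.lock Definition nut : fps := dil 4 nu0.

Lemma nu0_ode : 2 * D (D nu0) + D w0 =
  qX * (32 * D (D nu0) + 32 * D nu0 + 8 * nu0 + 16 * D w0 + 8 * w0).
Proof.
apply: fpsP => n; rewrite cf_qXM !cfD.
have N k : k%:R = fpsC k%:R by rewrite fpsC_nat.
rewrite (N 2) (N 32) (N 8) (N 16) !cfCM !cf_D.
case: n => [|n]; first by rewrite !mul0r mulr0 addr0.
rewrite !cfD !cfCM !cf_D /=.
have E : n.+1%:R * ('C(2 * n.+1, n.+1))%:R = 2 * (2 * n%:R + 1) * ('C(2 * n, n))%:R :> rat.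
  transitivity ((n.+1 * 'C(2 * n.+1, n.+1))%:R : rat); first by rewrite natrM.
  by rewrite binom_centralS -(addn1 (2 * n)) !(natrM, natrD); ring.
rewrite psihS !natrX.
have n0 : n.+1%:R != 0 :> rat by rewrite pnatr_eq0.
have n1 : 2 * n%:R + 1 != 0 :> rat by rewrite -natrM natr1 pnatr_eq0.
set c := 'C(_, _)%:R in E *; set a := 'C(2 * n, n)%:R in E *.
transitivity (2 * (n.+1%:R * c) ^+ 2 * (psih n + (2 * n%:R + 1)^-1) : rat).
  by field; rewrite n1 [1 + _]addrC natr1.
by rewrite E; field.
Qed.

(** Says that w log t + nu solves the equation of [wt_ode]: the logarithm cancels and leaves the
    terms in [wt]. *)
Lemma nut_ode : (1 - 16 * qX ^+ 4) * D (D nut) =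
  64 * qX ^+ 4 * (D nut + nut) - 2 * D wt + 32 * qX ^+ 4 * (D wt + 2 * wt).
Proof.
have := congr1 (dil 4) nu0_ode; rewrite !dil4E => E.
rewrite nut.unlock wt.unlock !(D_dil pos4) !DM !D_nat !(D_dil pos4).
apply/eqP; rewrite -subr_eq0; apply/eqP; rewrite -[RHS](mulr0 8) -[in RHS](subrr (2 * dil 4 (D (D nu0)) + dil 4 (D w0))).
by rewrite [in X in _ = _ * (_ - X)]E; ring.
Qed.

Lemma wt0 : wt 0%N = 1.
Proof. by rewrite wt.unlock cf0_dil //= muln0 bin0. Qed.
Lemma kap0 : (1 - 16 * qX ^+ 4) 0%N = 1.
Proof. by rewrite cfB (cf0M 16) (cf_qXn 4) mulr0 subr0. Qed.

(** Abel's formula for the Wronskian of w and w log t + nu; the term [wt ^+ 2] comes from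
    differentiating log t. *)
Lemma legendre_wronskian :
  (wt * D nut - nut * D wt + wt ^+ 2) * (1 - 16 * qX ^+ 4) = 1.
Proof.
apply: D0_eq1; last first.
  rewrite cf0M kap0 mulr1 cfD cfB (cf0X wt 2) wt0 expr1n !cf0M !cf_D.
  by rewrite !mul0r !mulr0 subr0 add0r.
rewrite DM DD !DB !(DX, DM) (D_nat 1) D_nat D_qX /=.
transitivity (wt * ((1 - 16 * qX ^+ 4) * D (D nut)) - nut * ((1 - 16 * qX ^+ 4) * D (D wt)) +
  2 * wt * D wt * (1 - 16 * qX ^+ 4) - 64 * qX ^+ 4 * (wt * D nut - nut * D wt + wt ^+ 2)); first by ring.
by rewrite nut_ode wt_ode; ring.
Qed.

Lemma nut0 : nut 0%N = 0.
Proof. by rewrite nut.unlock cf0_dil //= /psih /harm !big_ord0 subrr mulr0. Qed.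
Lemma unit_wt : wt \is a GRing.unit. Proof. exact: unit_fps1 wt0. Qed.
Lemma unit_kap : 1 - 16 * qX ^+ 4 \is a GRing.unit.
Proof. exact: unit_fps1 kap0. Qed.

HB.lock Definition lamT : fps := nut / wt.
(** The derivative of log t + [lamT] with respect to log t. Composed with [tq] it is the inverse of
    [Yq], so it is d log q / d log t. *)
HB.lock Definition omT : fps := (wt ^+ 2 * (1 - 16 * qX ^+ 4))^-1.

Lemma unit_om : wt ^+ 2 * (1 - 16 * qX ^+ 4) \is a GRing.unit.
Proof. by rewrite unitrM unitrX ?unit_wt ?unit_kap. Qed.

Lemma lamT0 : lamT 0%N = 0. Proof. by rewrite lamT.unlock cf0M nut0 mul0r. Qed.
Lemma wt_lamT : wt * lamT = nut. Proof. by rewrite lamT.unlock mulrC mulrVK ?unit_wt. Qed.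
Lemma omTE : omT * (wt ^+ 2 * (1 - 16 * qX ^+ 4)) = 1.
Proof. by rewrite omT.unlock mulVr ?unit_om. Qed.

Lemma D_lamT : D lamT = omT - 1.
Proof.
have DN' : D nut = wt * D lamT + D wt * lamT by rewrite -wt_lamT DM addrC mulrC.
apply: (mulIr unit_om); rewrite mulrBl omTE mul1r -[X in _ = X - _]legendre_wronskian DN' -wt_lamT.
by ring.
Qed.

Definition expo := Fps (fun k => (k`!)%:R^-1).

Lemma der_expo : der expo = expo.
Proof.
apply: fpsP => n /=; rewrite factS natrM invfM mulrA divff ?mul1r //.
by rewrite pnatr_eq0.
Qed.

HB.lock Definition sT : fps := qX * scomp expo lamT.

Lemma sT0 : sT 0%N = 0. Proof. by rewrite sT.unlock cf_qXM. Qed.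
Lemma sT1 : sT 1%N = 1.
Proof. by rewrite sT.unlock cf_qXM cf0_comp /= invr1. Qed.

Lemma D_sT : D sT = sT * omT.
Proof.
rewrite sT.unlock DM D_qX (D_comp _ lamT0) der_expo D_lamT; ring.
Qed.

Lemma omT_tq : scomp omT tq * Yq = 1.
Proof.
have := congr1 (fun x => scomp x tq) omTE.
rewrite comp1 (compM _ _ tq0) (compM (wt ^+ 2) _ tq0) (compX _ _ tq0) wt_tq.
by rewrite (compB 1) comp1 (compM 16 _ tq0) comp_nat (comp_qXn 4 tq0) -Yq_eq.
Qed.

(** The composite satisfies D S = S, so only its coefficient at q can be nonzero, and that
    coefficient is 1. *)
Lemma sT_tq : scomp sT tq = qX.
Proof.
set S := LHS; have DS : D S = S.
  rewrite /S (D_comp_log _ tq0 D_tq) D_sT (compM _ _ tq0) -mulrA omT_tq mulr1 //.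
have S1 : S 1%N = 1.
  rewrite /S /= !big_ord_recl big_ord0 sT0 mul0r /= addr0 add0r /bump /= sT1 mul1r.
  by rewrite expr1 tq.unlock cf_qXM rq0.
clearbody S; apply: fpsP => n; have := congr1 (fun x : fps => x n) DS; rewrite cf_D.
case: n => [|[|n]]; first by rewrite mul0r => <-.
  by rewrite S1.
move=> e; have : (n.+1%:R : rat) * S n.+2 = 0.
  by have := e; rewrite -natr1 mulrDl mul1r -{3}[S n.+2]add0r => /addIr.
by move/eqP; rewrite mulf_eq0 pnatr_eq0 => /eqP ->.
Qed.

Lemma tq1 : tq 1%N = 1. Proof. by rewrite tq.unlock cf_qXM rq0. Qed.

Lemma cf_powd (t : fps) n : t 0%N = 0 -> t 1%N = 1 -> (t ^+ n) n = 1.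
Proof.
move=> t0 t1; elim: n => [|n IH] //.
rewrite exprS cfM big_ord_recl t0 mul0r add0r big_ord_recl /= /bump /= t1 subSS subn0 IH.
rewrite mul1r big1 ?addr0 // => i _; rewrite cfX0 ?mulr0 //.
by rewrite /bump /=; have := ltn_ord i; lia.
Qed.

Lemma cf_comp_last (x t : fps) n : t 0%N = 0 -> t 1%N = 1 ->
  scomp x t n = \sum_(k < n) x k * (t ^+ k) n + x n.
Proof. by move=> t0 t1; rewrite /= big_ord_recr /= cf_powd // mulr1. Qed.

Lemma scomp_inj (t x y : fps) : t 0%N = 0 -> t 1%N = 1 -> scomp x t = scomp y t -> x = y.
Proof.
move=> t0 t1 e; apply: fpsP => n; elim/ltn_ind: n => n IH.
have := congr1 (fun z : fps => z n) e; rewrite !cf_comp_last //.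
by rewrite (eq_bigr _ (fun k _ => congr1 (fun c => c * _) (IH _ (ltn_ord k)))) => /addrI.
Qed.

Lemma tq_sT : scomp tq sT = qX.
Proof.
apply: (scomp_inj tq0 tq1); rewrite (compA _ sT0 tq0) sT_tq comp_id.
by rewrite comp_qX // tq0.
Qed.

(** * Series with coefficients in a subring *)

Section Over.
Variable S : subringClosed rat.

Definition fps_over (x : fps) := forall n, x n \in S.

Lemma overD x y : fps_over x -> fps_over y -> fps_over (x + y).
Proof. by move=> hx hy n; rewrite cfD rpredD. Qed.
Lemma overN x : fps_over x -> fps_over (- x).
Proof. by move=> hx n; rewrite cfN rpredN. Qed.
Lemma overB x y : fps_over x -> fps_over y -> fps_over (x - y).
Proof. by move=> hx hy; apply: overD => //; apply: overN. Qed.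
Lemma overM x y : fps_over x -> fps_over y -> fps_over (x * y).
Proof. by move=> hx hy n; rewrite cfM rpred_sum // => i _; rewrite rpredM. Qed.
Lemma overC c : c \in S -> fps_over (fpsC c).
Proof. by move=> hc n /=; case: ifP; rewrite ?rpred0. Qed.
Lemma over_nat k : fps_over k%:R.
Proof. by rewrite -fpsC_nat; apply: overC; apply: rpred_nat. Qed.
Lemma over1 : fps_over 1. Proof. exact: (over_nat 1). Qed.
Lemma overX x k : fps_over x -> fps_over (x ^+ k).
Proof.
move=> hx; elim: k => [|k IH]; first exact: over1.
by rewrite exprS; apply: overM.
Qed.
Lemma over_qX : fps_over qX.
Proof. by move=> n /=; apply: rpred_nat. Qed.
Lemma over_comp (x t : fps) : fps_over x -> fps_over t -> fps_over (scomp x t).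
Proof. by move=> hx ht n; rewrite rpred_sum // => k _; rewrite rpredM // overX. Qed.
Lemma over_dil d x : fps_over x -> fps_over (dil d x).
Proof. by rewrite dil.unlock => hx; apply: over_comp => //; apply/overX/over_qX. Qed.
Lemma over_V (x : fps) : x 0%N = 1 -> fps_over x -> fps_over x^-1.
Proof.
move=> x0 hx n; have u := unit_fps1 x0.
elim/ltn_ind: n => -[|n] IH; first by rewrite cf0V // x0 invr1 rpred1.
have := congr1 (fun z : fps => z n.+1) (mulrV u).
rewrite cfM cf1 big_ord_recl x0 mul1r subn0 => /eqP.
rewrite addr_eq0 => /eqP ->; rewrite rpredN rpred_sum // => i _.
by rewrite rpredM // IH // subSS ltnS leq_subr.
Qed.

(** Substituting [t] acts on coefficients by a unitriangular matrix over [S], which can be inverted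
    over [S]. *)
Lemma over_triangular (x t : fps) : t 0%N = 0 -> t 1%N = 1 -> fps_over t ->
  fps_over (scomp x t) -> fps_over x.
Proof.
move=> t0 t1 ht hx n; elim/ltn_ind: n => n IH.
have -> : x n = scomp x t n - \sum_(k < n) x k * (t ^+ k) n.
  by rewrite cf_comp_last // addrC addKr.
rewrite rpredB // rpred_sum // => k _; rewrite rpredM ?IH //.
exact: overX.
Qed.

End Over.

Section OverS.
Variable S : subringClosed rat.
Let fps_over := (fps_over S).

Lemma over_fps_of f : fps_over (fps_of f).
Proof. by move=> n /=; rewrite rpred_int. Qed.
Lemma over_eulerd d : fps_over (dil d euler).
Proof. exact/over_dil/over_fps_of. Qed.
Lemma over_th2 : fps_over th2.
Proof.
rewrite th2.unlock /psi; apply/over_dil/overM; first exact/overX/over_eulerd.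
apply: over_V; [exact: euler0 | exact: over_fps_of].
Qed.
Lemma over_th3 : fps_over th3.
Proof.
rewrite th3.unlock => n; rewrite -[phi n]/(_ + _ * _).
by rewrite rpredD ?rpred_nat // rpredM ?rpred_nat // rpred_sum // => i _; rewrite rpred_nat.
Qed.
Lemma over_rq : fps_over rq.
Proof.
rewrite rq.unlock; apply/over_dil/overM; first exact: over_th2.
by apply: over_V; [exact: th3_0 | exact: over_th3].
Qed.
Lemma over_tq : fps_over tq.
Proof. by rewrite tq.unlock; apply: overM; [exact: over_qX | exact: over_rq]. Qed.
Lemma over_fq : fps_over fq.
Proof. by rewrite fq.unlock; apply/over_dil/overX/over_th3. Qed.
Lemma over_Kq : fps_over Kq.
Proof.
rewrite Kq.unlock; apply: over_V; last exact: overM over_fq over_rq.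
by rewrite cf0M fq0 rq0 mulr1.
Qed.
Lemma over_g2q : fps_over g2q.
Proof. by rewrite g2q.unlock -fps_of_g2; apply: overM; [exact: over_qX | exact: over_fps_of]. Qed.
Lemma over_wt : fps_over wt.
Proof. by rewrite wt.unlock; apply: over_dil => n; rewrite /= rpred_nat. Qed.
Lemma over_omT : fps_over omT.
Proof.
rewrite omT.unlock; apply: over_V.
  by rewrite cf0M kap0 (cf0X wt 2) wt0 expr1n mulr1.
apply: overM; first exact/overX/over_wt.
apply: overB; first exact: over1.
by apply: overM; [exact: over_nat | exact/overX/over_qX].
Qed.
(** Invisible on the definition by an exponential; it holds because [sT] is the compositional
    inverse of the integral series [tq]. *)
Lemma over_sT : fps_over sT.
Proof.
apply: (over_triangular tq0 tq1); first exact: over_tq.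
by rewrite sT_tq; apply: over_qX.
Qed.
End OverS.

(** * [p]-integral rationals *)

Section Pint.
Variables (p : nat) (pp : prime p).

(** The localization of Z at p. The primality proof is an argument so that the predicate can carry a
    subring structure, whose closure laws rest on it. *)
Definition pint_at (_ : prime p) : {pred rat} := fun x => ~~ (p %| `|denq x|)%N.
Local Notation pint := (pint_at pp).

Lemma pint_frac (x : rat) (b : nat) (a : int) :
  ~~ (p %| b)%N -> x * b%:R = a%:~R -> x \in pint.
Proof.
move=> nb e; apply/negP => pd; case/negP: nb; apply: dvdn_trans pd _.
have e2 : numq x * b%:Z = a * denq x.
  apply/eqP; rewrite -(eqr_int rat) !rmorphM /= -e numqE; apply/eqP.
  by rewrite -pmulrn; ring.
have : (`|denq x| %| `|numq x| * b)%N.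
  have -> : (`|numq x| * b = absz (numq x * b%:Z)%R)%N by rewrite abszM.
  by rewrite e2 abszM dvdn_mull.
by rewrite Gauss_dvdr // coprime_sym coprime_num_den.
Qed.

Lemma pintP x : x \in pint ->
  exists a : int, exists2 b : nat, ~~ (p %| b)%N & x * b%:R = a%:~R.
Proof.
move=> h; exists (numq x), `|denq x|%N => //.
by rewrite numqE; congr (_ * _); rewrite pmulrn absz_denq.
Qed.

Fact pint_subring : subring_closed pint.
Proof.
split=> [|x y /pintP[a [b nb e]] /pintP[c [d nd e']]|x y /pintP[a [b nb e]] /pintP[c [d nd e']]].
- by apply: (@pint_frac _ 1 1); rewrite ?dvdn1 ?mulr1 //; case: eqP pp => // ->.
- apply: (@pint_frac _ (b * d) (a * d%:Z - c * b%:Z)); first by rewrite Euclid_dvdM // negb_or nb.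
  by rewrite natrM rmorphB !rmorphM /= -e -e' -!pmulrn; ring.
- apply: (@pint_frac _ (b * d) (a * c)); first by rewrite Euclid_dvdM // negb_or nb.
  by rewrite natrM rmorphM /= -e -e'; ring.
Qed.

HB.instance Definition _ := GRing.isSubringClosed.Build rat pint pint_subring.

Lemma pint_intV n : ~~ (p %| n)%N -> (n%:R^-1 : rat) \in pint.
Proof.
move=> nn; apply: (@pint_frac _ n 1) => //; rewrite mulVf // pnatr_eq0.
by case: eqP nn => // ->; rewrite dvdn0.
Qed.

Lemma int_pint x : x \is a Num.int -> x \in pint.
Proof. by move=> /intrP[m ->]; rewrite rpred_int. Qed.

Lemma pint_dvd n k : (n%:~R / (p ^ k)%:R : rat) \in pint -> (p ^ k %| `|n|)%N.
Proof.
move=> /pintP[a [b nb e]].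
have p0 : (p ^ k)%:R != 0 :> rat by rewrite pnatr_eq0 -lt0n expn_gt0 prime_gt0.
have e2 : n * b%:Z = a * (p ^ k)%:Z.
  apply/eqP; rewrite -(eqr_int rat) !rmorphM /= -e -!pmulrn mulrAC divfK //.
have : (p ^ k %| `|n| * b)%N.
  have -> : (`|n| * b = absz (n * b%:Z)%R)%N by rewrite abszM.
  by rewrite e2 abszM dvdn_mull.
by rewrite Gauss_dvdl // coprimeXl // prime_coprime.
Qed.

Definition pdvd (d x : rat) := exists2 r, r \in pint & x = d * r.

Lemma pdvd0 d : pdvd d 0. Proof. by exists 0; rewrite ?rpred0 ?mulr0. Qed.
Lemma pdvdD d x y : pdvd d x -> pdvd d y -> pdvd d (x + y).
Proof. by move=> [r hr ->] [s hs ->]; exists (r + s); rewrite ?rpredD // mulrDr. Qed.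
Lemma pdvdN d x : pdvd d x -> pdvd d (- x).
Proof. by move=> [r hr ->]; exists (- r); rewrite ?rpredN // mulrN. Qed.
Lemma pdvdB d x y : pdvd d x -> pdvd d y -> pdvd d (x - y).
Proof. by move=> hx hy; apply: pdvdD => //; apply: pdvdN. Qed.
Lemma pdvdMl d x y : y \in pint -> pdvd d x -> pdvd d (y * x).
Proof. by move=> hy [r hr ->]; exists (y * r); rewrite ?rpredM // mulrCA. Qed.
Lemma pdvdMr d x y : y \in pint -> pdvd d x -> pdvd d (x * y).
Proof. by rewrite mulrC; apply: pdvdMl. Qed.
Lemma pdvd_trans d e x : pdvd d e -> pdvd e x -> pdvd d x.
Proof. by move=> [r hr ->] [s hs ->]; exists (r * s); rewrite ?rpredM // mulrA. Qed.
Lemma pdvd_self d y : y \in pint -> pdvd d (d * y).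
Proof. by exists y. Qed.
Lemma pdvd_sum d I (r : seq I) (P : pred I) (F : I -> rat) :
  (forall i, P i -> pdvd d (F i)) -> pdvd d (\sum_(i <- r | P i) F i).
Proof.
by move=> H; elim/big_rec: _ => [|i x Pi hx]; [exact: pdvd0 | apply: pdvdD => //; exact: H].
Qed.
Lemma pdvd_nat a b : (a %| b)%N -> pdvd a%:R b%:R.
Proof. by case/dvdnP=> k ->; exists k%:R; rewrite ?rpred_nat // natrM mulrC. Qed.

Lemma pdvd_logn a b : (0 < a)%N -> (0 < b)%N -> (logn p a <= logn p b)%N -> pdvd a%:R b%:R.
Proof.
move=> a0 b0 le; have npa : ~~ (p %| a`_p^')%N.
  by rewrite -p'natE // part_pnat.
have d : (a`_p %| b)%N by rewrite p_part pfactor_dvdn.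
apply: pdvd_trans (pdvd_nat d).
exists (a`_p^')%:R^-1; first exact: pint_intV.
by rewrite -{2}(partnC p a0) natrM mulfK // pnatr_eq0 -lt0n part_gt0.
Qed.

End Pint.

(** * Central binomial coefficients and the [p]-adic Gamma function *)

Section Gauss.
Variables (p : nat) (pp : prime p) (c : nat) (pE : p = (4 * c + 3)%N).
Local Notation pint := (pint_at pp).
Local Notation pdvd := (pdvd pp).

(* The [p]-free part of [N!] (up to sign a value of the [p]-adic Gamma function). *)
Definition pfact N := (\prod_(i < N | ~~ (p %| i.+1)%N) i.+1)%N.
Definition pharm N : rat := \sum_(i < N | ~~ (p %| i.+1)%N) i.+1%:R^-1.

Let p_gt0 : (0 < p)%N := prime_gt0 pp.
Let pr0 : (p%:R : rat) != 0. Proof. by rewrite pnatr_eq0 -lt0n. Qed.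

Lemma pfactS N : pfact N.+1 = ((if p %| N.+1 then 1 else N.+1) * pfact N)%N.
Proof.
by rewrite /pfact big_mkcond big_ord_recr -big_mkcond /= [LHS]mulnC; case: (p %| N.+1)%N.
Qed.

Lemma pharmS N : pharm N.+1 = pharm N + (if (p %| N.+1)%N then 0 else N.+1%:R^-1).
Proof.
by rewrite /pharm big_mkcond big_ord_recr -big_mkcond /=; case: (p %| N.+1)%N.
Qed.

Lemma fact_pfact N : N`! = (pfact N * p ^ (N %/ p) * (N %/ p)`!)%N.
Proof.
elim: N => [|N IH]; first by rewrite /pfact big_ord0 div0n.
rewrite factS IH pfactS divnS //; case: ifPn => [d|_].
  rewrite add1n expnS factS mul1n.
  have e : N.+1 = (p * (N %/ p).+1)%N.
    by have /dvdnP[k e] := d; have := divnS N p_gt0; rewrite d e mulnK // add1n => <-; rewrite mulnC.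
  rewrite {1}e; lia.
by rewrite add0n !mulnA.
Qed.

Lemma harm_pharm N : harm N = pharm N + p%:R^-1 * harm (N %/ p).
Proof.
elim: N => [|N IH]; first by rewrite /pharm /harm div0n !big_ord0 mulr0 addr0.
rewrite harmS IH pharmS divnS //; case: ifPn => [d|_]; last by rewrite add0n addrAC.
have e : N.+1 = (p * (N %/ p).+1)%N.
  by have /dvdnP[k e] := d; have := divnS N p_gt0; rewrite d e mulnK // add1n => <-; rewrite mulnC.
by rewrite add1n harmS e natrM invfM; ring.
Qed.

Lemma pfact_unit N : ~~ (p %| pfact N)%N.
Proof.
elim: N => [|N IH]; first by rewrite /pfact big_ord0 dvdn1; case: eqP pp => // ->.
rewrite pfactS Euclid_dvdM // negb_or IH andbT; case: ifPn => // _.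
by rewrite dvdn1; case: eqP pp => // ->.
Qed.

Lemma pfact_neq0 N : (pfact N)%:R != 0 :> rat.
Proof.
by rewrite pnatr_eq0; case: eqP (pfact_unit N) => // ->; rewrite dvdn0.
Qed.

Lemma pint_pfactV N : (pfact N)%:R^-1 \in pint.
Proof. exact: pint_intV (pfact_unit N). Qed.

Lemma pint_pharm N : pharm N \in pint.
Proof. by rewrite rpred_sum // => i; apply: pint_intV. Qed.

Lemma p_odd2 : ~~ (p %| 2)%N. Proof. by apply/negP => /dvdn_leq; lia. Qed.
Lemma pint_half : (2^-1 : rat) \in pint.
Proof. exact: pint_intV p_odd2. Qed.
Lemma pint_quarter : (4^-1 : rat) \in pint.
Proof. by rewrite (_ : 4^-1 = 2^-1 * 2^-1) ?rpredM ?pint_half //; field. Qed.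

Lemma pfact_shift d N : (p %| d)%N ->
  pfact (d + N) = (pfact d * \prod_(i < N | ~~ (p %| i.+1)) (d + i.+1))%N.
Proof.
move=> pd; elim: N => [|N IH]; first by rewrite addn0 big_ord0 muln1.
rewrite addnS pfactS IH -addnS dvdn_addr // [in RHS]big_mkcond big_ord_recr -big_mkcond /=.
case: (p %| N.+1)%N => /=; first by rewrite mul1n muln1.
by rewrite mulnC mulnA.
Qed.

(** First-order expansion in [d] of the p-adic Gamma function, with [pharm] as its logarithmic
    derivative. *)
Lemma pfact_shift_mod d N : (p %| d)%N ->
  pdvd (d%:R ^+ 2) ((pfact (d + N))%:R - (pfact d)%:R * (pfact N)%:R * (1 + d%:R * pharm N)).
Proof.
move=> pd; rewrite pfact_shift // natrM -mulrA -mulrBr; apply: pdvdMl; first exact: rpred_nat.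
elim: N => [|N IH]; first by rewrite /pfact /pharm !big_ord0 mulr0 addr0 mulr1 subrr; apply: pdvd0.
rewrite big_mkcond big_ord_recr -big_mkcond /= pfactS pharmS.
case: (p %| N.+1)%N => /=; first by rewrite muln1 mul1n addr0.
move: IH; rewrite !natrM natrD; set P := (\prod_(i < N | _) _)%:R.
have n0 : N.+1%:R != 0 :> rat by rewrite pnatr_eq0.
have kz : (N.+1%:R : rat) \in pint by rewrite rpred_nat.
have [hF hH] : (pfact N)%:R \in pint /\ pharm N \in pint.
  by rewrite rpred_nat pint_pharm.
move: n0 kz hF hH; move: (N.+1%:R) (pfact N)%:R (pharm N) => k F H n0 kz hF hH IH.
have -> : P * (d%:R + k) - k * F * (1 + d%:R * (H + k^-1)) =
   (P - F * (1 + d%:R * H)) * (d%:R + k) + d%:R ^+ 2 * (F * H) by field.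
apply: pdvdD; first by apply: pdvdMr; rewrite // rpredD ?rpred_nat.
by apply: pdvd_self; rewrite rpredM.
Qed.

(* Pairing [i] with [d - i]. *)
Lemma pharm_self d : (p %| d)%N -> pdvd d%:R (pharm d).
Proof.
case: d => [|d] pd; first by rewrite /pharm big_ord0; apply: pdvd0.
have E : pharm d.+1 = \sum_(i < d | ~~ (p %| i.+1)%N) i.+1%:R^-1.
  by rewrite pharmS pd addr0.
have E2 : pharm d.+1 = \sum_(i < d | ~~ (p %| i.+1)%N) (d - i)%:R^-1.
  rewrite E (reindex_inj rev_ord_inj) /=; apply: eq_big => i.
    have lt := ltn_ord i; have le : (i.+1 <= d.+1)%N by lia.
    have -> : (d - i.+1).+1 = (d.+1 - i.+1)%N by lia.
    by rewrite (dvdn_subr le pd).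
  by move=> _; congr (_%:R^-1); have := ltn_ord i; lia.
have -> : pharm d.+1 = 2^-1 * (pharm d.+1 + pharm d.+1) by field.
apply: pdvdMl; first exact: pint_half.
rewrite {1}E E2 -big_split /=; apply: pdvd_sum => i ni.
have lt := ltn_ord i.
exists (i.+1%:R^-1 * (d - i)%:R^-1).
  rewrite rpredM ?pint_intV // -[(d - i)%N]subSS dvdn_subr //; lia.
have i0 : i.+1%:R != 0 :> rat by rewrite pnatr_eq0.
have j0 : (d - i)%:R != 0 :> rat by rewrite pnatr_eq0; lia.
have -> : d.+1%:R = i.+1%:R + (d - i)%:R :> rat by rewrite -natrD; congr _%:R; lia.
move: i0 j0; move: i.+1%:R (d - i)%:R => x y x0 y0.
by field; rewrite x0 y0.
Qed.

(** For n = p m + c this is 4 times the quotient of the central binomial coefficients at n and m;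
    the 4 is the square root of the 16 in g3 = 16 g2 t^2. [Tht] is half its logarithmic derivative
    in n. *)
Definition kap n : rat := 4 * (pfact (2 * n))%:R / (pfact n)%:R ^+ 2.
Definition Tht n := pharm (2 * n) - pharm n.

Lemma kap_neq0 n : kap n != 0.
Proof. by rewrite /kap !mulf_neq0 ?invr_eq0 ?expf_neq0 ?pfact_neq0. Qed.
Lemma pint_kap n : kap n \in pint.
Proof. by rewrite /kap !rpredM ?rpred_nat // -exprVn rpredX // pint_pfactV. Qed.
Lemma pint_kapV n : (kap n)^-1 \in pint.
Proof.
rewrite /kap invfM invrK invfM !rpredM ?rpredX ?rpred_nat ?pint_pfactV //.
exact: pint_quarter.
Qed.
Lemma pint_Tht n : Tht n \in pint.
Proof. by rewrite rpredB ?pint_pharm. Qed.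

(** The factors depending on [d] alone cancel modulo d^2: [pfact (2 * d)] is [pfact d ^ 2] times 1 +
    d [pharm d], and [pharm d] is itself divisible by [d]. *)
Lemma kap_shift n d : (p %| d)%N ->
  pdvd (d%:R ^+ 2) (kap (n + d) - kap n * (1 + 2 * d%:R * Tht n)).
Proof.
move=> pd; have pd2 : (p %| 2 * d)%N by rewrite dvdn_mull.
have u := pfact_neq0.
have [r hr e1] := pfact_shift_mod n pd.
have [r2 hr2 e2] := pfact_shift_mod (2 * n) pd2.
have [r3 hr3 e3] := pfact_shift_mod d pd.
have [r4 hr4 e4] := pharm_self pd.
rewrite -mulnDr natrM in e2; rewrite addnn -mul2n e4 in e3.
rewrite /kap /Tht [(n + d)%N]addnC.
have ux := pint_pfactV (d + n); have un := pint_pfactV n.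
have [y0 f0] := (u (d + n)%N, u n).
have ri k : (pfact k)%:R \in pint by rewrite rpred_nat.
have [hH1 hH2] := (pint_pharm n, pint_pharm (2 * n)).
have [[rF1 rF2] rD1] := (ri n, ri (2 * n)%N, ri d); have rd : d%:R \in pint by rewrite rpred_nat.
move: (pharm n) (pharm (2 * n)) hH1 hH2 e1 e2 => H1 H2 hH1 hH2 e1 e2.
move: e1 e2 e3 y0 f0 ux un rF1 rF2 rD1.
move: (pfact (2 * (d + n)))%:R (pfact (d + n))%:R (pfact (2 * d))%:R (pfact d)%:R => x y D2 D1.
move: (pfact (2 * n))%:R (pfact n)%:R => F2 F1 e1 e2 e3 y0 f0 ux un rF1 rF2 rD1.
move: (d%:R) rd e1 e2 e3 => {e4} z rz e1 e2 e3.
(* [X] and the local [Yq] are the second-order remainders of [pfact (2 * (d + n))] and of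
   [pfact (d + n) ^ 2]. *)
pose X := (D1 * D1 * r4 + r3) * F2 * (1 + 2 * z * H2) + 4 * r2.
pose Yq := D1 ^+ 2 * F1 ^+ 2 * H1 ^+ 2 + 2 * D1 * F1 * (1 + z * H1) * r + z ^+ 2 * r ^+ 2.
have eD : D2 = D1 * D1 * (1 + z * (z * r4)) + z ^+ 2 * r3.
  by rewrite -e3; ring.
have ex : x = D1 ^+ 2 * F2 * (1 + 2 * z * H2) + z ^+ 2 * X.
  have -> : x = D2 * F2 * (1 + 2 * z * H2) + (2 * z) ^+ 2 * r2 by rewrite -e2; ring.
  by rewrite eD /X; ring.
have ey : y ^+ 2 = D1 ^+ 2 * F1 ^+ 2 * (1 + 2 * z * H1) + z ^+ 2 * Yq.
  have -> : y = D1 * F1 * (1 + z * H1) + z ^+ 2 * r by rewrite -e1; ring.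
  by rewrite /Yq; ring.
have rX : X \in pint by rewrite !(rpredD, rpredM, rpred_nat) ?rpred1.
have rY : Yq \in pint by rewrite !(rpredD, rpredM, rpredX, rpred_nat) ?rpred1.
exists (4 * y^-1 ^+ 2 * F1^-1 ^+ 2 * (X * F1 ^+ 2 - F2 * Yq * (1 + 2 * z * (H2 - H1)) -
   4 * D1 ^+ 2 * F2 * F1 ^+ 2 * H1 * (H2 - H1))).
  by rewrite !(rpredD, rpredN, rpredM, rpredX, rpred_nat) ?rpred1.
transitivity (4 * y^-1 ^+ 2 * F1^-1 ^+ 2 * (x * F1 ^+ 2 - F2 * y ^+ 2 * (1 + 2 * z * (H2 - H1)))).
  by field; rewrite y0 f0.
by rewrite ex ey; ring.
Qed.

Lemma Tht_shift n d : (p %| d)%N -> pdvd d%:R (Tht (n + d) - Tht n).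
Proof.
have H N e : (p %| e)%N -> pdvd e%:R (pharm (e + N) - pharm N).
  move=> pe; elim: N => [|N IH].
    by rewrite addn0 {2}/pharm big_ord0 subr0; apply: pharm_self.
  rewrite addnS !pharmS -addnS dvdn_addr //; case: ifPn => [_|nd]; first by rewrite !addr0.
  have a0 : N.+1%:R != 0 :> rat by rewrite pnatr_eq0.
  have b0 : (e + N.+1)%:R != 0 :> rat by rewrite pnatr_eq0 addnS.
  have -> : pharm (e + N) + (e + N.+1)%:R^-1 - (pharm N + N.+1%:R^-1) =
     pharm (e + N) - pharm N - e%:R * ((e + N.+1)%:R^-1 * N.+1%:R^-1).
    move: b0; rewrite natrD; move: a0; move: (N.+1%:R : rat) => k a0 b0.
    by field; rewrite a0 b0.
  apply: pdvdB => //; apply: pdvd_self.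
  by rewrite rpredM ?pint_intV // dvdn_addr.
move=> pd; have -> : Tht (n + d) - Tht n =
   (pharm (2 * d + 2 * n) - pharm (2 * n)) - (pharm (d + n) - pharm n).
  by rewrite /Tht mulnDr [(2 * n + _)%N]addnC [(n + d)%N]addnC; ring.
apply: pdvdB; last exact: H.
apply: (@pdvd_trans _ _ _ (2 * d)%:R); last by apply: H; rewrite dvdn_mull.
exact/pdvd_nat/dvdn_mull.
Qed.

(** Both c and 2 c are below p = 4 c + 3, so n = p m + c and 2 n have quotients m and 2 m by p; the
    powers of p in the factorials then cancel. *)
Lemma binom_kap m : 4 * ('C(2 * (p * m + c), p * m + c))%:R =
  kap (p * m + c) * ('C(2 * m, m))%:R.
Proof.
set n := (p * m + c)%N.
have cp : (c < p)%N by lia.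
have q1 : (n %/ p = m)%N by rewrite /n mulnC divnMDl // divn_small // addn0.
have q2 : (2 * n %/ p = 2 * m)%N.
  have -> : (2 * n = (2 * m) * p + 2 * c)%N by rewrite /n; lia.
  by rewrite divnMDl // divn_small ?addn0 //; lia.
have E k : ('C(2 * k, k))%:R * (k`!%:R) ^+ 2 = ((2 * k)`!)%:R :> rat.
  have le : (k <= 2 * k)%N by lia.
  by rewrite -(bin_fact le) (_ : 2 * k - k = k)%N ?natrM ?expr2 //; lia.
have fn k : (k`!)%:R != 0 :> rat by rewrite pnatr_eq0 -lt0n fact_gt0.
have := E n; have := E m; rewrite (fact_pfact n) (fact_pfact (2 * n)) q1 q2 !natrM !natrX.
rewrite /kap exprM => e1 e2.
have [m0 f0] := (fn m, pfact_neq0 n).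
have pm0 : p%:R ^+ m != 0 :> rat by rewrite expf_neq0.
move: e1 e2; set a := ('C(2 * n, n))%:R; set b := ('C(2 * m, m))%:R.
set M := (m`!)%:R in m0 *; set M2 := ((2 * m)`!)%:R.
set f1 := (pfact n)%:R in f0 *; set f2 := (pfact (2 * n))%:R.
rewrite (exprAC p%:R 2) ; set P := p%:R ^+ m in pm0 * => e1 e2.
have k0 : (f1 * P * M) ^+ 2 != 0 by rewrite expf_neq0 // !mulf_neq0.
apply: (mulIf k0); rewrite -[LHS]mulrA e2 -e1; field => //.
Qed.

Lemma psih_Tht m : psih (p * m + c) = Tht (p * m + c) + p%:R^-1 * psih m.
Proof.
have cp : (c < p)%N by lia.
rewrite /psih /Tht (harm_pharm (2 * (p * m + c))) (harm_pharm (p * m + c)).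
have -> : ((p * m + c) %/ p = m)%N by rewrite mulnC divnMDl // divn_small // addn0.
have -> : (2 * (p * m + c) %/ p = 2 * m)%N.
  have -> : (2 * (p * m + c) = (2 * m) * p + 2 * c)%N by lia.
  by rewrite divnMDl // divn_small ?addn0 //; lia.
by ring.
Qed.

(** * Difference quotients at the p-adic base point n = -3/4 *)

Section Base.
Variables (K nK : nat) (nKE : (4 * nK + 3 = p ^ K.+1)%N).

(** Since 4 nK + 3 = p^(K+1), the index [nK] approximates -3/4 p-adically, and [gam] approximates
    the value of kap^2 there. [hh] is normalized to 1 at this point and [FF] is its difference
    quotient in 4 n + 3. *)
Definition gam : rat := kap nK ^+ 2.
Definition hh n : rat := (kap n / kap nK) ^+ 2.
Definition FF n : rat := (hh n - 1) / (4 * n + 3)%:R.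

Lemma gam_neq0 : gam != 0. Proof. by rewrite expf_neq0 ?kap_neq0. Qed.
Lemma pint_gam : gam \in pint. Proof. by rewrite rpredX ?pint_kap. Qed.
Lemma pint_gamV : gam^-1 \in pint.
Proof. by rewrite /gam -exprVn rpredX ?pint_kapV. Qed.
Lemma pint_hh n : hh n \in pint.
Proof. by rewrite rpredX // rpredM ?pint_kap ?pint_kapV. Qed.
Lemma hhK : hh nK = 1. Proof. by rewrite /hh divff ?kap_neq0 // expr1n. Qed.

Lemma binom_sqr_hh m : 16 * ('C(2 * (p * m + c), p * m + c) ^ 2)%:R =
  gam * hh (p * m + c) * ('C(2 * m, m) ^ 2)%:R.
Proof.
have := binom_kap m; rewrite !natrX; set a := 'C(_, _)%:R; set b := 'C(_, _)%:R => e.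
transitivity ((4 * a) ^+ 2); first by ring.
by rewrite e /gam /hh; field; rewrite kap_neq0.
Qed.

Lemma hh_shift_le n d : (p %| d)%N ->
  pdvd (d%:R ^+ 2) (hh (n + d) - hh n * (1 + 4 * d%:R * Tht n)).
Proof.
move=> pd; have [r hr e] := kap_shift n pd.
have ek : kap (n + d) = kap n * (1 + 2 * d%:R * Tht n) + d%:R ^+ 2 * r.
  by rewrite -e; ring.
have [k0 [kn kT]] := (pint_kapV nK, (pint_kap n, pint_Tht n)).
have rd : d%:R \in pint by rewrite rpred_nat.
rewrite /hh ek; move: (kap nK)^-1 (kap n) (Tht n) (d%:R) k0 kn kT rd => i k T z hi hk hT hz.
exists (i ^+ 2 * (4 * T ^+ 2 * k ^+ 2 + 2 * r * k * (1 + 2 * z * T) + z ^+ 2 * r ^+ 2)).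
  by rewrite !(rpredD, rpredM, rpredX, rpred_nat) ?rpred1.
by ring.
Qed.

Lemma dvd_shift n n' : (n <= n')%N -> (p %| 4 * n + 3)%N -> (p %| 4 * n' + 3)%N ->
  (p %| n' - n)%N.
Proof.
move=> le d d'; have : (p %| 4 * (n' - n))%N.
  have -> : (4 * (n' - n) = (4 * n' + 3) - (4 * n + 3))%N by lia.
  exact: dvdn_sub.
by rewrite Gauss_dvdr // (coprimeXr 2 (_ : coprime p 2)) // prime_coprime // p_odd2.
Qed.

Lemma hh_shift n n' (d := n'%:R - n%:R) : (p %| 4 * n + 3)%N -> (p %| 4 * n' + 3)%N ->
  pdvd (d ^+ 2) (hh n' - hh n * (1 + 4 * d * Tht n)).
Proof.
move=> pn pn'; have [le|/ltnW le] := leqP n n'.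
  have := hh_shift_le n (dvd_shift le pn pn').
  by rewrite /d subnKC // natrB.
(* For n' <= n, expand around n' and invert; replacing [Tht n'] by [Tht n] costs a multiple of n -
   n', which is of second order in the end. *)
have pd := dvd_shift le pn' pn.
have [r hr e] := hh_shift_le n' pd; have [s hs e'] := Tht_shift n' pd.
rewrite subnKC // in e e'; have -> : d = - (n - n')%:R by rewrite /d natrB // opprB.
have eh : hh n = hh n' * (1 + 4 * (n - n')%:R * Tht n') + (n - n')%:R ^+ 2 * r.
  by move/eqP: e; rewrite subr_eq => /eqP ->; ring.
have eT : Tht n = Tht n' + (n - n')%:R * s by rewrite -e'; ring.
have rz : (n - n')%:R \in pint by rewrite rpred_nat.
have [hh' hT] := (pint_hh n', pint_Tht n'); rewrite eh eT.
move: (hh n') (Tht n') (n - n')%:R hh' hT rz => h T z hh' hT hz.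
exists (h * (4 * s + 16 * T * (T + z * s)) - r * (1 - 4 * z * (T + z * s))).
  by rewrite !(rpredD, rpredN, rpredM, rpred_nat) ?rpred1.
by ring.
Qed.

(** Expand [hh nK = 1] around n: 4 (nK - n) = p^(K+1) - (4 n + 3), where p^(K+1) is negligible
    modulo (4 n + 3)^2. *)
Lemma FF_Tht n : (p %| 4 * n + 3)%N -> pdvd ((4 * n + 3)%:R ^+ 2) (p ^ K.+1)%:R ->
  pdvd (4 * n + 3)%:R (FF n - hh n * Tht n).
Proof.
move=> pn [a ha ea]; have pK : (p %| 4 * nK + 3)%N by rewrite nKE expnS dvdn_mulr.
have := hh_shift pn pK; rewrite hhK; set d := nK%:R - n%:R.
have P0 : (4 * n + 3)%:R != 0 :> rat by rewrite pnatr_eq0 addn3.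
have hP : (4 * n + 3)%:R \in pint by rewrite rpred_nat.
have ed : d = 4^-1 * ((p ^ K.+1)%:R - (4 * n + 3)%:R).
  by rewrite -nKE (natrD _ (4 * nK)) (natrD _ (4 * n)) !natrM /d; field.
have [hh' hT] := (pint_hh n, pint_Tht n).
rewrite /FF ed ea; move: (hh n) (Tht n) (4 * n + 3)%:R P0 hP hh' hT => h T P P0 hP hh' hT.
move=> [r hr e].
exists (- (h * T * a) - (4^-1 * (P * a - 1)) ^+ 2 * r).
  by rewrite !(rpredD, rpredN, rpredM, rpredX) ?rpred1 ?pint_quarter.
have e1 : h = 1 - h * (P ^+ 2 * a - P) * T - P ^+ 2 * ((4^-1 * (P * a - 1)) ^+ 2 * r).
  transitivity (1 - h * (P ^+ 2 * a - P) * T - (4^-1 * (P ^+ 2 * a - P)) ^+ 2 * r); last by field.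
  by rewrite -e; field.
apply: (mulfI P0); rewrite mulrBr [P * (_ / P)]mulrC divfK // {1}e1; ring.
Qed.

Lemma pint_FF n : (p %| 4 * n + 3)%N -> pdvd ((4 * n + 3)%:R ^+ 2) (p ^ K.+1)%:R ->
  FF n \in pint.
Proof.
move=> pn h; have [r hr e] := FF_Tht pn h.
move/eqP: e; rewrite subr_eq => /eqP ->.
apply: rpredD; apply: rpredM => //; [exact: rpred_nat | exact: pint_hh | exact: pint_Tht].
Qed.

(** P' - P may be far more divisible by p than P and P'; this extra divisibility later absorbs the
    denominators of [lamT]. *)
Lemma FF_lipschitz n n' (P := (4 * n + 3)%N) (P' := (4 * n' + 3)%N) :
  (p %| P)%N -> (p %| P')%N ->
  pdvd (P%:R ^+ 2) (p ^ K.+1)%:R -> pdvd (P'%:R ^+ 2) (p ^ K.+1)%:R ->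
  pdvd (P'%:R - P%:R) (FF n' - FF n).
Proof.
(* By symmetry P' has the smaller valuation, so P / P' is p-integral and the expansion may be
   divided by P'. *)
wlog le : n n' @P @P' / (logn p P' <= logn p P)%N.
  move=> H dP dP' hP hP'; have [le|/ltnW le] := leqP (logn p P') (logn p P); first exact: H.
  rewrite -opprB -[FF n' - _]opprB; have [r hr e] := H n' n le dP' dP hP' hP.
  by exists r => //; rewrite e mulNr.
move=> dP dP' hP _.
have P0 : P%:R != 0 :> rat by rewrite pnatr_eq0 /P addn3.
have P0' : P'%:R != 0 :> rat by rewrite pnatr_eq0 /P' addn3.
have [a ha ea] : pdvd P'%:R P%:R by apply: pdvd_logn; rewrite // /P /P' addn3.
have [b hb eb] := FF_Tht dP hP.
have := hh_shift dP dP'; set d := n'%:R - n%:R => -[r hr e].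
have ed : d = 4^-1 * (P'%:R - P%:R) by rewrite /d /P /P' (natrD _ (4 * n)) (natrD _ (4 * n')) !natrM; field.
have eh' : hh n' = 1 + P'%:R * FF n' by rewrite /FF mulrC divfK // addrC subrK.
have eh : hh n = 1 + P%:R * FF n by rewrite /FF mulrC divfK // addrC subrK.
have eb' : hh n * Tht n = FF n - P%:R * b by rewrite -eb opprB addrC subrK.
exists (4^-1 ^+ 2 * (1 - a) * r - a * b).
  by rewrite !(rpredD, rpredN, rpredM, rpredX) ?rpred1 ?pint_quarter.
move: e eh eh' eb' ed ea P0'.
move: (hh n) (hh n') (Tht n) (FF n) (FF n') (P%:R) (P'%:R) d => h h' T F F' z z' x.
move=> e eh eh' eb' ed ea z0'; apply: (mulfI z0').
have e2 : z' * F' = z * F + (z' - z) * (h * T) + x ^+ 2 * r.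
  have -> : z * F = h - 1 by rewrite eh; ring.
  by rewrite -e eh' ed; field.
by rewrite mulrBr e2 eb' ed ea; field.
Qed.

End Base.
End Gauss.

(** * The Frobenius lift *)

Definition qint : {pred rat} := fun x => x \is a Num.int.
Fact qint_subring : subring_closed qint.
Proof.
split=> [|x y|x y]; rewrite /in_mem /= /qint; first exact: rpred1.
  exact: rpredB.
exact: rpredM.
Qed.
HB.instance Definition _ := GRing.isSubringClosed.Build rat qint qint_subring.

Definition fexp (x : fps) := scomp expo x.

Lemma D_fexp (x : fps) : x 0%N = 0 -> D (fexp x) = fexp x * D x.
Proof. by move=> x0; rewrite /fexp D_comp // der_expo. Qed.

Lemma fexp0 x : fexp x 0%N = 1.
Proof. by rewrite /fexp cf0_comp /= invr1. Qed.

Lemma log_deriv_uniq (U V W : fps) : U 0%N = 1 -> V 0%N = 1 ->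
  D U = U * W -> D V = V * W -> U = V.
Proof.
move=> U0 V0 DU DV'; have uV := unit_fps1 V0.
have -> : U = U / V * V by rewrite mulrVK.
suff -> : U / V = 1 by rewrite mul1r.
apply: D0_eq1; last by rewrite cf0M cf0V // U0 V0 invr1 mulr1.
rewrite DM DU DV // DV'.
transitivity (U * W / V * (1 - V / V)); first by ring.
by rewrite mulrV // subrr mulr0.
Qed.

Lemma fexpX (x : fps) n : x 0%N = 0 -> fexp x ^+ n = fexp (n%:R * x).
Proof.
move=> x0; have nx0 : (n%:R * x) 0%N = 0 by rewrite cf0M x0 mulr0.
apply: (@log_deriv_uniq _ _ (n%:R * D x)).
- by rewrite cf0X fexp0 expr1n.
- exact: fexp0.
- rewrite DX D_fexp //; case: n {nx0} => [|n]; first by rewrite !mul0r mulr0.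
  by rewrite exprS /=; ring.
- by rewrite D_fexp // DM D_nat mul0r add0r.
Qed.

Lemma cf_fexp (x : fps) n :
  fexp x n.+1 = x n.+1 + \sum_(i < n) (i.+2`!)%:R^-1 * (x ^+ i.+2) n.+1.
Proof.
rewrite -[LHS]/(\sum_(k < n.+2) (k`!)%:R^-1 * (x ^+ k) n.+1) 2!big_ord_recl.
by rewrite expr0 cf1 mulr0 add0r (_ : 1`! = 1)%N // invr1 mul1r expr1; congr (_ + _); apply: eq_bigr.
Qed.

(** Without constant term, coefficient n of a power with exponent at least 2 involves only
    coefficients of index below n. *)
Lemma eqm_cfX (x y : fps) n k : x 0%N = 0 -> eqm n x y -> (1 < k)%N ->
  (0 < n)%N -> (x ^+ k) n = (y ^+ k) n.
Proof.
move=> x0 e k1 n0; have y0 : y 0%N = 0 by rewrite -e.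
case: k k1 => [|[|k]] // _; rewrite exprS [in RHS]exprS !cfM; apply: eq_bigr => i _.
have [i0|i0] := posnP i; first by rewrite i0 x0 y0 !mul0r.
have [lt|le] := ltnP i n; last first.
  have -> : (n - i = 0)%N by lia.
  by rewrite !cf0X x0 y0 !expr0n /= !mulr0.
by rewrite e // (eqmX k.+1 e) //; lia.
Qed.

Section Frobenius.
Variables (p : nat) (pp : prime p) (c : nat) (pE : p = (4 * c + 3)%N).
Local Notation pint := (pint_at pp).
Local Notation pdvd := (pdvd pp).

Let p_gt0 : (0 < p)%N := prime_gt0 pp.
Let p2 : (2 < p)%N. Proof. by rewrite pE; lia. Qed.

(** A weak form of v_p(k!) < k / (p - 1), by recursion on k / p, using p >= 3. *)
Lemma logn_fact_lt k : (0 < k)%N -> (2 * logn p k`! < k)%N.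
Proof.
elim/ltn_ind: k => k IH k0.
have u := pfact_unit pp k; have f0 : (0 < pfact p k)%N.
  by rewrite lt0n; case: eqP u => // ->; rewrite dvdn0.
have lu : logn p (pfact p k) = 0%N.
  by apply/eqP; rewrite eqn0Ngt logn_gt0 mem_primes pp f0.
rewrite (fact_pfact pp pE k) !lognM ?muln_gt0 ?f0 ?expn_gt0 ?p_gt0 ?fact_gt0 // lu pfactorK // add0n.
have [z|j0] := posnP (k %/ p); first by rewrite z fact0 logn1.
have lt : (k %/ p < k)%N by rewrite ltn_Pdiv // prime_gt1.
have := IH _ lt j0; have := leq_trunc_div k p; nia.
Qed.

(** Makes all terms of order at least 2 in the exponential of a multiple of p negligible modulo
    p^2. *)
Lemma pdvd_pX_fact k : (1 < k)%N -> pdvd (p%:R ^+ 2) (p%:R ^+ k / (k`!)%:R).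
Proof.
move=> k1.
have le : (logn p (p ^ 2 * k`!) <= logn p (p ^ k))%N.
  rewrite lognM ?expn_gt0 ?p_gt0 ?fact_gt0 // !pfactorK //.
  case: k k1 => [|[|[|k]]] // _; last by have := @logn_fact_lt k.+3 isT; lia.
  have -> : logn p 2`! = 0%N; last by [].
  apply/eqP; rewrite (_ : 2`! = 2)%N // eqn0Ngt logn_gt0 mem_primes pp /=.
  by apply/negP => /dvdn_leq; lia.
have n0 : (0 < p ^ 2 * k`!)%N by rewrite muln_gt0 expn_gt0 p_gt0 fact_gt0.
have m0 : (0 < p ^ k)%N by rewrite expn_gt0 p_gt0.
have [r hr e] := pdvd_logn pp n0 m0 le.
exists r => //; have f0 : (k`!)%:R != 0 :> rat by rewrite pnatr_eq0 -lt0n fact_gt0.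
apply: (mulIf f0); rewrite divfK //.
by move: e; rewrite natrM !natrX => ->; ring.
Qed.

Definition fdvd d (x : fps) := forall n, pdvd d (x n).

Lemma fdvdP d (x : fps) : fdvd d x <-> exists2 z, fps_over pint z & x = fpsC d * z.
Proof.
split=> [H|[z hz ->] n]; last by rewrite cfCM; apply: pdvd_self.
have [z hz] := choice (fun n => (let: ex_intro2 r h e := H n in
  ex_intro (fun r => r \in pint /\ x n = d * r) r (conj h e))).
exists (Fps z) => [n|]; first by case: (hz n).
by apply: fpsP => n; rewrite cfCM; case: (hz n).
Qed.

Lemma fdvdD d x y : fdvd d x -> fdvd d y -> fdvd d (x + y).
Proof. by move=> hx hy n; rewrite cfD; apply: pdvdD. Qed.
Lemma fdvdMl d (x y : fps) : fps_over pint y -> fdvd d x -> fdvd d (y * x).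
Proof.
move=> hy /fdvdP[z hz ->]; apply/fdvdP; exists (y * z); first exact: overM.
by rewrite mulrCA.
Qed.

Lemma fps_frobeniusD (x y : fps) : fps_over pint x -> fps_over pint y ->
  fdvd p%:R ((x + y) ^+ p - x ^+ p - y ^+ p).
Proof.
move=> hx hy.
have E q : (x + y) ^+ q.+1 - x ^+ q.+1 - y ^+ q.+1 =
    \sum_(i < q) x ^+ (q.+1 - i.+1) * y ^+ i.+1 *+ 'C(q.+1, i.+1).
  rewrite exprDn big_ord_recr big_ord_recl /= subn0 subnn !expr0 bin0 binn mulr1 mul1r !mulr1n.
  set T := bigop _ _ _; transitivity T; first by ring.
  by apply: eq_bigr => i _.
have := E p.-1; rewrite (prednK p_gt0) => -> {E}.
move=> n; rewrite cf_sum; apply: pdvd_sum => i _.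
have lt := ltn_ord i.
have /dvdnP[k ->] : (p %| 'C(p, i.+1))%N by rewrite prime_dvd_bin //= -[X in (_ < X)%N](prednK p_gt0) ltnS.
rewrite cfMn mulrnA -[X in pdvd _ X]mulr_natl; apply: pdvd_self.
by apply: rpredMn; apply: overM; apply: overX.
Qed.

Lemma int_fermat (m : int) : pdvd p%:R (m%:~R ^+ p - m%:~R).
Proof.
have H (k : nat) : pdvd p%:R (k%:R ^+ p - k%:R).
  have le : (k <= k ^ p)%N.
    by case: k => // k; rewrite -{1}[k.+1]expn1 leq_pexp2l.
  have : (p %| k ^ p - k)%N by rewrite -eqn_mod_dvd // fermat_little.
  by rewrite -natrX -natrB //; apply: pdvd_nat.
have op : odd p by case/even_prime: pp => // e; move: p2; rewrite e.
case: m => k; first exact: H.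
have -> : (Negz k)%:~R = - k.+1%:R :> rat by rewrite NegzE mulrNz.
rewrite exprNn -signr_odd op expr1 mulN1r -opprD; exact/pdvdN/H.
Qed.

(** The p-th power is additive modulo p, and on a monomial the claim is Fermat's little theorem for
    its coefficient. *)
Lemma fps_frobenius (x : fps) : fps_over qint x ->
  fdvd p%:R (x ^+ p - dil p x).
Proof.
move=> hx n; have hp : fps_over pint x by move=> k; apply: int_pint; exact: hx.
pose X N := \sum_(k < N) fpsC (x k) * qX ^+ k.
have oX N : fps_over pint (X N).
  move=> k; rewrite cf_sum rpred_sum // => i _; rewrite cfCM cf_qXn.
  by rewrite rpredM ?rpred_nat // hp.
suff H N : fdvd p%:R (X N ^+ p - dil p (X N)).
  have e : eqm n.+1 x (X n.+1) by apply: eqm_sum_qXn.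
  have -> : (x ^+ p - dil p x) n = (X n.+1 ^+ p - dil p (X n.+1)) n.
    rewrite !cfB (eqmX p e) //; congr (_ - _).
    by rewrite dil.unlock (eqm_comp (qXn0 p_gt0) e (@eqm_refl _ _)).
  exact: H.
elim: N => [|N IH].
  have -> : X 0%N = 0 by rewrite /X big_ord0.
  by move=> k; rewrite (dil_nat p 0) expr0n gtn_eqF //= subrr; apply: pdvd0.
rewrite /X big_ord_recr /= -/(X N); set y := fpsC (x N) * qX ^+ N.
have oy : fps_over pint y.
  by apply: overM; [apply: overC; apply: hp | apply/overX/over_qX].
have -> : (X N + y) ^+ p - dil p (X N + y) =
  ((X N + y) ^+ p - X N ^+ p - y ^+ p) + ((X N ^+ p - dil p (X N)) + (y ^+ p - dil p y)).
  by rewrite dilD; ring.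
apply: fdvdD; [exact: fps_frobeniusD | apply: fdvdD => //].
have ey : y ^+ p = fpsC (x N ^+ p) * qX ^+ (N * p).
  rewrite /y exprMn exprM; congr (_ * _).
  by elim: p => [|q IHq]; rewrite ?fpsC1 // !exprS IHq fpsCM.
have ed : dil p y = fpsC (x N) * qX ^+ (N * p).
  rewrite /y dilM // dilX // dil_qX // -exprM mulnC; congr (_ * _).
  by rewrite dil.unlock compC.
rewrite ey ed -mulrBl -fpsCN -fpsCD mulrC; apply: fdvdMl; first exact/overX/over_qX.
apply/fdvdP; have /intrP[m em] : x N \is a Num.int by exact: hx.
rewrite em; have [r hr ->] := int_fermat m.
by exists (fpsC r); [exact: overC | rewrite fpsCM].
Qed.

Variable L : fps.
Hypothesis L0 : L 0%N = 0.

(* By induction on the coefficients: [exp L = L + sum_(k >= 2) L^k / k!]. *)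
Lemma fdvd_log : fdvd p%:R (fexp L - 1) -> fdvd p%:R L.
Proof.
move=> H n; elim/ltn_ind: n => -[|n] IH; first by rewrite L0; apply: pdvd0.
(* Truncation makes the whole series divisible by p, without changing coefficient n + 1 of the
   powers with exponent at least 2. *)
pose L' := Fps (fun j => if (j < n.+1)%N then L j else 0).
have e : eqm n.+1 L L' by move=> j lt /=; rewrite lt.
have /fdvdP[z hz Lz] : fdvd p%:R L'.
  by move=> j /=; case: ifP => [/IH|] //; move=> _; apply: pdvd0.
have := H n.+1; rewrite cfB cf1 subr0 cf_fexp; set T := \sum_(i < n) _ => HT.
suff hT : pdvd p%:R T.
  have -> : L n.+1 = L n.+1 + T - T by rewrite addrK.
  exact: pdvdB.
apply: pdvd_sum => i _.
rewrite (eqm_cfX L0 e) // Lz exprMn.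
have -> : fpsC p%:R ^+ i.+2 = fpsC (p%:R ^+ i.+2).
  by rewrite fpsC_nat -!natrX fpsC_nat.
rewrite cfCM mulrA [_^-1 * _]mulrC; apply: pdvdMr; first exact: overX.
have [r hr ->] := @pdvd_pX_fact i.+2 isT.
by exists (p%:R * r); [rewrite rpredM ?rpred_nat | ring].
Qed.

Lemma fexpX_mod n : fdvd p%:R L ->
  fdvd (n%:R ^+ 2 * p%:R ^+ 2) (fexp L ^+ n - 1 - n%:R * L).
Proof.
move=> /fdvdP[z hz Lz] [|j].
  rewrite !cfB cf0X fexp0 expr1n cf1 subrr cf0M L0 mulr0 subrr; exact: pdvd0.
rewrite fexpX // !cfB cf1 subr0 cf_fexp addrAC subrr add0r.
apply: pdvd_sum => i _; set k := i.+2.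
have -> : (n%:R * L) ^+ k = fpsC (n%:R ^+ i * n%:R ^+ 2 * p%:R ^+ k) * z ^+ k.
  by rewrite Lz -exprD addn2 !exprMn -!natrX -natrM !fpsC_nat natrM !natrX mulrA.
rewrite cfCM [X in pdvd _ X]mulrA; apply: pdvdMr; first exact: (overX k hz).
have -> : (k`!)%:R^-1 * (n%:R ^+ i * n%:R ^+ 2 * p%:R ^+ k) =
   n%:R ^+ i * (n%:R ^+ 2 * (p%:R ^+ k / (k`!)%:R)) :> rat by ring.
apply: pdvdMl; first by rewrite rpredX ?rpred_nat.
have [r hr ->] := @pdvd_pX_fact k isT.
by exists r => //; rewrite mulrA.
Qed.

(** The k-th term of the remainder is x_k (exp(k L) - 1 - k L), divisible by k^2 p^2 x_k. The factor
    k^2 is essential: [taylor] is applied to a double integral, whose coefficients have denominators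
    k^2. *)
Lemma taylor (x s : fps) : s 0%N = 0 -> fps_over pint s -> fps_over pint (D (D x)) ->
  fdvd p%:R L ->
  fdvd (p%:R ^+ 2) (scomp x (s * fexp L) - scomp x s - scomp (D x) s * L).
Proof.
move=> s0 hs hx hL n.
have sL0 : (s * fexp L) 0%N = 0 by rewrite cf0M s0 mul0r.
rewrite !cfB (comp_le _ sL0 (ltnSn n)) (comp_le _ s0 (ltnSn n)).
have -> : (scomp (D x) s * L) n = \sum_(k < n.+1) x k * (s ^+ k * (k%:R * L)) n.
  have e : eqm n.+1 (scomp (D x) s) (\sum_(k < n.+1) fpsC (D x k) * s ^+ k).
    move=> j lt; rewrite cf_sum (comp_le _ s0 lt); apply: eq_bigr => k _.
    by rewrite cfCM.
  rewrite (eqmM e (@eqm_refl n.+1 L)) // mulr_suml cf_sum; apply: eq_bigr => k _.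
  by rewrite cf_D -mulrA cfCM mulrCA -fpsC_nat cfCM mulrA [x k * _]mulrC.
rewrite -!sumrB; apply: pdvd_sum => k _.
have -> : x k * ((s * fexp L) ^+ k) n - x k * (s ^+ k) n - x k * (s ^+ k * (k%:R * L)) n =
   x k * (s ^+ k * (fexp L ^+ k - 1 - k%:R * L)) n.
  by rewrite -!mulrBr -!cfB exprMn; congr (_ * cf _ n); ring.
have := fdvdMl (overX k hs) (fexpX_mod k hL) n.
move=> [r hr ->]; exists (D (D x) k * r); first by rewrite rpredM.
by rewrite !cf_D; ring.
Qed.

End Frobenius.

(** * The Frobenius defect of the inverse series [s] *)

HB.lock Definition LT (p : nat) : fps := p%:R * lamT - dil p lamT.

Section Defect.
Variables (p : nat) (pp : prime p) (c : nat) (pE : p = (4 * c + 3)%N).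
Let p_gt0 : (0 < p)%N := prime_gt0 pp.

Lemma LT0 : LT p 0%N = 0.
Proof. by rewrite LT.unlock cfB cf0M lamT0 mulr0 cf0_dil // lamT0 subr0. Qed.

Lemma D_LT : D (LT p) = p%:R * (omT - 1) - p%:R * dil p (omT - 1).
Proof. by rewrite LT.unlock DB DM D_nat mul0r add0r D_dil // D_lamT. Qed.

Lemma fexp_lamTX : fexp lamT ^+ p = dil p (fexp lamT) * fexp (LT p).
Proof.
apply: (@log_deriv_uniq _ _ (p%:R * (omT - 1))).
- by rewrite cf0X fexp0 expr1n.
- by rewrite cf0M cf0_dil // !fexp0 mulr1.
- have e : fexp lamT ^+ p = fexp lamT ^+ p.-1 * fexp lamT by rewrite -exprSr prednK.
  by rewrite DX (D_fexp lamT0) D_lamT e; ring.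
- rewrite DM D_dil // (D_fexp lamT0) D_lamT dilM // (D_fexp LT0) D_LT; ring.
Qed.

Lemma sT_powp : sT ^+ p = dil p sT * fexp (LT p).
Proof.
rewrite sT.unlock -/(fexp _) exprMn fexp_lamTX dilM // dil_qX //; ring.
Qed.

(** The series s / t = exp [lamT] has integer coefficients, so its Frobenius congruence gives
    exp([LT p]) = 1 modulo p, and logarithms can be taken. *)
Lemma fdvd_LT : fdvd pp p%:R (LT p).
Proof.
apply: (fdvd_log pE LT0).
have h : fps_over qint (fexp lamT).
  by move=> n; have := over_sT qint n.+1; rewrite sT.unlock cf_qXM.
have hp : fps_over (pint_at pp) (fexp lamT) by move=> n; apply: int_pint; exact: h.
have u : dil p (fexp lamT) \is a GRing.unit by rewrite unit_dil // unit_fps fexp0.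
have -> : fexp (LT p) - 1 = (dil p (fexp lamT))^-1 * (fexp lamT ^+ p - dil p (fexp lamT)).
  by rewrite mulrBr mulVr // fexp_lamTX mulKr.
apply: fdvdMl; last exact: fps_frobenius pE _ h.
by apply: over_V; [rewrite cf0_dil // fexp0 | apply: over_dil].
Qed.

End Defect.

(** * The congruence between [g3] and [g2] *)

(** Under t = t(q), [AT] dt/t becomes g2 dq/q, and [BT] dt/t becomes g3 dq/q. *)
HB.lock Definition AT : fps := qX * wt.
HB.lock Definition BT : fps := 16 * qX ^+ 3 * wt.

Definition u1T := integ AT.
Definition u3T := integ BT.
(** The second integration is in log q, whence the factor [omT] = d log q / d log t. *)
Definition e1T := integ (omT * u1T).
Definition e3T := integ (omT * u3T).

Lemma D_u1T : D u1T = AT. Proof. by rewrite D_integ // AT.unlock cf_qXM. Qed.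
Lemma D_u3T : D u3T = BT.
Proof. by rewrite D_integ // BT.unlock cf0M (cf0M 16) (cf_qXn 3) mulr0 mul0r. Qed.
Lemma D_e1T : D e1T = omT * u1T. Proof. by rewrite D_integ // cf0M integ0 mulr0. Qed.
Lemma D_e3T : D e3T = omT * u3T. Proof. by rewrite D_integ // cf0M integ0 mulr0. Qed.

Lemma over_AT (S : subringClosed rat) : fps_over S AT.
Proof. by rewrite AT.unlock; apply: overM; [exact: over_qX | exact: over_wt]. Qed.
Lemma over_BT (S : subringClosed rat) : fps_over S BT.
Proof.
rewrite BT.unlock; apply: overM; last exact: over_wt.
by apply: overM; [exact: over_nat | exact/overX/over_qX].
Qed.

Lemma cf_wt n : wt n = if (4 %| n)%N then ('C(2 * (n %/ 4), n %/ 4) ^ 2)%:R else 0.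
Proof. by rewrite wt.unlock cf_dil. Qed.
Lemma cf_nut n : nut n = if (4 %| n)%N
  then ('C(2 * (n %/ 4), n %/ 4) ^ 2)%:R * psih (n %/ 4) else 0.
Proof. by rewrite nut.unlock cf_dil. Qed.

Lemma cf_AT m : AT (4 * m + 1)%N = ('C(2 * m, m) ^ 2)%:R.
Proof. by rewrite AT.unlock cf_qXM addn1 cf_wt dvdn_mulr // mulKn. Qed.
Lemma cf_BT n : BT (4 * n + 3)%N = 16 * ('C(2 * n, n) ^ 2)%:R.
Proof.
rewrite BT.unlock -mulrA -(fpsC_nat 16) cfCM cf_qXnM leq_addl addnK cf_wt.
by rewrite dvdn_mulr // mulKn.
Qed.
Lemma AT_eq0 z : (z %% 4 != 1)%N -> AT z = 0.
Proof.
move=> h; rewrite AT.unlock cf_qXM; case: z h => // z h.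
by rewrite cf_wt; case: ifPn => // /dvdnP[k e]; move: h; rewrite e; lia.
Qed.
Lemma BT_eq0 z : (z %% 4 != 3)%N -> BT z = 0.
Proof.
move=> h; rewrite BT.unlock -mulrA -(fpsC_nat 16) cfCM cf_qXnM.
case: ifPn => // le; rewrite ?mulr0 // cf_wt.
by case: ifPn => [/dvdnP[k e]|]; [lia | rewrite mulr0].
Qed.

(** The factor w in [AT] and [BT] cancels the denominator of [lamT] = nu / w, so these products have
    explicit coefficients. *)
Lemma lamT_AT : lamT * AT = qX * nut.
Proof. by rewrite AT.unlock -wt_lamT; ring. Qed.
Lemma lamT_BT : lamT * BT = 16 * (qX ^+ 3 * nut).
Proof. by rewrite BT.unlock -wt_lamT; ring. Qed.

Lemma cf_lamT_AT m : (lamT * AT) (4 * m + 1)%N = AT (4 * m + 1)%N * psih m.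
Proof. by rewrite cf_AT lamT_AT cf_qXM addn1 cf_nut dvdn_mulr // mulKn. Qed.
Lemma cf_lamT_BT n : (lamT * BT) (4 * n + 3)%N = BT (4 * n + 3)%N * psih n.
Proof.
rewrite cf_BT lamT_BT -(fpsC_nat 16) cfCM cf_qXnM leq_addl addnK cf_nut.
by rewrite dvdn_mulr // mulKn // mulrA.
Qed.
Lemma lamT_AT_eq0 z : (z %% 4 != 1)%N -> (lamT * AT) z = 0.
Proof.
move=> h; rewrite lamT_AT cf_qXM; case: z h => // z h.
by rewrite cf_nut; case: ifPn => // /dvdnP[k e]; move: h; rewrite e; lia.
Qed.
Lemma lamT_BT_eq0 z : (z %% 4 != 3)%N -> (lamT * BT) z = 0.
Proof.
move=> h; rewrite lamT_BT -(fpsC_nat 16) cfCM cf_qXnM.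
case: ifPn => // le; rewrite ?mulr0 // cf_nut.
by case: ifPn => [/dvdnP[k e]|]; [lia | rewrite mulr0].
Qed.

Lemma lamT_eq0 j : ~~ (4 %| j)%N -> lamT j = 0.
Proof.
have -> : lamT = dil 4 (nu0 / w0).
  have u : w0 \is a GRing.unit by apply: unit_fps1; rewrite /= bin0.
  by rewrite lamT.unlock nut.unlock wt.unlock -(dilV pos4 u) -(dilM pos4).
by move=> h; rewrite cf_dil // (negbTE h).
Qed.

(** * Integrality, in the variable t, of the twice integrated defect *)

Section Descent.
Variables (p : nat) (pp : prime p) (c : nat) (pE : p = (4 * c + 3)%N).
Variables (K nK : nat) (nKE : (4 * nK + 3 = p ^ K.+1)%N).
Local Notation pint := (pint_at pp).
Local Notation pdvd := (pdvd pp).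
Local Notation gm := (gam p nK).

Let p_gt0 : (0 < p)%N := prime_gt0 pp.
Let pr0 : (p%:R : rat) != 0. Proof. by rewrite pnatr_eq0 -lt0n. Qed.

Definition vT := u3T - fpsC (gm / p%:R) * dil p u1T.
(** The bracket is the first-order Taylor expansion of the double integral of g2 at s(t)^p = s(t^p)
    exp([LT p]). *)
Definition ZT := e3T - fpsC (gm / p%:R ^+ 2) * (dil p e1T + LT p * dil p u1T).

(* [FF] at the index [n] with [4 n + 3 = p z]. *)
Definition Fz z := FF p nK (p * (z %/ 4) + c).

Lemma pz_index m : (p * (4 * m + 1) = 4 * (p * m + c) + 3)%N.
Proof. by rewrite {1}pE [in RHS]pE; lia. Qed.

Lemma vT_p y : vT (p * y)%N = gm * AT y * Fz y.
Proof.
rewrite cfB cfCM dil_mul // /u3T /u1T /=.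
have [e|ne] := eqVneq (y %% 4)%N 1%N; last first.
  rewrite (AT_eq0 ne) BT_eq0; first by rewrite !(mul0r, mulr0) subrr.
  (* Multiplication by p = 3 modulo 4 sends the class 1 to the class 3, and no other class to 3. *)
  have := divn_eq y 4; rewrite {1}pE => yE; rewrite yE; move: ne; lia.
have yE : y = (4 * (y %/ 4) + 1)%N by rewrite {1}(divn_eq y 4) e mulnC.
move: yE; rewrite /Fz; move: (y %/ 4)%N => m ->.
rewrite pz_index cf_BT (binom_sqr_hh pp pE nK) cf_AT /FF -pz_index natrM.
have y0 : (4 * m + 1)%:R != 0 :> rat by rewrite pnatr_eq0 addn1.
move: y0; move: ((4 * m + 1)%:R : rat) => x x0; move: (hh _ _ _) (_ ^ 2)%:R (gam _ _) => h b g.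
by field; rewrite x0 pr0.
Qed.

Lemma D_vT : D vT = BT - fpsC gm * dil p AT.
Proof.
rewrite DB DCM D_dil // D_u3T D_u1T -fpsC_nat mulrA -fpsCM divfK //.
Qed.

(** The derivative of [LT p] turns the [dil p omT] coming from [dil p e1T] into [omT], so that [vT]
    factors out. *)
Lemma D_ZT : D ZT = omT * vT - fpsC (gm / p%:R) * (LT p * dil p AT).
Proof.
rewrite DB D_e3T DCM DD DM !D_dil // D_e1T D_u1T (D_LT pp) dilB // dilM // dil1.
have -> : fpsC (gm / p%:R) = fpsC (gm / p%:R ^+ 2) * p%:R.
  by rewrite -fpsC_nat -fpsCM; congr fpsC; field.
rewrite /vT; have -> : fpsC (gm / p%:R) = fpsC (gm / p%:R ^+ 2) * p%:R.
  by rewrite -fpsC_nat -fpsCM; congr fpsC; field.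
by ring.
Qed.

(** Integration by parts with [omT] = 1 + [D lamT]. At an index divisible by p the coefficient has
    to be divided by that index: this is harmless for the exact derivative, and the other terms are
    explicit. *)
Lemma D_ZT' : D ZT = vT + D (lamT * vT) - lamT * BT + fpsC (gm / p%:R) * dil p (lamT * AT).
Proof.
rewrite D_ZT DM D_vT D_lamT dilM // LT.unlock.
have -> : fpsC gm = fpsC (gm / p%:R) * p%:R.
  by rewrite -fpsC_nat -fpsCM; congr fpsC; field.
by ring.
Qed.

Variables (B : nat) (hB : (2 * B <= K.+1)%N).

(** The crude bound v_p(N) < N <= B is enough, as 2 B <= K + 1. *)
Lemma pK_dvd N : (0 < N <= B)%N -> pdvd (N%:R ^+ 2) (p ^ K.+1)%:R.
Proof.
move=> /andP[N0 le]; rewrite -natrX; apply: pdvd_logn.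
- by rewrite expn_gt0 N0.
- by rewrite expn_gt0 p_gt0.
rewrite lognX pfactorK //; apply: leq_trans hB; rewrite leq_mul2l /=.
by apply: leq_trans le; apply: ltnW; apply: ltn_logl.
Qed.

Lemma Fz_bound z : (z %% 4 = 1)%N -> (p * z <= B)%N ->
  [/\ (p * z = 4 * (p * (z %/ 4) + c) + 3)%N, (p %| 4 * (p * (z %/ 4) + c) + 3)%N &
      pdvd ((4 * (p * (z %/ 4) + c) + 3)%:R ^+ 2) (p ^ K.+1)%:R].
Proof.
move=> e le; have zE : (p * z = 4 * (p * (z %/ 4) + c) + 3)%N.
  by rewrite -pz_index; congr (p * _)%N; rewrite {1}(divn_eq z 4) e mulnC.
split=> //; first by rewrite -zE dvdn_mulr.
rewrite -zE; apply: pK_dvd; rewrite le andbT muln_gt0 p_gt0 lt0n.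
by apply/eqP => z0; move: e; rewrite z0.
Qed.

Lemma pint_Fz z : (z %% 4 = 1)%N -> (p * z <= B)%N -> Fz z \in pint.
Proof. by move=> e le; have [_ d h] := Fz_bound e le; rewrite /Fz; have := pint_FF pE nKE d h. Qed.

Lemma pint_AT_Fz z : (p * z <= B)%N -> AT z * Fz z \in pint.
Proof.
move=> le; have [e|ne] := eqVneq (z %% 4)%N 1%N.
  by rewrite rpredM ?pint_Fz //; apply: over_AT.
by rewrite AT_eq0 // mul0r rpred0.
Qed.

Lemma pint_vT k : (k <= B)%N -> vT k \in pint.
Proof.
have [/dvdnP[y ->]|nd] := boolP (p %| k)%N.
  rewrite mulnC => le; by rewrite vT_p -mulrA; apply: rpredM; [exact: pint_gam | exact: pint_AT_Fz].
move=> _; rewrite cfB cfCM cf_dil // (negbTE nd) mulr0 subr0.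
by rewrite rpredM ?pint_intV //; apply: over_BT.
Qed.

Lemma pint_LT k : (LT p k) / p%:R \in pint.
Proof. by have [r hr ->] := fdvd_LT pp pE k; rewrite mulrC mulKf. Qed.

Lemma pint_lamT k : ~~ (p %| k)%N -> lamT k \in pint.
Proof.
move=> nk; have k0 : k%:R != 0 :> rat.
  by rewrite pnatr_eq0; case: eqP nk => // ->; rewrite dvdn0.
have -> : lamT k = D lamT k / k%:R by rewrite cf_D mulrC mulKf.
rewrite D_lamT rpredM ?pint_intV //.
by apply: overB; [apply: over_omT | apply: over1].
Qed.

(** Measures the denominators of [lamT]: one more factor p each time the index is multiplied by
    p. *)
Lemma lamT_p j : lamT (p * j)%N - lamT j / p%:R \in pint.
Proof.
have -> : lamT (p * j)%N - lamT j / p%:R = LT p (p * j)%N / p%:R.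
  by rewrite LT.unlock cfB -fpsC_nat cfCM dil_mul // mulrBl mulrAC divff // mul1r.
exact: pint_LT.
Qed.

Definition wF := Fps (fun y => AT y * Fz y).

(** The indices i and p z - i are prime to p together, and then both factors are integral; the
    remaining terms are compared by [vT_p] and [lamT_p]. *)
Lemma conv_lamT_vT z : (p * z <= B)%N ->
  (lamT * vT) (p * z)%N - gm / p%:R * (lamT * wF) z \in pint.
Proof.
move=> le; have -> : (lamT * wF) z = (dil p lamT * dil p wF) (p * z)%N.
  by rewrite -dilM // dil_mul.
rewrite mulrC [dil p lamT * _]mulrC !cfM mulr_sumr -sumrB rpred_sum // => i _.
have lei : (i <= p * z)%N by rewrite -ltnS.
rewrite [dil p wF i]cf_dil //; case: ifPn => [/dvdnP[y yE]|nd].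
  have -> : (p * z - i = p * (z - y))%N by rewrite yE mulnBr [(y * p)%N]mulnC.
  rewrite yE mulnK // [(y * p)%N]mulnC vT_p dil_mul //.
  have -> : gm * AT y * Fz y * lamT (p * (z - y))%N - gm / p%:R * (wF y * lamT (z - y)%N) =
     gm * (AT y * Fz y) * (lamT (p * (z - y))%N - lamT (z - y)%N / p%:R).
    rewrite -[wF y]/(AT y * Fz y); move: (gam _ _) (AT y) (Fz y) (lamT _) (lamT _) => g a b x x'.
    by ring.
  apply: rpredM; last exact: lamT_p.
  apply: rpredM; first exact: pint_gam.
  by apply: pint_AT_Fz; apply: leq_trans le; move: lei; rewrite yE mulnC.
rewrite mul0r mulr0 subr0 rpredM ?pint_vT ?pint_lamT //; first exact: leq_trans le.
by rewrite dvdn_subr // dvdn_mulr.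
Qed.

(** The difference of values of [Fz] at y and z has a factor p (z - y): p cancels the denominator
    and z - y turns the coefficient of [lamT] into one of the integral series [D lamT]. *)
Lemma conv_lipschitz z : (p * z <= B)%N ->
  gm / p%:R * ((lamT * wF) z - Fz z * (lamT * AT) z) \in pint.
Proof.
move=> le; rewrite mulrC [lamT * AT]mulrC [lamT * wF]mulrC !cfM !mulr_sumr -sumrB mulr_suml.
rewrite rpred_sum // => y _; have ley : (y <= z)%N by rewrite -ltnS.
have -> : wF y * lamT (z - y)%N - Fz z * (AT y * lamT (z - y)%N) =
   AT y * ((Fz y - Fz z) * lamT (z - y)%N).
  rewrite -[wF y]/(AT y * Fz y); move: (AT y) (Fz y) (Fz z) (lamT _) => a b b' x.
  by ring.
have [ey|ny] := eqVneq (y %% 4)%N 1%N; last by rewrite AT_eq0 // !mul0r rpred0.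
have [dv|nd] := boolP (4 %| z - y)%N; last by rewrite lamT_eq0 // !(mulr0, mul0r) rpred0.
have ez : (z %% 4 = 1)%N by move: dv ey; rewrite -eqn_mod_dvd // => /eqP <-.
have le' : (p * y <= B)%N by apply: leq_trans le; rewrite leq_mul2l ley orbT.
have [iy dy hy] := Fz_bound ey le'; have [iz dz hz] := Fz_bound ez le.
have [r hr e] := FF_lipschitz pE nKE dz dy hz hy; move: e; rewrite -iy -iz -!/(Fz _) => ->.
rewrite !natrM.
have -> : (AT y * ((p%:R * y%:R - p%:R * z%:R) * r * lamT (z - y)%N)) * (gm / p%:R) =
   - (AT y * r * gm * ((z - y)%:R * lamT (z - y)%N)).
  rewrite natrB //; move: (gam _ _) (AT y) (lamT _) (z%:R) (y%:R) => g a x z' y'.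
  by field.
rewrite rpredN; apply: rpredM.
  apply: rpredM; last exact: pint_gam.
  by apply: rpredM => //; exact: over_AT.
rewrite -cf_D D_lamT.
by apply: overB; [apply: over_omT | apply: over1].
Qed.

(** Everything is explicit here. After [psih_Tht], the part with [Tht] is divisible by p z by
    [FF_Tht], and the part with psih / p is cancelled by the added term, because 1 - hh = - p z
    FF. *)
Lemma bracket_ZT z : (0 < z)%N -> (p * z <= B)%N ->
  (vT (p * z)%N - (lamT * BT) (p * z)%N + gm / p%:R * (lamT * AT) z) / (p * z)%:R
    + gm / p%:R * (Fz z * (lamT * AT) z) \in pint.
Proof.
move=> z0 le; have [e|ne] := eqVneq (z %% 4)%N 1%N; last first.
  rewrite lamT_AT_eq0 // lamT_BT_eq0 ?vT_p ?AT_eq0 //.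
    by rewrite !(mulr0, mul0r, subr0, addr0) rpred0.
  have := divn_eq z 4; rewrite {1}pE => zE; rewrite zE; move: ne; lia.
have [iz dz hz] := Fz_bound e le.
have zE : z = (4 * (z %/ 4) + 1)%N by rewrite {1}(divn_eq z 4) e mulnC.
have hA : (lamT * AT) z = AT z * psih (z %/ 4).
  by have := cf_lamT_AT (z %/ 4); rewrite -zE.
have hC : (lamT * BT) (p * z)%N = gm * hh p nK (p * (z %/ 4) + c) * AT z * psih (p * (z %/ 4) + c).
  rewrite iz cf_lamT_BT cf_BT (binom_sqr_hh pp pE nK) -cf_AT.
  by rewrite -zE.
rewrite vT_p hA hC (psih_Tht pp pE) iz /Fz.
set n := (p * (z %/ 4) + c)%N in iz dz hz *.
have [r hr er] := FF_Tht pE nKE dz hz.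
have P0 : (4 * n + 3)%:R != 0 :> rat by rewrite pnatr_eq0 addn3.
have hh1 : hh p nK n = 1 + (4 * n + 3)%:R * FF p nK n.
  by rewrite /FF mulrC divfK // addrC subrK.
suff -> : forall ps T F h N : rat, N != 0 -> h = 1 + N * F -> F - h * T = N * r ->
   (gm * AT z * F - gm * h * AT z * (T + p%:R^-1 * ps) + gm / p%:R * (AT z * ps)) / N +
    gm / p%:R * (F * (AT z * ps)) = gm * AT z * r.
- apply: rpredM => //; apply: rpredM; [exact: pint_gam | exact: over_AT].
- exact: P0.
- exact: hh1.
- exact: er.
move=> ps T F h N N0 eh eF.
move: (AT z) (gam _ _) => A g.
have -> : g * A * F - g * h * A * (T + p%:R^-1 * ps) + g / p%:R * (A * ps) =
  g * A * (F - h * T) + g / p%:R * (A * ps) * (1 - h) by ring.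
by rewrite eF eh; field; rewrite N0 pr0.
Qed.

Lemma pint_ZT N : (N <= B)%N -> ZT N \in pint.
Proof.
have [->|N0] := posnP N.
  move=> _; rewrite cfB cfCM cfD cf0_dil // cf0M LT0 // mul0r !integ0 addr0 mulr0 subrr.
  exact: rpred0.
move=> le; have n0 : N%:R != 0 :> rat by rewrite pnatr_eq0 -lt0n.
have -> : ZT N = D ZT N / N%:R by rewrite cf_D mulrC mulKf.
have [/dvdnP[z zE]|nd] := boolP (p %| N)%N.
  have {zE} zE : N = (p * z)%N by rewrite zE mulnC.
  subst N; have z0 : (0 < z)%N by move: N0; rewrite muln_gt0 => /andP[].
  rewrite D_ZT' cfD cfB cfD cf_D cfCM dil_mul //.
  have -> : (vT (p * z)%N + (p * z)%:R * (lamT * vT) (p * z)%N - (lamT * BT) (p * z)%N +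
     gm / p%:R * (lamT * AT) z) / (p * z)%:R =
   ((vT (p * z)%N - (lamT * BT) (p * z)%N + gm / p%:R * (lamT * AT) z) / (p * z)%:R
    + gm / p%:R * (Fz z * (lamT * AT) z)) +
   ((lamT * vT) (p * z)%N - gm / p%:R * (lamT * wF) z) +
   gm / p%:R * ((lamT * wF) z - Fz z * (lamT * AT) z).
    move: n0; move: (vT _) (_%:R) ((lamT * vT) _) ((lamT * BT) _) ((lamT * AT) _) ((lamT * wF) _) (Fz z).
    by move: (gam _ _) => g v M a b d e f M0; field; rewrite M0 pr0.
  apply: rpredD; last exact: conv_lipschitz.
  by apply: rpredD; [exact: bracket_ZT | exact: conv_lamT_vT].
rewrite rpredM ?pint_intV // D_ZT cfB cfCM; apply: rpredB.
  rewrite cfM rpred_sum // => i _; rewrite rpredM ?pint_vT ?over_omT //.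
  exact: leq_trans (leq_subr _ _) le.
rewrite cfM mulr_sumr rpred_sum // => i _.
have -> : gm / p%:R * (LT p i * dil p AT (N - i)%N) = gm * (LT p i / p%:R) * dil p AT (N - i)%N.
  by move: (gam _ _) (LT _ _) (dil _ _ _) => g a b; ring.
apply: rpredM; last by apply: over_dil; apply: over_AT.
by apply: rpredM; [exact: pint_gam | exact: pint_LT].
Qed.

(** * Return from t to q: double integrals of g2 and g3 in log q *)

Definition E1q := integ (integ g2q).
Definition E3q := integ (integ g3q).

Lemma g2q0 : g2q 0%N = 0. Proof. by rewrite g2q.unlock cf_qXM. Qed.
Lemma g3q0 : g3q 0%N = 0. Proof. by rewrite g3q.unlock !cf0M g2q0 mulr0 mul0r. Qed.

Lemma u1T_tq : scomp u1T tq = integ g2q.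
Proof.
apply: D_eq; last by rewrite cf0_comp !integ0.
rewrite (D_comp_log _ tq0 D_tq) D_u1T (D_integ g2q0) AT.unlock (compM _ _ tq0).
by rewrite (comp_qX tq0) wt_tq g2qE D_tq; ring.
Qed.

Lemma u3T_tq : scomp u3T tq = integ g3q.
Proof.
apply: D_eq; last by rewrite cf0_comp !integ0.
rewrite (D_comp_log _ tq0 D_tq) D_u3T (D_integ g3q0) BT.unlock (compM _ wt tq0) (compM 16 _ tq0).
by rewrite comp_nat (comp_qXn 3 tq0) wt_tq g3q.unlock g2qE D_tq; ring.
Qed.

Lemma e1T_tq : scomp e1T tq = E1q.
Proof.
apply: D_eq; last by rewrite cf0_comp !integ0.
rewrite (D_comp_log _ tq0 D_tq) D_e1T D_integ ?integ0 // (compM _ _ tq0) u1T_tq.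
by rewrite mulrAC omT_tq mul1r.
Qed.

Lemma e3T_tq : scomp e3T tq = E3q.
Proof.
apply: D_eq; last by rewrite cf0_comp !integ0.
rewrite (D_comp_log _ tq0 D_tq) D_e3T D_integ ?integ0 // (compM _ _ tq0) u3T_tq.
by rewrite mulrAC omT_tq mul1r.
Qed.

Lemma E1q_sT : scomp E1q sT = e1T.
Proof. by rewrite -e1T_tq (compA _ tq0 sT0) tq_sT comp_id. Qed.
Lemma DE1q_sT : scomp (D E1q) sT = u1T.
Proof. by rewrite D_integ ?integ0 // -u1T_tq (compA _ tq0 sT0) tq_sT comp_id. Qed.

Lemma scomp_dil x : scomp x (dil p sT) = dil p (scomp x sT).
Proof. by rewrite dil.unlock (compA _ sT0 (qXn0 p_gt0)). Qed.

(** Composed with t(q) this is E3(q) - (gm / p^2) E1(q^p), because s(t(q)) = q. *)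
Definition ZZ := e3T - fpsC (gm / p%:R ^+ 2) * scomp E1q (sT ^+ p).

Lemma pint_ZZ N : (N <= B)%N -> ZZ N \in pint.
Proof.
move=> le; have hD : fps_over pint (D (D E1q)).
  by rewrite D_integ ?integ0 // (D_integ g2q0); apply: over_g2q.
have s0 : dil p sT 0%N = 0 by rewrite cf0_dil // sT0.
have := taylor pE (LT0 p) s0 (over_dil p (over_sT _)) hD (fdvd_LT pp pE) N.
rewrite -(sT_powp pp) !scomp_dil E1q_sT DE1q_sT => -[r hr er].
have -> : ZZ N = ZT N - gm * r.
  rewrite /ZZ /ZT !cfB !cfCM cfD.
  have -> : scomp E1q (sT ^+ p) N = p%:R ^+ 2 * r + (dil p e1T N + (dil p u1T * LT p) N).
      by rewrite -er !cfB; ring.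
  rewrite [LT p * _]mulrC; move: (gam _ _) (e3T N) (dil p e1T N) ((dil p u1T * LT p) N) => g a b d.
  by field.
apply: rpredB; first exact: pint_ZT.
by apply: rpredM => //; exact: pint_gam.
Qed.

Lemma g3q_g2q N : (N <= B)%N ->
  E3q N - gm / p%:R ^+ 2 * dil p E1q N \in pint.
Proof.
move=> le.
have sp0 : (sT ^+ p) 0%N = 0 by rewrite cf0X sT0 expr0n gtn_eqF.
have -> : E3q N - gm / p%:R ^+ 2 * dil p E1q N = scomp ZZ tq N.
  rewrite compB (compM _ _ tq0) compC e3T_tq (compA _ sp0 tq0) (compX _ _ tq0) sT_tq.
  by rewrite cfB cfCM dil.unlock.
rewrite rpred_sum // => k _; rewrite rpredM ?(overX _ (over_tq _)) //.
by apply: pint_ZZ; apply: leq_trans le; rewrite -ltnS.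
Qed.

Lemma g3q_congr N : (0 < N)%N -> (p * N <= B)%N ->
  pdvd ((p * N)%:R ^+ 2) (g3q (p * N)%N - gm * g2q N).
Proof.
move=> N0 le; have h := g3q_g2q le.
exists (E3q (p * N)%N - gm / p%:R ^+ 2 * dil p E1q (p * N)%N) => //.
have n0 : N%:R != 0 :> rat by rewrite pnatr_eq0 -lt0n.
rewrite dil_mul // /E3q /E1q /= natrM.
by move: n0; move: (N%:R) (gam _ _) (g3q _) (g2q _) => n g a b n0; field; rewrite n0 pr0.
Qed.

End Descent.

(** * Conclusion *)

Lemma C_nat (N : nat) : (C N%:Z)%:~R = Hq N.+1 :> rat.
Proof. by rewrite /C /lcoef opprK addrC -[1 + _]/(Posz N.+1). Qed.

Lemma cf_Hq N : Hq N.+1 = g3q N + N%:R ^+ 2 * Kq N.+1.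
Proof.
have := congr1 (fun x : fps => x N.+1) Hq_g3q.
rewrite cfB cf_qXM cfB cf_D cfB cf_D => /eqP; rewrite subr_eq => /eqP ->.
by rewrite -natr1; ring.
Qed.

Lemma g2coef_nat (n : nat) : (g2coef n%:Z)%:~R = g2q n :> rat.
Proof.
rewrite g2q.unlock cf_qXM -fps_of_g2 /g2coef /lcoef; case: n => [|n] //.
by rewrite -[n.+1%:Z]/(1 + n%:Z) addrC addrA addNr add0r.
Qed.

Lemma g2q1 : g2q 1%N = 1.
Proof. by rewrite g2q.unlock cf_qXM cf0_dil // cf0X euler0 expr1n. Qed.

Section Final.
Variables (p : nat) (pp : prime p) (c : nat) (pE : p = (4 * c + 3)%N).
Local Notation pint := (pint_at pp).
Local Notation pdvd := (pdvd pp).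

Let p_gt0 : (0 < p)%N := prime_gt0 pp.
Let pr0 : (p%:R : rat) != 0. Proof. by rewrite pnatr_eq0 -lt0n. Qed.

Lemma g2q_scaleX m n : g2q (p ^ (2 * m) * n)%N = p%:R ^+ (2 * m) * g2q n.
Proof.
elim: m n => [|m IH] n; first by rewrite muln0 expn0 mul1n mul1r.
rewrite mulnS expnD -mulnA (g2q_scale _ pp pE) IH exprD mulrA //.
Qed.

Lemma base_index B : exists nK, (4 * nK + 3 = p ^ (2 * B).+1)%N.
Proof.
elim: B => [|B [nK e]]; first by exists c; rewrite muln0 expn1 pE.
(* The second summand is 3 (p^2 - 1) / 4. *)
exists (nK * (p * p) + (3 * (4 * c * c + 6 * c + 2)))%N.
have -> : (p ^ (2 * B.+1).+1 = p ^ (2 * B).+1 * (p * p))%N.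
  by rewrite mulnn -expnD; congr (_ ^ _)%N; lia.
by rewrite -e pE; lia.
Qed.

(** The precision is fixed by the larger index M n, so that one constant serves both M and M n. The
    modulus is M^2, and g2 at p^(2m) n supplies the factor p^(2m). *)
Lemma C_congr m n (M := (p ^ (2 * m + 1))%N) : (0 < n)%N ->
  exists g : rat, [/\ g != 0, g^-1 \in pint, g \in pint,
    pdvd (p%:R ^+ (4 * m + 2)) ((C M%:Z)%:~R - g * p%:R ^+ (2 * m)) &
    pdvd (p%:R ^+ (4 * m + 2)) ((C (M * n)%N%:Z)%:~R - g * p%:R ^+ (2 * m) * g2q n)].
Proof.
move=> n0; have [nK nKE] := base_index (M * n).
exists (gam p nK).
have key k : (0 < k)%N -> (k <= n)%N ->
    pdvd (p%:R ^+ (4 * m + 2)) ((C (M * k)%N%:Z)%:~R - gam p nK * p%:R ^+ (2 * m) * g2q k).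
  move=> k0 kn; have ME : (M * k = p * (p ^ (2 * m) * k))%N.
    by rewrite /M addn1 expnS mulnA.
  have pk : (0 < p ^ (2 * m) * k)%N by rewrite muln_gt0 expn_gt0 p_gt0 k0.
  have lek : (p * (p ^ (2 * m) * k) <= M * n)%N by rewrite -ME leq_mul2l kn orbT.
  have hB : (2 * (M * n) <= (2 * (M * n)).+1)%N by [].
  have := g3q_congr pp pE nKE hB pk lek.
  rewrite g2q_scaleX -ME => h.
  have -> : (C (M * k)%N%:Z)%:~R - gam p nK * p%:R ^+ (2 * m) * g2q k =
    (g3q (M * k)%N - gam p nK * (p%:R ^+ (2 * m) * g2q k)) + (M * k)%:R ^+ 2 * Kq (M * k).+1.
    rewrite C_nat cf_Hq; move: (gam _ _) (g3q _) (Kq _) (g2q _) (_ ^+ (2 * m)) (_ ^+ 2) => g a b d x y.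
    by ring.
  apply: (@pdvd_trans _ _ _ ((M * k)%:R ^+ 2)).
    exists (k%:R ^+ 2); first by rewrite rpredX ?rpred_nat.
    by rewrite natrM exprMn /M natrX -exprM; congr (_ ^+ _ * _); lia.
  apply: pdvdD => //; apply: pdvd_self; apply: over_Kq.
split; [exact: gam_neq0 | exact: pint_gamV pE _ | exact: pint_gam | | exact: key].
by have := key 1%N isT n0; rewrite muln1 g2q1 mulr1.
Qed.

Lemma vp_int (z : int) : vp p z%:~R = (logn p `|z|%N)%:Z.
Proof. by rewrite /vp numq_int denq_int /= logn1 subr0. Qed.

Lemma vp_ge_pint (k : nat) (y : rat) : y \in pint -> vp_ge p (p%:R ^+ k * y) k%:Z.
Proof.
move=> /pintP[a [b nb e]]; set x := _ * y; have [->|x0] := eqVneq x 0; first by left.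
right; have e2 : numq x * b%:Z = (p ^ k)%N%:Z * a * denq x.
  apply/eqP; rewrite -(eqr_int rat) !rmorphM /= -e numqE -!pmulrn natrX /x; apply/eqP; ring.
have nx : (0 < `|numq x|)%N by rewrite absz_gt0 numq_eq0.
have dx : (0 < `|denq x|)%N by rewrite absz_gt0 denq_neq0.
have b0 : (0 < b)%N by case: b nb {e e2} => //; rewrite dvdn0.
have pk0 : (0 < p ^ k)%N by rewrite expn_gt0 p_gt0.
have a0 : (0 < `|a|)%N.
  rewrite absz_gt0; apply/eqP => az; move: e2; rewrite az mulr0 mul0r => /eqP.
  by rewrite mulf_eq0 numq_eq0 (negbTE x0) /= eqz_nat; case: (b) b0.
have := congr1 (logn p \o absz) e2; rewrite /= !abszM !lognM ?muln_gt0 ?pk0 ?a0 ?dx //.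
have -> : logn p b = 0%N by apply/eqP; rewrite eqn0Ngt logn_gt0 mem_primes pp b0.
rewrite pfactorK // /vp addn0 => ->.
by rewrite !PoszD -addrA -addrA; lia.
Qed.

Lemma pint_pV : (p%:R^-1 : rat) \notin pint.
Proof.
apply/negP => /pintP[a [b nb e]]; case/negP: nb.
have /eqP : (b%:Z)%:~R = (p%:Z * a)%:~R :> rat.
  by rewrite rmorphM /= -e mulrA divff // mul1r.
by rewrite eqr_int => /eqP /(congr1 absz); rewrite abszM /= => ->; rewrite dvdn_mulr.
Qed.

(** The two hypotheses together say that u is a p-adic unit. *)
Lemma pint_inv u : u \in pint -> u / p%:R \notin pint -> u^-1 \in pint.
Proof.
move=> /pintP[a [b nb e]] npu; have u0 : u != 0.
  by apply: contraNneq npu => ->; rewrite mul0r rpred0.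
apply: (@pint_frac _ pp _ `|a|%N (sgz a * b%:Z)).
  apply: contra npu => /dvdnP[k ek]; apply: (@pint_frac _ pp _ b (sgz a * k%:Z)) => //.
  by rewrite mulrAC e {1}[a]intEsg ek PoszM !rmorphM /= mulrA mulfK.
have ae : `|a|%N%:R = (sgz a * a)%:~R :> rat by rewrite -abszEsg.
by rewrite ae !rmorphM /= -e; field.
Qed.

Lemma main_pos m n (M := (p ^ (2 * m + 1))%N) : (0 < n)%N ->
  [/\ C M%:Z != 0, vp p (C M%:Z)%:~R = (2 * m)%N%:Z &
      vp_ge p ((C (M * n)%N%:Z)%:~R / (C M%:Z)%:~R - g2q n) (2 * m + 2)%N%:Z].
Proof.
move=> n0; have [g [g0 gV gi [r hr e1] [s hs e2]]] := C_congr m n0.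
set x : rat := (C _)%:~R in e1; set y : rat := (C _)%:~R in e2.
have q0 : p%:R ^+ (2 * m) != 0 :> rat by rewrite expf_neq0.
have pk : p%:R ^+ (4 * m + 2) = p%:R ^+ (2 * m) * p%:R ^+ (2 * m + 2) :> rat.
  by rewrite -exprD; congr (_ ^+ _); lia.
(* C(M) = p^(2m) u, where u is congruent to the unit g modulo p^(2m+2) and so is a unit; dividing
   the congruence modulo p^(4m+2) by C(M) then leaves p^(2m+2). *)
set u := g + p%:R ^+ (2 * m + 2) * r.
have ex : x = p%:R ^+ (2 * m) * u.
  by move/eqP: e1; rewrite subr_eq => /eqP ->; rewrite pk /u; ring.
have ui : u \in pint by rewrite rpredD // !rpredM ?rpredX ?rpred_nat.
have npu : u / p%:R \notin pint.
  apply: contra pint_pV => h.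
  have -> : p%:R^-1 = g^-1 * (u / p%:R - p%:R ^+ (2 * m).+1 * r).
    by rewrite /u addn2 exprS; move: (_ ^+ (2 * m).+1) => q; field; rewrite g0 pr0.
  by rewrite rpredM // rpredB // rpredM ?rpredX ?rpred_nat.
have u0 : u != 0 by apply: contraNneq npu => ->; rewrite mul0r rpred0.
have x0 : x != 0 by rewrite ex mulf_neq0.
have z0 : C M%:Z != 0 by move: x0; rewrite /x intr_eq0.
split=> //.
  rewrite vp_int; congr Posz; apply/eqP; rewrite eqn_leq leqNgt -!pfactor_dvdn ?absz_gt0 //.
  apply/andP; split; last first.
    by apply: (pint_dvd (pp := pp)); rewrite -/x ex natrX mulrC mulKf.
  apply: contra npu => /dvdnP[k ek].
  have [e ee] : exists e : int, C M%:Z = e * (p ^ (2 * m).+1)%N%:Z.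
    exists (sgz (C M%:Z) * k%:Z); rewrite -mulrA -PoszM -ek.
    by rewrite [LHS]intEsg.
  have -> : u / p%:R = e%:~R.
    have pm0 : p%:R ^+ (2 * m).+1 != 0 :> rat by rewrite expf_neq0.
    apply: (mulIf pm0); rewrite exprS mulrA divfK // mulrC -ex /x ee rmorphM /= -pmulrn natrX exprS //.
  exact: rpred_int.
have -> : y / x - g2q n = p%:R ^+ (2 * m + 2) * ((s - r * g2q n) * u^-1).
  have -> : y = g * p%:R ^+ (2 * m) * g2q n + p%:R ^+ (4 * m + 2) * s by rewrite -e2; ring.
  rewrite ex pk; move: u0; rewrite /u.
  move: (g2q n) (p%:R ^+ (2 * m)) (p%:R ^+ (2 * m + 2)) q0 => G P Q q0 u0.
  by field; rewrite u0 q0.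
apply: vp_ge_pint; apply: rpredM; last exact: pint_inv.
by apply: rpredB => //; apply: rpredM => //; apply: over_g2q.
Qed.

End Final.

(* The coefficient of q^n in H | U(M) is C(M n); the second claim says that
   every coefficient of (H | U(M))/C(M) - g2 has v_p >= 2m+2. *)
Theorem theorem5p1 (p m : nat) :
  prime p -> (p %% 4 = 3)%N ->
  let M : int := (p ^ (2 * m + 1))%N%:Z in
  [/\ C M != 0,
      vp p ((C M)%:~R) = (2 * m)%N%:Z
    & forall n : int,
        vp_ge p ((C (M * n))%:~R / (C M)%:~R - (g2coef n)%:~R) (2 * m + 2)%N%:Z].
Proof.
move=> pp p3; have pE : p = (4 * (p %/ 4) + 3)%N by rewrite {1}(divn_eq p 4) p3 mulnC.
move=> M; have [C0 vC _] := main_pos pp pE m (isT : (0 < 1)%N).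
split=> // -[[|n]|n].
- by left; rewrite mulr0 (C_nat 0) cf_Hq g3q0 expr0n mul0r addr0 mul0r.
- rewrite (g2coef_nat n.+1); have [_ _] := main_pos pp pE m (isT : (0 < n.+1)%N).
  by rewrite PoszM.
(* For negative n the index M n is at most -3, below the leading exponent -1 of H. *)
- left; have -> : C (M * Negz n) = 0.
    rewrite /C /lcoef NegzE mulrN opprK /M -PoszM.
    have : (2 < p ^ (2 * m + 1) * n.+1)%N.
      have p2 : (2 < p)%N by rewrite pE; lia.
      have := expn_gt0 p (2 * m); rewrite addn1 expnS; nia.
    by case: (_ * n.+1)%N => [|[|k]].
  by rewrite mul0r /g2coef /lcoef NegzE -opprD /= subrr.
Qed.
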